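(* Let $t \in (1,2]$, $s \in (2-t,1]$ and $\sigma \in [0,s)$. There exists a constant $c = c(\sigma,s,t) > 0$ such that the following holds for every $C \geq 1$ and every $\delta \in 2^{-\mathbb{N}}$. Let $\mu$ be a Borel measure on $B(1) \subset \mathbb{R}^{2}$ satisfying $\mu(B(p,r)) \leq C r^{t}$ for all $p \in \mathbb{R}^{2}$ and $r > 0$. For every $p \in \mathcal{D}_{\delta}(\operatorname{spt} \mu)$, let $\mathcal{T}_{p} \subset \mathcal{T}^{\delta}$ be a non-empty $(\delta,s,C)$-set such that $T \cap p \neq \emptyset$ for all $T \in \mathcal{T}_{p}$, and let $\mathcal{T} := \bigcup_{p \in \mathcal{D}_{\delta}(\operatorname{spt}\mu)} \mathcal{T}_{p}$. Then $$\mathcal{H}^{\sigma+1}_{\delta,\infty}(\mathcal{T}) \geq c\, \mu(\mathbb{R}^{2})/C^{3}.$$ In particular, $\mathcal{T}$ contains a Katz-Tao $(\delta,\sigma+1)$-set $\mathcal{T}'$ of cardinality $|\mathcal{T}'| \geq c\, \mu(\mathbb{R}^{2})\, \delta^{-(\sigma+1)}/C^{3}$.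
   Context: $B(p,r)$ is the ball of radius $r$ centred at $p$; $B(1)$ is the closed unit ball of $\mathbb{R}^{2}$ centred at the origin. $2^{-\mathbb{N}} = \{2^{-n} : n \in \mathbb{N}\}$. Dyadic squares and tubes: for $\delta \in 2^{-\mathbb{N}}$, $\mathcal{D}_{\delta}(\operatorname{spt}\mu)$ denotes the family of standard (half-open) dyadic squares of side $\delta$ in $\mathbb{R}^{2}$ which intersect $\operatorname{spt}\mu$, and $\mathcal{D}_{\delta} = \mathcal{D}_{\delta}([0,1)\times\mathbb{R})$ denotes the standard dyadic squares of side $\delta$ contained in the parameter space $[0,1) \times \mathbb{R}$. For $(\theta,r) \in [0,1) \times \mathbb{R}$ let $\ell_{\theta,r} = \{z \in \mathbb{R}^{2} : z \cdot (\cos 2\pi\theta,\sin 2\pi\theta) = r\}$. For $Q \in \mathcal{D}_{\delta}([0,1)\times \mathbb{R})$ let $T(Q) := \bigcup\{\ell_{\theta,r} : (\theta,r) \in Q\}$, and let $\mathcal{T}^{\delta} := \{T(Q) : Q \in \mathcal{D}_{\delta}([0,1)\times\mathbb{R})\}$ be the family of dyadic $\delta$-tubes. Let $|\cdot|_{\delta}$ be the $\delta$-covering number. A subset $P$ of a metric space $X$ is a $(\delta,s,C)$-set if $|P \cap B(x,r)|_{\delta} \leq C r^{s} |P|_{\delta}$ for all $x \in X$, $r \geq \delta$. It is a Katz-Tao $(\delta,s,C)$-set if $|P \cap B(x,r)|_{\delta} \leq C (r/\delta)^{s}$ for all $x \in X$, $r \geq \delta$; it is called simply a Katz-Tao $(\delta,s)$-set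 if the constant $C$ is absolute. A family $\mathcal{T} \subset \mathcal{T}^{\delta}$ is called a $(\delta,s,C)$-set (resp. Katz-Tao $(\delta,s,C)$-set) if the union of the parameter squares $\{Q : T(Q) \in \mathcal{T}\}$ is a $(\delta,s,C)$-set (resp. Katz-Tao $(\delta,s,C)$-set) in $\mathbb{R}^{2}$. $\mathcal{H}^{s}_{\delta,\infty}$ is the variant of $s$-dimensional Hausdorff content in which the covering sets are balls of radii in $[\delta,\infty)$, i.e. $\mathcal{H}^{s}_{\delta,\infty}(A) = \inf \sum_{i} \operatorname{diam}(B_{i})^{s}$ over countable covers of $A$ by such balls $B_{i}$. For $\mathcal{T} \subset \mathcal{T}^{\delta}$, $\mathcal{H}^{s}_{\delta,\infty}(\mathcal{T})$ denotes the content of the (union of the) parameter squares $\{Q \in \mathcal{D}_{\delta} : T(Q) \in \mathcal{T}\}$. *)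

(* Defs.v *)
From HB Require Import structures.
From mathcomp Require Import all_boot all_order all_algebra.
From mathcomp Require Import finmap.
From mathcomp Require Import all_classical all_reals all_analysis.

Set Implicit Arguments.
Unset Strict Implicit.
Unset Printing Implicit Defensive.
Import Order.TTheory GRing.Theory Num.Theory.
Import numFieldNormedType.Exports.

Local Open Scope classical_set_scope.
Local Open Scope ring_scope.

(* The norm of R * R in the library is the sup norm, whereas all the balls,
   covering numbers and diameters below are Euclidean, and balls are closed. *)
Definition edist (R : realType) (x y : R * R) : R :=
  Num.sqrt ((x.1 - y.1) ^+ 2 + (x.2 - y.2) ^+ 2).

Definition eball (R : realType) (x : R * R) (r : R) : set (R * R) :=
  [set y | edist x y <= r].

Definition diam (R : realType) (A : set (R * R)) : \bar R :=
  ereal_sup [set (edist z.1 z.2)%:E | z in A `*` A].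

Definition spt (R : realType) (mu : set (R * R) -> \bar R) : set (R * R) :=
  [set x | forall U : set (R * R), open U -> U x -> (0 < mu U)%E].

Definition dyadic_scale (R : realType) : set R :=
  [set (2 ^- n : R) | n in [set: nat]].

Definition dyadic_square (R : realType) (delta : R) (k l : int) :
    set (R * R) :=
  [set z | k%:~R * delta <= z.1 < (k + 1)%:~R * delta /\
           l%:~R * delta <= z.2 < (l + 1)%:~R * delta].

Definition dyadic (R : realType) (delta : R) : set (set (R * R)) :=
  [set Q | exists k l : int, Q = dyadic_square delta k l].

Definition dyadic_meeting (R : realType) (delta : R) (A : set (R * R)) :
    set (set (R * R)) :=
  [set Q | dyadic delta Q /\ Q `&` A !=set0].

(* The parameter space [0, 1) x R. *)
Definition params (R : realType) : set (R * R) := [set z | 0 <= z.1 < 1].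

Definition param_square (R : realType) (delta : R) : set (set (R * R)) :=
  [set Q | dyadic delta Q /\ Q `<=` @params R].

Definition line (R : realType) (theta r : R) : set (R * R) :=
  [set z | z.1 * cos (2 * pi * theta) + z.2 * sin (2 * pi * theta) = r].

Definition tube (R : realType) (Q : set (R * R)) : set (R * R) :=
  \bigcup_(q in Q) line q.1 q.2.

Definition dyadic_tube (R : realType) (delta : R) : set (set (R * R)) :=
  @tube R @` param_square delta.

Definition param_union (R : realType) (delta : R) (T : set (set (R * R))) :
    set (R * R) :=
  \bigcup_(Q in [set Q | param_square delta Q /\ T (tube Q)]) Q.

(* The least number of closed balls of radius delta that cover P; it is +oo
   when finitely many do not suffice. *)
Definition covering_number (R : realType) (delta : R) (P : set (R * R)) :
    \bar R :=
  ereal_inf [set n%:R%:E | n in [set n : nat |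
    exists x : 'I_n -> R * R, P `<=` \bigcup_i eball (x i) delta]].

Definition delta_set (R : realType) (delta s C : R) (P : set (R * R)) : Prop :=
  forall (x : R * R) (r : R), delta <= r ->
    (covering_number delta (P `&` eball x r) <=
     (C * r `^ s)%:E * covering_number delta P)%E.

Definition katz_tao (R : realType) (delta s C : R) (P : set (R * R)) : Prop :=
  forall (x : R * R) (r : R), delta <= r ->
    (covering_number delta (P `&` eball x r) <= (C * (r / delta) `^ s)%:E)%E.

Definition tube_delta_set (R : realType) (delta s C : R)
    (T : set (set (R * R))) : Prop :=
  delta_set delta s C (param_union delta T).

Definition tube_katz_tao (R : realType) (delta s C : R)
    (T : set (set (R * R))) : Prop :=
  katz_tao delta s C (param_union delta T).

(* The covers are indexed by subsets of nat, so they may be finite. *)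
Definition content (R : realType) (delta s : R) (A : set (R * R)) : \bar R :=
  ereal_inf [set S | exists (D : set nat) (x : nat -> R * R) (r : nat -> R),
    [/\ forall i, D i -> delta <= r i,
        A `<=` \bigcup_(i in D) eball (x i) (r i) &
        S = (\esum_(i in D) (diam (eball (x i) (r i))) `^ s)%E]].

Definition tube_content (R : realType) (delta s : R)
    (T : set (set (R * R))) : \bar R :=
  content delta s (param_union delta T).

(* Main.v *)
Require Import Defs.
From HB Require Import structures.
From mathcomp Require Import all_boot all_order all_algebra.
From mathcomp Require Import finmap.
From mathcomp Require Import all_classical all_reals all_analysis.
From mathcomp Require Import zify ring lra.

(** Let [mu] satisfy the ball condition of dimension [t > 1], let
[a = sigma + 1], and let [X] be a maximal family of parameter squares of side
[delta] in the union of the [T p] that satisfies the Katz-Tao condition of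
dimension [a]. Both conclusions follow from
[#X >= c * mu setT * delta ^ (- a) / C ^ 3]: counting [X] in the balls of a
cover bounds the content ([content_ge]), and the tubes of [X] form the second
family, since only boundedly many squares have the same tube ([tube_twin]).

By maximality every square of the union lies below a saturated node, that is, a
dyadic square of some side [rho] which contains at least [(rho / delta) ^ a / 2]
members of [X] ([greedy_selection]). The maximal saturated nodes are disjoint,
so that the sum of [rho ^ a] over them is at most [2 * delta ^ a * #X]
([tops_total]), and those of a fixed side satisfy the Katz-Tao condition
themselves ([tops_window]). The set [T p] has dimension [s] and is covered by
these nodes; hence for some side [rho], which depends on [p], it meets at least
about [rho ^ (eps - s) / C] of them ([delta_set_cover]). If [M] is the mass of
the points [p] with a given [rho] and [N] is the number of nodes of that side,
there are [M * rho ^ (eps - s) / C] weighted incidences between the points and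
the tubes of width [rho]. When [a + t >= 3], [incidence_bound] bounds them above
by [rho ^ (1 - a / 2 - eps) * (C * M * N) ^ (1 / 2)], up to a constant. As
[sigma < s], comparing the two gives [N * rho ^ a >= c * M / C ^ 3] if [eps] is
small, and the sum over [rho] gives the bound for [#X] ([discrete_furstenberg]).
When [a + t < 3], a larger exponent [a'], which is still less than [s + 1] and
at least [3 - t], serves in the incidence bound; the Katz-Tao condition of
dimension [a] implies that of dimension [a'].

The incidence bound comes from a comparison of scales. Consider, as a function
of the line, the mass of its neighbourhood of width [rho] divided by [rho], and
the same for the width [K * rho]. The mean square of the difference over all
lines is a double integral of a kernel [k (x - y)], where [k v] is the mean over
all directions of a mean-zero profile of the projection of [v]. Integration by
parts in the angle turns the mean-zero property into a gain of [rho / |v|]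
([by_parts_sum]), so that [k v] is at most about [1 / rho] and [rho / |v| ^ 2]
([band_pair]), and the mean square is at most about [C * M * rho ^ (t - 1)] for
[1 < t < 2] ([band_energy]). By Cauchy-Schwarz this bounds the contribution of
the difference to the incidences ([high_part]). What is left are the incidences
with the wider tubes, which are bounded by those of the parent squares at the
scale [K * rho] ([low_part]). Each such step costs a bounded factor, in total a
power [rho ^ (- eps)] if [K] is large ([tube_sum_bound]).

The angles are sampled at the multiples of a small [2 ^- N], and integrals over
the offset of a line are replaced by the positivity of Gram matrices of
intervals ([overlap_gram_ge0]), so that the argument up to
[discrete_furstenberg] deals with finite sums only. *)

Set Implicit Arguments.
Unset Strict Implicit.
Unset Printing Implicit Defensive.
Import Order.TTheory GRing.Theory Num.Theory.
Import numFieldNormedType.Exports.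

Local Open Scope classical_set_scope.
Local Open Scope ring_scope.

(** * Gram matrices of intervals *)

(** Subtracting the least abscissa from all the others changes the form by a
square times a real number, and kills the row of that abscissa: induction on the
number of points. The zero-sum condition makes the form translation invariant,
so that the abscissae may be taken nonnegative. *)
Lemma min_kernel_ge0 (R : realDomainType) (s : seq (R * R)) :
  \sum_(e <- s) e.1 = 0 ->
  0 <= \sum_(e <- s) \sum_(f <- s) e.1 * f.1 * Num.min e.2 f.2.
Proof.
have key : forall n (s : seq (R * R)), size s = n ->
    all (fun e => 0 <= e.2) s ->
    0 <= \sum_(e <- s) \sum_(f <- s) e.1 * f.1 * Num.min e.2 f.2.
  elim=> [|n IH] {}s.
    by move/size0nil => -> _; rewrite big_nil.
  move=> sn s0.
  have [e0 e0s mine0] : exists2 e0, e0 \in s & forall e, e \in s -> e0.2 <= e.2.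
    clear -sn; elim: s n sn => // e s IHs n _.
    case: s IHs => [|e' s] IHs.
      by exists e; rewrite ?mem_seq1// => f; rewrite mem_seq1 => /eqP ->.
    have [//|e1 e1s H] := IHs (size s).
    have [le|lt] := leP e1.2 e.2.
      exists e1; first by rewrite inE e1s orbT.
      by move=> f; rewrite inE => /orP[/eqP -> //|/H].
    exists e; first by rewrite inE eqxx.
    move=> f; rewrite inE => /orP[/eqP -> //|/H h].
    by rewrite (le_trans (ltW lt)).
  pose s' := [seq (e.1, e.2 - e0.2) | e <- rem e0 s].
  have ps := perm_to_rem e0s.
  have sz : size s' = n by rewrite size_map size_rem// sn.
  have pos' : all (fun e => 0 <= e.2) s'.
    by apply/allP => e /mapP[f /mem_rem fs ->] /=; rewrite subr_ge0 mine0.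
  have := IH _ sz pos'.
  rewrite big_map.
  under eq_bigr do rewrite big_map.
  move=> /= H.
  have -> : \sum_(e <- s) \sum_(f <- s) e.1 * f.1 * Num.min e.2 f.2 =
     e0.2 * (\sum_(e <- s) e.1) ^+ 2 +
     \sum_(e <- s) \sum_(f <- s) e.1 * f.1 * Num.min (e.2 - e0.2) (f.2 - e0.2).
    rewrite expr2 mulr_suml mulr_sumr -big_split /=; apply: eq_bigr => e _.
    rewrite mulr_sumr mulr_sumr -big_split /=; apply: eq_bigr => f _.
    by rewrite -addr_minl; ring.
  apply: addr_ge0.
    by rewrite mulr_ge0 ?sqr_ge0//; exact: (allP s0).
  rewrite (perm_big _ ps) /= big_cons.
  have z : forall e, e \in s -> e0.1 * e.1 * Num.min (e0.2 - e0.2) (e.2 - e0.2) = 0.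
    by move=> e es; rewrite subrr min_l ?mulr0// subr_ge0 mine0.
  rewrite big_seq big1 ?add0r; last by move=> e /andP[/z -> _] || move=> e /z.
  rewrite -[X in 0 <= X]/(\sum_(j <- rem e0 s) _).
  rewrite (eq_big_seq (fun j => \sum_(f <- rem e0 s)
     j.1 * f.1 * Num.min (j.2 - e0.2) (f.2 - e0.2))) // => j /mem_rem js.
  rewrite (perm_big _ ps) /= big_cons minC (mulrC j.1) z ?add0r//.
move=> s0.
have [M HM] : exists M, forall e, e \in s -> - M <= e.2.
  clear; elim: s => [|e s [M H]]; first by exists 0.
  exists (Num.max M (- e.2)) => f; rewrite inE => /orP[/eqP ->|/H h].
    by rewrite lerNl le_max lexx orbT.
  by apply: le_trans h; rewrite lerN2 le_max lexx.
have := key _ [seq (e.1, e.2 + M) | e <- s] erefl.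
rewrite big_map; under eq_bigr do rewrite big_map.
move=> /= H.
have -> : \sum_(e <- s) \sum_(f <- s) e.1 * f.1 * Num.min e.2 f.2 =
  \sum_(e <- s) \sum_(f <- s) e.1 * f.1 * Num.min (e.2 + M) (f.2 + M).
  transitivity (\sum_(e <- s) \sum_(f <- s) e.1 * f.1 * Num.min e.2 f.2 +
     M * (\sum_(e <- s) e.1) ^+ 2); first by rewrite s0 expr0n mulr0 addr0.
  rewrite expr2 mulr_suml mulr_sumr -big_split /=; apply: eq_bigr => e _.
  rewrite mulr_sumr mulr_sumr -big_split /=; apply: eq_bigr => f _.
  by rewrite -addr_minl; ring.
apply: H; apply/allP => e /mapP[f fs ->] /=.
by rewrite -lerBlDr sub0r HM.
Qed.

(** Length of the intersection of the intervals [[a, b]] and [[c, d]]. *)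
Definition overlap (R : realDomainType) (a b c d : R) : R :=
  Num.min b d - Num.min b c - Num.min a d + Num.min a c.

(** The form is the squared L2 norm of a step function. This positivity is the
only property of integrals over the offset that the argument uses, so it stands
in for them. *)
Lemma overlap_gram_ge0 (R : realDomainType) (s : seq (R * (R * R))) :
  0 <= \sum_(e <- s) \sum_(f <- s)
     e.1 * f.1 * overlap e.2.1 e.2.2 f.2.1 f.2.2.
Proof.
pose s' := [seq (e.1, e.2.2) | e <- s] ++ [seq (- e.1, e.2.1) | e <- s].
have z : \sum_(e <- s') e.1 = 0.
  by rewrite big_cat !big_map /= -big_split big1// => e _ /=; rewrite subrr.
have := min_kernel_ge0 z.
rewrite big_cat !big_map /= -big_split /=.
under eq_bigr do rewrite !big_cat !big_map /= -!big_split /=.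
congr (0 <= _); apply: eq_bigr => e _; apply: eq_bigr => f _.
by rewrite /overlap; ring.
Qed.

(** * The mean-zero profile of a difference of scales *)

Section Profile.
Variable R : realType.
Implicit Types x y z h k K L : R.

Definition pos_part x := Num.max x 0.
(** The primitive of [pos_part]. *)
Definition pos_prim x := pos_part x ^+ 2 / 2.

Lemma pos_part_id x : 0 <= x -> pos_part x = x.
Proof. by move=> x0; rewrite /pos_part max_l. Qed.

Lemma pos_part_0 x : x <= 0 -> pos_part x = 0.
Proof. by move=> x0; rewrite /pos_part max_r. Qed.

Lemma pos_prim_taylor x y :
  0 <= pos_prim (x + y) - pos_prim x - y * pos_part x <= y ^+ 2 / 2.
Proof.
rewrite /pos_prim; have [x0|x0] := leP 0 x; have [xy|xy] := leP 0 (x + y).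
- by rewrite !pos_part_id//; have := sqr_ge0 y; lra.
- rewrite (pos_part_id x0) (pos_part_0 (ltW xy)).
  have := sqr_ge0 (x + y); have : 0 <= x * (- x - (y + y)) by apply: mulr_ge0; lra.
  lra.
- rewrite (pos_part_id xy) (pos_part_0 (ltW x0)).
  have := sqr_ge0 (x + y); have : 0 <= - x * (y + y + x) by apply: mulr_ge0; lra.
  lra.
- by rewrite (pos_part_0 (ltW x0)) (pos_part_0 (ltW xy)); have := sqr_ge0 y; lra.
Qed.

Lemma pos_prim_bound x M : `|x| <= M -> 0 <= pos_prim x <= M ^+ 2 / 2.
Proof.
rewrite ler_norml /pos_prim => /andP[xl xr].
have : 0 <= (M - x) * (M + x) by apply: mulr_ge0; lra.
have := sqr_ge0 x; have := sqr_ge0 M => ? ? ?.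
have [x0|x0] := leP 0 x; first by rewrite pos_part_id//; lra.
by rewrite (pos_part_0 (ltW x0)); lra.
Qed.

(** Second-difference form of the overlap of two centred intervals. *)
Definition tent h k z :=
  pos_part (z + h + k) - pos_part (z + k - h) - pos_part (z + h - k)
  + pos_part (z - h - k).

Definition tent_prim h k z :=
  pos_prim (z + h + k) - pos_prim (z + k - h) - pos_prim (z + h - k)
  + pos_prim (z - h - k).

Lemma minE x y : Num.min x y = y - pos_part (y - x).
Proof.
have [xy|xy] := leP x y.
  by rewrite pos_part_id ?subr_ge0//; ring.
by rewrite pos_part_0 ?subr_le0 ?(ltW xy)//; ring.
Qed.

(** The overlap depends only on the difference of the centres, which is what
makes the mean-square kernel a function of the difference of two points. *)
Lemma overlap_centred x y h k :
  overlap (x - h) (x + h) (y - k) (y + k) = tent h k (y - x).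
Proof.
rewrite /overlap !minE /tent.
rewrite (_ : y + k - (x + h) = y - x + k - h); last by ring.
rewrite (_ : y - k - (x + h) = y - x - h - k); last by ring.
rewrite (_ : y + k - (x - h) = y - x + h + k); last by ring.
rewrite (_ : y - k - (x - h) = y - x + h - k); last by ring.
ring.
Qed.

Lemma tent_scale x h k z : 0 <= x -> tent (x * h) (x * k) (x * z) = x * tent h k z.
Proof.
move=> x0; rewrite /tent /pos_part.
have E u : Num.max (x * u) 0 = x * Num.max u 0 by rewrite maxr_pMr// mulr0.
by rewrite !mulrDr !mulrN -!E !mulrDr !mulrN.
Qed.

Lemma tent_bound h k z : 0 <= h -> 0 <= k -> 0 <= tent h k z <= 2 * h.
Proof.
move=> h0 k0; rewrite /tent /pos_part.
have [a|a] := leP (z + h + k) 0; have [b|b] := leP (z + k - h) 0;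
have [c|c] := leP (z + h - k) 0; have [d|d] := leP (z - h - k) 0; lra.
Qed.

Lemma tent_out h k z : 0 <= h -> 0 <= k -> h + k <= `|z| -> tent h k z = 0.
Proof.
move=> h0 k0; rewrite /tent ler_normr => /orP[] z0.
  by rewrite !pos_part_id; try lra; ring.
by rewrite !pos_part_0; try lra; ring.
Qed.

(** Beyond the supports the primitive of [tent] is its total mass, the product
of the lengths of the two intervals. *)
Lemma tent_prim_out h k z : 0 <= h -> 0 <= k -> h + k <= `|z| ->
  tent_prim h k z = if 0 <= z then 4 * h * k else 0.
Proof.
move=> h0 k0; rewrite /tent_prim /pos_prim ler_normr => /orP[] z0.
  rewrite !pos_part_id; try lra.
  by rewrite ifT; [field|lra].
rewrite !pos_part_0; try lra.
case: ifP => z1; last by field.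
have -> : h = 0 by lra.
by field.
Qed.

Lemma tent_prim_taylor h k z y :
  `|tent_prim h k (z + y) - tent_prim h k z - y * tent h k z| <= 2 * y ^+ 2.
Proof.
rewrite ler_norml /tent_prim /tent.
have := pos_prim_taylor (z + h + k) y.
have := pos_prim_taylor (z + k - h) y.
have := pos_prim_taylor (z + h - k) y.
have := pos_prim_taylor (z - h - k) y.
rewrite (_ : z + y + h + k = z + h + k + y); last by ring.
rewrite (_ : z + y + k - h = z + k - h + y); last by ring.
rewrite (_ : z + y + h - k = z + h - k + y); last by ring.
rewrite (_ : z + y - h - k = z - h - k + y); last by ring.
have := sqr_ge0 y.
lra.
Qed.

Lemma tent_prim_bound h k z M : 0 <= h <= M -> 0 <= k <= M ->
  `|z| <= 2 * M -> `|tent_prim h k z| <= 16 * M ^+ 2.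
Proof.
move=> hM kM; rewrite ler_norml => zM.
have B x : `|x| <= 4 * M -> 0 <= pos_prim x <= 8 * M ^+ 2.
  by move=> /pos_prim_bound; rewrite exprMn; lra.
rewrite ler_norml /tent_prim.
have := B (z + h + k); have := B (z + k - h).
have := B (z + h - k); have := B (z - h - k).
rewrite !ler_norml.
by do 4 (move=> /(_ ltac:(lra)) ?); lra.
Qed.

(** Up to a factor, the autocorrelation of the difference of the indicators of
[[- L, L]] and [[- L * K, L * K]], normalised to have equal masses. It has mean
zero, so that its primitive [band_prim] has compact support. *)
Definition band K L z :=
  tent L L z - 2 / K * tent L (L * K) z + K^-2 * tent (L * K) (L * K) z.

Definition band_prim K L z :=
  tent_prim L L z - 2 / K * tent_prim L (L * K) z
  + K^-2 * tent_prim (L * K) (L * K) z.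

Lemma invK_bounds K : 1 <= K -> [/\ 0 < K, 0 <= K^-1 <= 1 & 0 <= K^-2 <= 1].
Proof.
move=> K1; have K0 : 0 < K by lra.
split=> //; first by rewrite invr_ge0 (ltW K0) invf_le1.
by rewrite invr_ge0 exprn_ge0 ?(ltW K0)// invf_le1 ?exprn_gt0// exprn_ege1.
Qed.

Lemma band_bound K L z : 1 <= K -> 1 <= L -> `|band K L z| <= 8 * L.
Proof.
move=> K1 L1; have [K0 iK iK2] := invK_bounds K1.
have LK : L <= L * K by nra.
rewrite /band -mulrA; have := @tent_bound L L z; have := @tent_bound L (L * K) z.
have := @tent_bound (L * K) (L * K) z.
do 3 (move=> /(_ ltac:(lra) ltac:(lra)) ?).
have e : K^-2 * (2 * (L * K)) = 2 * L * K^-1 by field; lra.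
have : K^-2 * tent (L * K) (L * K) z <= 2 * L * K^-1.
  by rewrite -e ler_wpM2l//; lra.
have : 0 <= K^-2 * tent (L * K) (L * K) z by rewrite mulr_ge0//; lra.
rewrite ler_norml; nra.
Qed.

Lemma band_out K L z : 1 <= K -> 1 <= L -> 2 * L * K <= `|z| -> band K L z = 0.
Proof.
move=> K1 L1; have [K0 iK iK2] := invK_bounds K1.
have LK : L <= L * K by nra.
move=> zb; rewrite /band (@tent_out L L) ?(@tent_out L (L * K)) ?(@tent_out (L * K) (L * K)); lra.
Qed.

(** To the right of the support the three masses add up to
[4 * L ^+ 2 * (1 - 2 + 1) = 0]. *)
Lemma band_prim_out K L z : 1 <= K -> 1 <= L -> 2 * L * K <= `|z| -> band_prim K L z = 0.
Proof.
move=> K1 L1; have [K0 iK iK2] := invK_bounds K1.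
have LK : L <= L * K by nra.
move=> zb; rewrite /band_prim !tent_prim_out; try lra; try nra.
by case: ifP => _; [field; lra|ring].
Qed.

Lemma band_prim_taylor K L z y : 1 <= K -> 1 <= L ->
  `|band_prim K L (z + y) - band_prim K L z - y * band K L z| <= 8 * y ^+ 2.
Proof.
move=> K1 L1; have [K0 iK iK2] := invK_bounds K1.
have LK : L <= L * K by nra.
have := tent_prim_taylor L L z y; have := tent_prim_taylor L (L * K) z y.
have := tent_prim_taylor (L * K) (L * K) z y.
rewrite /band_prim /band.
set a := tent_prim _ _ _ - _ - _; set b := tent_prim _ _ _ - _ - _.
set c := tent_prim _ _ _ - _ - _ => Ha Hb Hc.
rewrite [X in `|X|](_ : _ = c - 2 * (K^-1 * b) + K^-2 * a); last first.
  by rewrite /a /b /c; field; lra.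
have y2 := sqr_ge0 y.
have Hb' : `|K^-1 * b| <= 2 * y ^+ 2.
  rewrite normrM ger0_norm; last lra.
  by apply: le_trans Hb; rewrite ler_piMl//; lra.
have Ha' : `|K^-2 * a| <= 2 * y ^+ 2.
  rewrite normrM ger0_norm; last lra.
  by apply: le_trans Ha; rewrite ler_piMl//; lra.
move: Ha' Hb' Hc; rewrite !ler_norml; lra.
Qed.

Lemma band_prim_bound K L z : 1 <= K -> 1 <= L -> `|z| <= 2 * L * K ->
  `|band_prim K L z| <= 64 * (L * K) ^+ 2.
Proof.
move=> K1 L1; have [K0 iK iK2] := invK_bounds K1.
have LK : L <= L * K by nra.
move=> zb.
have := @tent_prim_bound L L z (L * K); have := @tent_prim_bound L (L * K) z (L * K).
have := @tent_prim_bound (L * K) (L * K) z (L * K).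
do 3 (move=> /(_ ltac:(lra) ltac:(lra) ltac:(lra)) ?).
rewrite /band_prim -(mulrA 2).
have y2 := sqr_ge0 (L * K).
have Hb' : `|K^-1 * tent_prim L (L * K) z| <= 16 * (L * K) ^+ 2.
  rewrite normrM ger0_norm; last lra.
  by apply: le_trans (_ : `|tent_prim L (L * K) z| <= _); rewrite ?ler_piMl//; lra.
have Ha' : `|K^-2 * tent_prim (L * K) (L * K) z| <= 16 * (L * K) ^+ 2.
  rewrite normrM ger0_norm; last lra.
  by apply: le_trans (_ : `|tent_prim (L * K) (L * K) z| <= _); rewrite ?ler_piMl//; lra.
have Hc : `|tent_prim L L z| <= 16 * (L * K) ^+ 2 by [].
move: Ha' Hb' Hc; rewrite !ler_norml; lra.
Qed.

Lemma band_prim_bound_all K L z : 1 <= K -> 1 <= L -> `|band_prim K L z| <= 64 * (L * K) ^+ 2.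
Proof.
move=> K1 L1; have [K0 iK iK2] := invK_bounds K1.
have LK : L <= L * K by nra.
have [/band_prim_bound ->//|zb] := leP `|z| (2 * L * K).
by rewrite band_prim_out ?(ltW zb)// normr0 mulr_ge0// sqr_ge0.
Qed.

Lemma mul_band_prim K L z : 1 <= K -> 1 <= L -> `|z * band_prim K L z| <= 128 * (L * K) ^+ 3.
Proof.
move=> K1 L1; have [K0 iK iK2] := invK_bounds K1.
have LK : L <= L * K by nra.
have [zb|zb] := leP `|z| (2 * L * K); last first.
  rewrite band_prim_out ?(ltW zb)// mulr0 normr0 mulr_ge0// exprn_ge0//; nra.
rewrite normrM; have := band_prim_bound_all z K1 L1 => h.
have -> : 128 * (L * K) ^+ 3 = (2 * L * K) * (64 * (L * K) ^+ 2) by ring.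
exact: ler_pM.
Qed.

Lemma sqr_mul_band K L z : 1 <= K -> 1 <= L -> `|z ^+ 2 * band K L z| <= 32 * L * (L * K) ^+ 2.
Proof.
move=> K1 L1; have [K0 iK iK2] := invK_bounds K1.
have LK : L <= L * K by nra.
have [zb|zb] := leP `|z| (2 * L * K); last first.
  rewrite band_out ?(ltW zb)// mulr0 normr0 mulr_ge0 ?sqr_ge0//; nra.
rewrite normrM normrX; have := band_bound z K1 L1 => h.
have -> : 32 * L * (L * K) ^+ 2 = (2 * L * K) ^+ 2 * (8 * L) by ring.
by apply: ler_pM; rewrite ?sqr_ge0// lerXn2r ?nnegrE//; nra.
Qed.

End Profile.

(** * Projections and integration by parts in the angle *)

Section Trig.
Variable R : realType.
Implicit Types a b x : R.

Lemma sin_lip a b : `|sin a - sin b| <= `|a - b|.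
Proof.
wlog ab : a b / b <= a.
  move=> H; have [/H//|/ltW/H] := leP b a.
  by rewrite distrC (distrC b).
have [c _ ->] : exists2 c, c \in `[b, a] & sin a - sin b = cos c * (a - b).
  apply: MVT_segment => //.
  by apply: continuous_subspaceT => x; exact: continuous_sin.
by rewrite normrM ler_piMl// cos_max.
Qed.

Lemma cos_lip a b : `|cos a - cos b| <= `|a - b|.
Proof. by rewrite -!sinDpihalf (le_trans (sin_lip _ _))// opprD addrACA subrr addr0. Qed.

Lemma cos_near1 x : 0 <= x -> `|cos x - 1| <= x ^+ 2.
Proof.
move=> x0; have [c] : exists2 c, c \in `[0, x] & cos x - cos 0 = - sin c * (x - 0).
  apply: (@MVT_segment _ _ (fun y => - sin y)) => //.
  by apply: continuous_subspaceT => y; exact: continuous_cos.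
rewrite in_itv /= cos0 subr0 => /andP[c0 cx] ->.
rewrite normrM (ger0_norm x0) expr2 ler_wpM2r// normrN.
by have := sin_lip c 0; rewrite sin0 !subr0 (ger0_norm c0) => /le_trans; apply.
Qed.

Lemma sin_near_id x : 0 <= x -> `|sin x - x| <= x ^+ 2.
Proof.
move=> x0; have [c] : exists2 c, c \in `[0, x] & sin x - sin 0 = cos c * (x - 0).
  apply: MVT_segment => //.
  by apply: continuous_subspaceT => y; exact: continuous_sin.
rewrite in_itv /= sin0 !subr0 => /andP[c0 cx] ->.
rewrite -{2}(mul1r x) -mulrBl normrM (ger0_norm x0) expr2 ler_wpM2r//.
by have := cos_lip c 0; rewrite cos0 subr0 (ger0_norm c0) => /le_trans; apply.
Qed.

Lemma pi_lt4 : pi < 4 :> R.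
Proof. by have := pihalf_lt2 R; lra. Qed.

Definition proj (v : R * R) (th : R) : R :=
  v.1 * cos (2 * pi * th) + v.2 * sin (2 * pi * th).

Definition proj_perp (v : R * R) (th : R) : R :=
  v.2 * cos (2 * pi * th) - v.1 * sin (2 * pi * th).

Lemma proj_pythagoras v th :
  proj v th ^+ 2 + proj_perp v th ^+ 2 = v.1 ^+ 2 + v.2 ^+ 2.
Proof.
rewrite /proj /proj_perp; set c := cos _; set s := sin _.
transitivity ((v.1 ^+ 2 + v.2 ^+ 2) * (c ^+ 2 + s ^+ 2)); first by ring.
by rewrite cos2Dsin2 mulr1.
Qed.

Let mul_le1 (x y M : R) : `|x| <= M -> `|y| <= 1 -> `|x * y| <= M.
Proof. by move=> xM y1; rewrite normrM (le_trans _ xM)// ler_piMr. Qed.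

Lemma proj_le v th M : `|v.1| <= M -> `|v.2| <= M -> `|proj v th| <= 2 * M.
Proof.
move=> h1 h2; rewrite mulrDl mul1r (le_trans (ler_normD _ _))// lerD//;
by rewrite mul_le1 ?cos_max ?sin_max.
Qed.

Lemma proj_perp_le v th M : `|v.1| <= M -> `|v.2| <= M ->
  `|proj_perp v th| <= 2 * M.
Proof.
move=> h1 h2; rewrite mulrDl mul1r (le_trans (ler_normB _ _))// lerD//;
by rewrite mul_le1 ?cos_max ?sin_max.
Qed.

Lemma proj_lip v a b M : `|v.1| <= M -> `|v.2| <= M ->
  `|proj v a - proj v b| <= 16 * M * `|a - b|.
Proof.
move=> h1 h2; rewrite /proj.
rewrite [X in `|X|](_ : _ = v.1 * (cos (2 * pi * a) - cos (2 * pi * b)) +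
  v.2 * (sin (2 * pi * a) - sin (2 * pi * b))); last by ring.
have P : `|2 * pi * a - 2 * pi * b| <= 8 * `|a - b|.
  rewrite -mulrBr normrM ler_wpM2r// ger0_norm; have := pi_gt0 R; have := pi_lt4; lra.
rewrite (_ : 16 * M * _ = M * (8 * `|a - b|) + M * (8 * `|a - b|)); last by ring.
rewrite (le_trans (ler_normD _ _))// !normrM lerD// ler_pM//.
  exact: le_trans (cos_lip _ _) P.
exact: le_trans (sin_lip _ _) P.
Qed.

Lemma proj_step v th h :
  proj v (th + h) = proj v th * cos (2 * pi * h) + proj_perp v th * sin (2 * pi * h).
Proof. by rewrite /proj /proj_perp mulrDr cosD sinD; ring. Qed.

Lemma proj_perp_step v th h :
  proj_perp v (th + h) =
  proj_perp v th * cos (2 * pi * h) - proj v th * sin (2 * pi * h).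
Proof. by rewrite /proj /proj_perp mulrDr cosD sinD; ring. Qed.

Lemma ler_normM (x y a b : R) : `|x| <= a -> `|y| <= b -> `|x * y| <= a * b.
Proof. by move=> xa yb; rewrite normrM ler_pM. Qed.

(** First-order expansion of the 1-periodic function [proj_perp v * G (proj v)],
whose derivative is [2 * pi] times the difference of the two terms on the right
when [Psi] is the derivative of [G]. *)
Lemma by_parts_step (Psi G : R -> R) (v : R * R) (c V th h : R) :
  1 <= c -> 1 <= V -> 0 <= h <= 1 ->
  (forall z, `|Psi z| <= c) -> (forall z, `|G z| <= c) ->
  (forall z y, `|G (z + y) - G z - y * Psi z| <= c * y ^+ 2) ->
  `|proj v th| <= V -> `|proj_perp v th| <= V ->
  `|proj_perp v (th + h) * G (proj v (th + h)) - proj_perp v th * G (proj v th) -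
    2 * pi * h * (proj_perp v th ^+ 2 * Psi (proj v th) - proj v th * G (proj v th))|
  <= 50 * c * V ^+ 3 * (2 * pi * h) ^+ 2.
Proof.
move=> c1 V1 /andP[h0 h1] HPsi HG HT gV hV.
rewrite proj_step proj_perp_step.
set g := proj v th; set k := proj_perp v th; set al := 2 * pi * h.
have pi4 := pi_lt4; have pi0 := pi_gt0 R.
have al0 : 0 <= al by rewrite /al !mulr_ge0//; lra.
have al8 : al <= 8.
  have : pi * h <= 4 * 1 by rewrite ler_pM// ltW.
  rewrite /al; lra.
have Hs := sin_near_id al0; have Hc := cos_near1 al0.
have Hc' : `|cos al - 1| <= al.
  by have := cos_lip al 0; rewrite cos0 subr0 (ger0_norm al0).
have Hs' : `|sin al| <= al.
  by have := sin_lip al 0; rewrite sin0 !subr0 (ger0_norm al0).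
set es := sin al - al in Hs; set ec := cos al - 1 in Hc Hc'.
have Es : sin al = al + es by rewrite /es; ring.
have Ec : cos al = 1 + ec by rewrite /ec; ring.
set D := g * ec + k * sin al.
have -> : g * cos al + k * sin al = g + D by rewrite Ec /D; ring.
have HD : `|D| <= 2 * V * al.
  rewrite (le_trans (ler_normD _ _))// !normrM.
  rewrite (_ : 2 * V * al = V * al + V * al); last by ring.
  by rewrite lerD// ler_pM.
have := HT g D; set e := G (g + D) - G g - D * Psi g => He.
have EG : G (g + D) = G g + D * Psi g + e by rewrite /e; ring.
have V0 : 0 <= V by lra.
have c0 : 0 <= c by lra.
have D2 : D ^+ 2 <= 4 * V ^+ 2 * al ^+ 2.
  rewrite -(real_normK (num_real D)).
  rewrite (_ : 4 * _ * _ = (2 * V * al) ^+ 2); last by ring.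
  have a0 : 0 <= 2 * V * al by apply: mulr_ge0 => //; lra.
  by apply: lerXn2r HD; rewrite nnegrE.
have He' : `|e| <= c * (4 * V ^+ 2 * al ^+ 2).
  by rewrite (le_trans He)// ler_wpM2l.
rewrite [X in `|X|](_ : _ = k ^+ 2 * Psi g * es + k * g * ec * Psi g + k * e
   + k * ec * G (g + D) - g * es * G (g + D) - g * al * (D * Psi g) - g * al * e);
  last by rewrite Ec Es EG /D Es; ring.
have B1 : `|k ^+ 2 * Psi g * es| <= c * V ^+ 2 * al ^+ 2.
  by rewrite (mulrC c) expr2 (expr2 V); do 3 apply: ler_normM => //.
have B2 : `|k * g * ec * Psi g| <= c * V ^+ 2 * al ^+ 2.
  by rewrite -(mulrA c) (mulrC c) (expr2 V); do 3 apply: ler_normM => //.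
have B3 : `|k * e| <= 4 * c * V ^+ 3 * al ^+ 2.
  rewrite (_ : 4 * _ * _ * _ = V * (c * (4 * V ^+ 2 * al ^+ 2))); last by ring.
  exact: ler_normM.
have B4 : `|k * ec * G (g + D)| <= c * V * al ^+ 2.
  by rewrite -(mulrA c) (mulrC c); do 2 apply: ler_normM => //.
have B5 : `|g * es * G (g + D)| <= c * V * al ^+ 2.
  by rewrite -(mulrA c) (mulrC c); do 2 apply: ler_normM => //.
have al1 : `|al| <= al by rewrite ger0_norm.
have al8' : `|al| <= 8 by rewrite ger0_norm.
have B6 : `|g * al * (D * Psi g)| <= 2 * c * V ^+ 2 * al ^+ 2.
  rewrite (_ : 2 * c * V ^+ 2 * al ^+ 2 = V * al * (2 * V * al * c)); last by ring.
  by apply: ler_normM; apply: ler_normM.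
have B7 : `|g * al * e| <= 32 * c * V ^+ 3 * al ^+ 2.
  rewrite (_ : 32 * _ * _ * _ = V * 8 * (c * (4 * V ^+ 2 * al ^+ 2))); last by ring.
  by apply: ler_normM => //; apply: ler_normM.
have W : V <= V ^+ 3 by rewrite ler_eXnr.
have W2 : V ^+ 2 <= V ^+ 3 by rewrite ler_weXn2l.
have c2 : 0 <= c * al ^+ 2 by rewrite mulr_ge0// sqr_ge0.
have U : c * V * al ^+ 2 <= c * V ^+ 3 * al ^+ 2.
  by rewrite mulrAC [leRHS]mulrAC ler_wpM2l.
have U2 : c * V ^+ 2 * al ^+ 2 <= c * V ^+ 3 * al ^+ 2.
  by rewrite mulrAC [leRHS]mulrAC ler_wpM2l.
move: B1 B2 B3 B4 B5 B6 B7; rewrite !ler_norml.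
lra.
Qed.

(** Integration by parts over a period: [v] has squared length
[proj ^+ 2 + proj_perp ^+ 2], and the part of a mean of [Psi (proj v)] that is
weighted by [proj_perp ^+ 2] is traded for [proj * G (proj)], which is bounded
independently of [v] when [G] has compact support. The mean is a Riemann sum,
hence the last term, which is negligible for large [n]. *)
Lemma by_parts_sum (Psi G : R -> R) (v : R * R) (c V : R) (n : nat) :
  (0 < n)%N -> 1 <= c -> 1 <= V ->
  (forall z, `|Psi z| <= c) -> (forall z, `|G z| <= c) ->
  (forall z y, `|G (z + y) - G z - y * Psi z| <= c * y ^+ 2) ->
  (forall th, `|proj v th| <= V) -> (forall th, `|proj_perp v th| <= V) ->
  \sum_(i < n) proj_perp v (i%:R / n%:R) ^+ 2 * Psi (proj v (i%:R / n%:R)) <=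
  \sum_(i < n) proj v (i%:R / n%:R) * G (proj v (i%:R / n%:R)) +
  400 * c * V ^+ 3.
Proof.
move=> n0 c1 V1 HP HG HT gV hV.
have n0' : 0 < n%:R :> R by rewrite ltr0n.
pose H t := proj_perp v t * G (proj v t).
pose F t := proj_perp v t ^+ 2 * Psi (proj v t) - proj v t * G (proj v t).
pose al : R := 2 * pi * n%:R^-1.
have pi4 := pi_lt4; have pi0 := pi_gt0 R.
have al0 : 0 < al by rewrite /al !mulr_gt0// invr_gt0.
have st (i : 'I_n) : al * F (i%:R / n%:R) <=
   (H (i.+1%:R / n%:R) - H (i%:R / n%:R)) + 50 * c * V ^+ 3 * al ^+ 2.
  have -> : i.+1%:R / n%:R = i%:R / n%:R + n%:R^-1 :> R.
    by rewrite -natr1 mulrDl mul1r.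
  have := @by_parts_step Psi G v c V (i%:R / n%:R) n%:R^-1 c1 V1 _ HP HG HT (gV _) (hV _).
  rewrite invr_ge0 ltW// invf_le1// ler1n n0 => /(_ isT).
  rewrite ler_norml -/al -/(H _) -/(H (_ / _)) -/(F _) /=; lra.
have : \sum_(i < n) al * F (i%:R / n%:R) <=
   \sum_(i < n) ((H (i.+1%:R / n%:R) - H (i%:R / n%:R)) + 50 * c * V ^+ 3 * al ^+ 2).
  by apply: ler_sum => i _; exact: st.
rewrite -mulr_sumr [leRHS]big_split /= [X in _ + X]big_const_ord iter_addr_0.
rewrite -(big_mkord xpredT (fun i => H (i.+1%:R / n%:R) - H (i%:R / n%:R))).
rewrite telescope_sumr// mul0r divff ?gt_eqF//.
have -> : H 1 = H 0.
  have e1 : 2 * pi * 1 = 0 + pi *+ 2 :> R by rewrite mulr1 add0r mulr_natl.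
  by rewrite /H /proj /proj_perp e1 cosD2pi sinD2pi mulr0.
rewrite subrr add0r -[leRHS]mulr_natr => le.
have {}le : al * \sum_(i < n) F (i%:R / n%:R) <= al * (400 * c * V ^+ 3).
  apply: le_trans le _.
  rewrite (_ : _ * _ ^+ 2 * _ = al * (50 * c * V ^+ 3 * (2 * pi))); last first.
    by rewrite /al; field; rewrite gt_eqF.
  rewrite (ler_wpM2l (ltW al0))//.
  have cV : 0 <= c * V ^+ 3 by apply: mulr_ge0; [lra|apply: exprn_ge0; lra].
  have : 0 <= (4 - pi) * (c * V ^+ 3) by apply: mulr_ge0 => //; lra.
  lra.
move: le; rewrite ler_pM2l// sumrB; lra.
Qed.

End Trig.

(** * Mean-square difference of two scales *)

Section Energy.
Variable R : realType.

Definition kernel_const (K L : R) := 32 * L * (L * K) ^+ 2 + 128 * (L * K) ^+ 3 + 1.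
Definition taylor_const (K L : R) := 64 * (L * K) ^+ 2.

Lemma kernel_const_ge1 K L : 1 <= K -> 1 <= L -> 1 <= kernel_const K L.
Proof.
move=> K1 L1; have LK0 : 0 <= L * K by apply: mulr_ge0; lra.
have h2 : 0 <= L * (L * K) ^+ 2 by apply: mulr_ge0; [lra|exact: sqr_ge0].
have h3 : 0 <= (L * K) ^+ 3 by exact: exprn_ge0.
by rewrite /kernel_const; lra.
Qed.

Lemma taylor_const_ge0 K L : 0 <= 400 * taylor_const K L.
Proof. by have := sqr_ge0 (L * K); rewrite /taylor_const; lra. Qed.

(** Averaged over all directions, the profile is as small as the inverse square
of the length of [v]; absolute values would only give the inverse of the length.
This is the gain from the mean-zero property. *)
Lemma band_average (K L V : R) (v : R * R) (n : nat) :
  1 <= K -> 1 <= L -> 1 <= V -> `|v.1| <= V -> `|v.2| <= V ->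
  400 * taylor_const K L * (2 * V) ^+ 3 <= n%:R ->
  (v.1 ^+ 2 + v.2 ^+ 2) * \sum_(i < n) band K L (proj v (i%:R / n%:R)) <=
  kernel_const K L * n%:R.
Proof.
move=> K1 L1 V1 v1 v2 nV.
set c := taylor_const K L in nV *.
have LK1 : 1 <= L * K by rewrite -(mulr1 1) ler_pM.
have LK2 : L * K <= (L * K) ^+ 2 by rewrite ler_eXnr.
have LK3 : L <= L * K by rewrite ler_peMr//; lra.
have c8 : 8 * L <= c by rewrite /c /taylor_const; lra.
have n0 : (0 < n)%N.
  rewrite -(ltr0n R); apply: lt_le_trans nV; apply: mulr_gt0; first by lra.
  by apply: exprn_gt0; lra.
rewrite -(proj_pythagoras v 0) mulr_sumr.
under eq_bigr => i _ do
  rewrite (proj_pythagoras v 0) -(proj_pythagoras v (i%:R / n%:R)) mulrDl.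
rewrite big_split /=.
have bp := @by_parts_sum R (band K L) (band_prim K L) v c (2 * V) n n0.
have H1 : \sum_(i < n) proj v (i%:R / n%:R) ^+ 2 * band K L (proj v (i%:R / n%:R))
    <= 32 * L * (L * K) ^+ 2 * n%:R.
  rewrite mulr_natr -[leRHS]iter_addr_0 -[n in leRHS]card_ord -big_const.
  by apply: ler_sum => i _; apply: le_trans (ler_norm _) _; exact: sqr_mul_band.
have H2 : \sum_(i < n) proj v (i%:R / n%:R) * band_prim K L (proj v (i%:R / n%:R))
    <= 128 * (L * K) ^+ 3 * n%:R.
  rewrite mulr_natr -[leRHS]iter_addr_0 -[n in leRHS]card_ord -big_const.
  by apply: ler_sum => i _; apply: le_trans (ler_norm _) _; exact: mul_band_prim.
have {bp} := bp ltac:(lra) ltac:(lra).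
move=> /(_ (fun z => le_trans (band_bound z K1 L1) c8)).
move=> /(_ (fun z => band_prim_bound_all z K1 L1)).
have HT z y : `|band_prim K L (z + y) - band_prim K L z - y * band K L z| <= c * y ^+ 2.
  rewrite (le_trans (band_prim_taylor _ _ K1 L1))// ler_wpM2r ?sqr_ge0//; lra.
move=> /(_ HT (fun th => proj_le _ v1 v2) (fun th => proj_perp_le _ v1 v2)).
rewrite /kernel_const; lra.
Qed.

(** A majorant of [d ^- 2], truncated at scale [2 ^- j], made of indicators of
dyadic balls so that it can be summed against a ball condition. *)
Definition shells (j : nat) (d : R) : R :=
  1 + \sum_(i < j.+1) 4 ^+ i.+1 * (d <= 2 ^- i)%R%:R.

Lemma shells_far j d : 2 ^- j < d -> d ^- 2 <= shells j d.
Proof.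
rewrite /shells; elim: j => [|j IH] dj.
  rewrite big_ord_recl big_ord0 addr0.
  have d0 : 1 < d by rewrite expr0 invr1 in dj.
  have : d ^- 2 <= 1 by rewrite invf_le1 ?exprn_gt0 ?exprn_ege1 ?ltW//; lra.
  have : 0 <= 4 ^+ 1 * (d <= 2 ^- 0)%R%:R :> R by rewrite mulr_ge0.
  by rewrite /=; lra.
rewrite big_ord_recr /=.
have pos0 : 0 <= 4 ^+ j.+2 * (d <= 2 ^- j.+1)%R%:R :> R by rewrite mulr_ge0// exprn_ge0.
have [/IH|dj'] := ltP (2 ^- j) d; first by lra.
rewrite big_ord_recr /= dj' mulr1.
have S0 : 0 <= \sum_(i < j) 4 ^+ i.+1 * (d <= 2 ^- i)%R%:R :> R.
  by apply: sumr_ge0 => i _; rewrite mulr_ge0// exprn_ge0.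
have d0 : 0 < d by rewrite (lt_trans _ dj)// invr_gt0 exprn_gt0.
suff : d ^- 2 <= 4 ^+ j.+1 by lra.
have -> : 4 ^+ j.+1 = (2 ^- j.+1) ^- 2 :> R.
  by rewrite exprVn invrK -exprM mulnC exprM; congr (_ ^+ _); rewrite expr2; ring.
rewrite lef_pV2 ?posrE ?exprn_gt0 ?invr_gt0 ?exprn_gt0//.
by rewrite lerXn2r ?nnegrE ?ltW// invr_gt0 exprn_gt0.
Qed.

Lemma shells_near j d : d <= 2 ^- j -> 4 ^+ j <= shells j d.
Proof.
move=> dj; rewrite /shells big_ord_recr /= dj mulr1.
have S0 : 0 <= \sum_(i < j) 4 ^+ i.+1 * (d <= 2 ^- i)%R%:R :> R.
  by apply: sumr_ge0 => i _; rewrite mulr_ge0// exprn_ge0.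
have : 0 <= 4 ^+ j :> R by rewrite exprn_ge0.
by rewrite exprS; lra.
Qed.

Definition sep (a b : R * R) : R := Num.max `|a.1 - b.1| `|a.2 - b.2|.

Definition vsub (a b : R * R) : R * R := (a.1 - b.1, a.2 - b.2).

Lemma proj_sub a b th : proj (vsub a b) th = proj a th - proj b th.
Proof. by rewrite /proj /=; ring. Qed.

Lemma proj_scale (c : R) v th : proj (c * v.1, c * v.2) th = c * proj v th.
Proof. by rewrite /proj /=; ring. Qed.

(** The kernel of two points is at most of the order of the inverse of the scale
when they are closer than the scale, and of [2 ^- j / sep ^+ 2] otherwise by
[band_average]. *)
Lemma band_pair (K L : R) (a b : R * R) (j n : nat) :
  1 <= K -> 1 <= L -> sep a b <= 4 ->
  400 * taylor_const K L * (8 * 2 ^+ j) ^+ 3 <= n%:R ->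
  \sum_(i < n) 2 ^+ j * band K L (2 ^+ j * (proj a (i%:R / n%:R) - proj b (i%:R / n%:R)))
  <= n%:R * (kernel_const K L * 2 ^- j * shells j (sep a b)).
Proof.
move=> K1 L1 ab nV.
have LK1 : 1 <= L * K by rewrite -(mulr1 1) ler_pM.
have LK2 : L * K <= (L * K) ^+ 2 by rewrite ler_eXnr.
have LK4 : L <= L * K by rewrite ler_peMr//; lra.
have LK5 : L * K <= L * (L * K) ^+ 2.
  by rewrite -[leLHS]mul1r ler_pM//; lra.
have LK3 : 1 <= (L * K) ^+ 3 by rewrite exprn_ege1.
have j0 : 0 < 2 ^+ j :> R by rewrite exprn_gt0.
have j1 : 1 <= 2 ^+ j :> R by rewrite exprn_ege1// ler1n.
set d := sep a b in ab *.
have [dj|dj] := leP d (2 ^- j).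
  have := shells_near dj => sh.
  apply: (@le_trans _ _ (n%:R * (8 * L * 2 ^+ j))).
    rewrite mulr_natl -[leRHS]iter_addr_0 -[n in leRHS]card_ord -big_const.
    apply: ler_sum => i _; rewrite mulrC ler_wpM2r ?(ltW j0)//.
    by rewrite (le_trans (ler_norm _))// band_bound.
  rewrite ler_wpM2l// -[leRHS]mulrA.
  apply: (@le_trans _ _ (kernel_const K L * (2 ^- j * 4 ^+ j))).
    have -> : 2 ^- j * 4 ^+ j = 2 ^+ j :> R.
      by rewrite (_ : 4 = 2 * 2) ?exprMn ?mulKf ?gt_eqF//; lra.
    by rewrite (ler_wpM2r (ltW j0))// /kernel_const; lra.
  rewrite ler_wpM2l//; first by rewrite /kernel_const; lra.
  by rewrite ler_wpM2l// invr_ge0 ltW.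
have := shells_far dj => sh.
have d0 : 0 < d by rewrite (lt_trans _ dj)// invr_gt0.
pose v := (2 ^+ j * (vsub a b).1, 2 ^+ j * (vsub a b).2).
have [a1 a2] : `|a.1 - b.1| <= 4 /\ `|a.2 - b.2| <= 4.
  by move: ab; rewrite /d /sep ge_max => /andP[].
have V1 : 1 <= 4 * 2 ^+ j :> R by lra.
have va : forall t : R, `|t| <= 4 -> `|2 ^+ j * t| <= 4 * 2 ^+ j.
  by move=> t t4; rewrite normrM (ger0_norm (ltW j0)) mulrC ler_wpM2r// ltW.
have nV' : 400 * taylor_const K L * (2 * (4 * 2 ^+ j)) ^+ 3 <= n%:R.
  by rewrite (_ : 2 * (4 * 2 ^+ j) = 8 * 2 ^+ j)//; ring.
have := @band_average K L (4 * 2 ^+ j) v n K1 L1 V1 (va _ a1) (va _ a2) nV'.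
rewrite -mulr_sumr.
have -> : \sum_(i < n) band K L (proj v (i%:R / n%:R)) = \sum_(i < n)
    band K L (2 ^+ j * (proj a (i%:R / n%:R) - proj b (i%:R / n%:R))).
  by apply: eq_bigr => i _; rewrite proj_scale proj_sub.
set S := \sum_(i < n) _.
have C0 : 0 < kernel_const K L by rewrite /kernel_const; lra.
have [S0|S0] := leP S 0.
  move=> _; apply: (@le_trans _ _ 0); first by rewrite mulr_ge0_le0// ltW.
  apply: mulr_ge0 => //; apply: mulr_ge0.
    by rewrite mulr_ge0 ?invr_ge0 ?ltW.
  by apply: le_trans sh; rewrite invr_ge0 exprn_ge0// ltW.
move=> H.
have dv : (2 ^+ j * d) ^+ 2 <= v.1 ^+ 2 + v.2 ^+ 2.
  rewrite /v /d /sep /= !exprMn -mulrDr ler_wpM2l ?sqr_ge0//.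
  have [_|_] := leP `|a.1 - b.1| `|a.2 - b.2|; rewrite real_normK ?num_real//.
    by rewrite lerDr sqr_ge0.
  by rewrite lerDl sqr_ge0.
have {}H : (2 ^+ j * d) ^+ 2 * S <= kernel_const K L * n%:R.
  by apply: le_trans H; rewrite ler_wpM2r// ltW.
apply: (@le_trans _ _ (n%:R * (kernel_const K L * 2 ^- j * d ^- 2))); last first.
  rewrite ler_wpM2l// ler_wpM2l// mulr_ge0 ?invr_ge0 ?ltW//.
have -> : 2 ^+ j * S = (2 ^+ j * d) ^+ 2 * S * (2 ^- j * d ^- 2).
  by field; rewrite !gt_eqF.
apply: (@le_trans _ _ (kernel_const K L * n%:R * (2 ^- j * d ^- 2))).
  by rewrite ler_wpM2r// mulr_ge0 ?invr_ge0 ?exprn_ge0 ?ltW.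
by rewrite le_eqVlt; apply/orP; left; apply/eqP; ring.
Qed.

Section Points.
Variables (P : eqType) (pts : seq P) (x : P -> R * R) (m : P -> R).

(** The ball condition of dimension [log2 tau], tested only around the points
themselves and at dyadic scales down to [2 ^- j]; the total mass is bounded
separately, in place of the scales above [1]. *)
Definition frostman (C tau : R) (j : nat) :=
  (\sum_(q <- pts) m q <= C) /\
  forall i p, (i <= j)%N -> p \in pts ->
    \sum_(q <- pts | sep (x q) (x p) <= 2 ^- i) m q <= C * tau ^- i.

(** The shell of radius [2 ^- i] contributes about [(4 / tau) ^+ i]; as
[tau < 4] this is a geometric sum dominated by the smallest shell. *)
Lemma shells_mass (C tau : R) (j : nat) (p : P) :
  0 < tau < 4 -> 0 <= C -> (forall q, 0 <= m q) -> frostman C tau j -> p \in pts ->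
  \sum_(q <- pts) m q * shells j (sep (x q) (x p)) <=
  C * (1 + 16 / (4 - tau)) * (4 / tau) ^+ j.
Proof.
move=> /andP[t0 t4] C0 m0 [M1 F] pp.
rewrite /shells.
under eq_bigr do rewrite mulrDr mulr1 mulr_sumr.
rewrite big_split /= exchange_big /=.
set q := 4 / tau.
have q1 : 1 < q by rewrite ltr_pdivlMr// mul1r.
have qj : 1 <= q ^+ j by rewrite exprn_ege1// ltW.
have B : \sum_(i < j.+1) \sum_(i0 <- pts)
    m i0 * (4 ^+ i.+1 * (sep (x i0) (x p) <= 2 ^- i)%R%:R) <=
    \sum_(i < j.+1) 4 * C * q ^+ i.
  apply: ler_sum => i _.
  have -> : \sum_(i0 <- pts) m i0 * (4 ^+ i.+1 * (sep (x i0) (x p) <= 2 ^- i)%R%:R) =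
      4 ^+ i.+1 * \sum_(i0 <- pts | sep (x i0) (x p) <= 2 ^- i) m i0.
    rewrite [in RHS]big_mkcond mulr_sumr; apply: eq_bigr => r _.
    by case: ifP => _; rewrite ?mulr1 ?mulr0 // mulrC.
  apply: (@le_trans _ _ (4 ^+ i.+1 * (C * tau ^- i))).
    by rewrite ler_wpM2l ?exprn_ge0// F// -ltnS.
  by rewrite /q exprMn exprVn exprS; rewrite le_eqVlt; apply/orP; left; apply/eqP; ring.
have G : \sum_(i < j.+1) q ^+ i <= 4 / (4 - tau) * q ^+ j.
  have -> : 4 / (4 - tau) = q / (q - 1) by rewrite /q; field; rewrite ?gt_eqF//; lra.
  have q10 : 0 < q - 1 by lra.
  rewrite -(ler_pM2l q10).
  have := subrX1 q j.+1 => <-.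
  rewrite [leRHS](_ : _ = q ^+ j.+1); last by rewrite exprS; field; rewrite gt_eqF.
  by lra.
rewrite -mulr_sumr in B.
have B2 : 4 * C * \sum_(i < j.+1) q ^+ i <= 4 * C * (4 / (4 - tau) * q ^+ j).
  by rewrite ler_wpM2l//; lra.
have B3 : \sum_(i <- pts) m i <= C * q ^+ j.
  by rewrite (le_trans M1)// ler_peMr.
apply: le_trans (lerD B3 (le_trans B B2)) _.
by rewrite le_eqVlt; apply/orP; left; apply/eqP; field; rewrite gt_eqF//; lra.
Qed.

(** Expanding the square, the mean over all lines of the squared difference
between the masses of a tube of width about [2 ^- j] and of the tube [K] times
wider, each divided by its width, is this double sum; the kernel bound and the
ball condition then give the dimension [log2 tau - 1]. *)
Lemma band_energy (K L C tau : R) (j n : nat) :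
  1 <= K -> 1 <= L -> 0 < tau < 4 -> 0 <= C -> (forall q, 0 <= m q) ->
  (forall p q, p \in pts -> q \in pts -> sep (x q) (x p) <= 4) ->
  frostman C tau j ->
  400 * taylor_const K L * (8 * 2 ^+ j) ^+ 3 <= n%:R ->
  \sum_(i < n) \sum_(p <- pts) \sum_(q <- pts) m p * m q *
    (2 ^+ j * band K L (2 ^+ j * (proj (x q) (i%:R / n%:R) - proj (x p) (i%:R / n%:R))))
  <= n%:R * (kernel_const K L * (1 + 16 / (4 - tau)) * C * (\sum_(p <- pts) m p)
       * (2 / tau) ^+ j).
Proof.
move=> K1 L1 t04 C0 m0 sp F nV.
have j0 : 0 < 2 ^+ j :> R by rewrite exprn_gt0.
have C1 : 0 <= kernel_const K L by exact: le_trans ler01 (kernel_const_ge1 K1 L1).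
rewrite exchange_big /=.
apply: (@le_trans _ _ (\sum_(p <- pts) m p * (n%:R * (kernel_const K L * 2 ^- j *
   (C * (1 + 16 / (4 - tau)) * (4 / tau) ^+ j))))); last first.
  rewrite -mulr_suml le_eqVlt; apply/orP; left; apply/eqP.
  have -> : (4 / tau) ^+ j = 2 ^+ j * (2 / tau) ^+ j.
    by rewrite -exprMn mulrA; congr ((_ / _) ^+ _); ring.
  have h1 : 4 - tau != 0 by rewrite gt_eqF//; case/andP: t04; lra.
  by field; rewrite h1 gt_eqF.
rewrite big_seq [leRHS]big_seq; apply: ler_sum => p pp.
rewrite exchange_big /=.
apply: (@le_trans _ _ (\sum_(q <- pts) m p * (m q *
    (n%:R * (kernel_const K L * 2 ^- j * shells j (sep (x q) (x p))))))).
  rewrite big_seq [leRHS]big_seq; apply: ler_sum => q qq.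
  rewrite -mulr_sumr -mulrA ler_wpM2l// ler_wpM2l//.
  by apply: band_pair => //; exact: sp.
rewrite -mulr_sumr ler_wpM2l//.
rewrite (_ : \sum_(q <- pts) _ = n%:R * (kernel_const K L * 2 ^- j *
   \sum_(q <- pts) m q * shells j (sep (x q) (x p)))); last first.
  by rewrite !mulr_sumr; apply: eq_bigr => q _; ring.
rewrite ler_wpM2l// ler_wpM2l//; first by rewrite mulr_ge0// invr_ge0 ltW.
exact: shells_mass.
Qed.

End Points.
End Energy.

(** * Incidence sums and their high-frequency part *)

(** The angles of one column of squares form a block of consecutive samples. *)
Lemma big_block (R : nmodType) (a b k : nat) (F : nat -> R) : (k < a)%N -> (0 < b)%N ->
  \sum_(i < a * b | (i %/ b == k)%N) F i = \sum_(i < b) F (k * b + i)%N.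
Proof.
move=> ka b0.
rewrite -(big_mkord (fun i => (i %/ b == k)%N) F).
rewrite (@big_cat_nat _ _ _ (k * b)%N) //=; last by rewrite leq_mul2r ltnW ?orbT.
rewrite (@big_cat_nat _ _ _ (k * b + b)%N (k * b)%N) //=; first last.
- by rewrite -mulSnr leq_mul2r ka orbT.
- exact: leq_addr.
rewrite big_nat_cond big1 ?add0r; last first.
  by move=> i /andP[/andP[_ ik] /eqP ke]; move: ik; rewrite -ltn_divLR// ke ltnn.
rewrite [X in _ + X]big_nat_cond [X in _ + X]big1 ?addr0; last first.
  by move=> i /andP[/andP[ik _] /eqP ke]; move: ik; rewrite -mulSnr -leq_divRL// ke ltnn.
rewrite -{1}[(k * b)%N]add0n big_addn addKn big_mkord.
under [RHS]eq_bigr do rewrite addnC.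
apply: eq_bigl => i; rewrite divnDMl// divn_small//; exact: eqxx.
Qed.

Section Overlap.
Variable R : realDomainType.
Implicit Types a b c d : R.

Lemma overlap_bound a b c d : a <= b -> c <= d -> 0 <= overlap a b c d <= b - a.
Proof.
rewrite /overlap => ab cd.
have [?|?] := leP b d; have [?|?] := leP b c; have [?|?] := leP a d;
have [?|?] := leP a c; lra.
Qed.

Lemma overlap_gt0 a b c d : a <= b -> c <= d -> 0 < overlap a b c d -> c < b /\ a < d.
Proof.
rewrite /overlap => ab cd.
have [?|?] := leP b d; have [?|?] := leP b c; have [?|?] := leP a d;
have [?|?] := leP a c; (try by move=> ?; split; lra); lra.
Qed.

Lemma overlap_sub a b c d : a <= b -> c <= a -> b <= d -> overlap a b c d = b - a.
Proof.
rewrite /overlap => ab ca bd.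
rewrite (min_l bd) (min_r (le_trans ca ab)) (min_l (le_trans ab bd)) (min_r ca); ring.
Qed.

Lemma overlapC a b c d : overlap a b c d = overlap c d a b.
Proof. by rewrite /overlap (minC b) (minC b c) (minC a d) (minC a); ring. Qed.
End Overlap.

Section Recursion.
Variables (R : realType) (P : eqType) (pts : seq P) (x : P -> R * R) (m : P -> R).
Variables (L N : nat).
Implicit Types (q : nat * int) (s : seq (nat * int)) (j : nat).

(** A pair [(k, l)] denotes at level [j] the parameter square
[[k, k + 1) * [l, l + 1)] scaled by [2 ^- j]; its offsets lie between [lo] and [hi]. *)
Definition lo j q : R := q.2%:~R / 2 ^+ j.
Definition hi j q : R := (q.2 + 1)%:~R / 2 ^+ j.
Definition angle (i : nat) : R := i%:R / (2 ^ N)%:R.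

(** The incidence of a point and a square, smoothed over the offset: it is
positive only when some line of the square in the sampled direction passes
within [H] of the point, and at most the side of the square. *)
Definition hit j (H : R) (i : nat) q (p : P) : R :=
  overlap (lo j q) (hi j q) (proj (x p) (angle i) - H) (proj (x p) (angle i) + H).

(** For each sampled angle only the squares above that angle count, so that a
square sees a share [2 ^- j] of the angles. *)
Definition tube_sum j (H : R) s : R :=
  \sum_(i < 2 ^ N) \sum_(q <- s | (i %/ 2 ^ (N - j) == q.1)%N)
    \sum_(p <- pts) m p * hit j H i q p.

Lemma lo_hi j q : hi j q - lo j q = 2 ^- j.
Proof. by rewrite /hi /lo rmorphD /=; ring. Qed.

Lemma le_lo_hi j q : lo j q <= hi j q.
Proof. by rewrite -subr_ge0 lo_hi invr_ge0 exprn_ge0. Qed.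

Lemma lo_hi_disjoint j q q' : q.1 = q'.1 ->
  overlap (lo j q) (hi j q) (lo j q') (hi j q') = 2 ^- j * (q == q')%:R.
Proof.
case: q q' => [k l] [k' l'] /= ->; rewrite xpair_eqE eqxx /=.
have j0 : 0 < 2 ^- j :> R by rewrite invr_gt0 exprn_gt0.
have [ll|ll] := eqVneq l l'.
  by rewrite ll overlap_sub ?lexx ?le_lo_hi// lo_hi mulr1.
rewrite mulr0; apply/eqP; have [b0 _] := andP (overlap_bound (le_lo_hi j (k', l)) (le_lo_hi j (k', l'))).
rewrite eq_le b0 andbT leNgt; apply/negP => /overlap_gt0.
move=> /(_ (le_lo_hi j _) (le_lo_hi j _))[].
rewrite /lo /hi /= !ltr_pM2r// !ltr_int; lia.
Qed.

(** Katz-Tao condition on a list of level-[j] squares, tested on the windows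
that are dyadic in the angle but arbitrary in the offset, so that it survives
translations of the offset. *)
Definition window_kt (kap A : R) j s :=
  forall (e k : nat) (c : int), (e <= j)%N ->
    (count (fun q => (q.1 %/ 2 ^ e == k)%N && (c <= q.2 < c + (2 ^ e)%N%:Z)) s)%:R <= kap * A ^+ e.

Lemma count_mem_kt (kap A : R) j s q : window_kt kap A j s ->
  (count_mem q s)%:R <= kap.
Proof.
move=> /(_ 0%N q.1 q.2 (leq0n _)); rewrite expr0 mulr1; apply: le_trans.
rewrite ler_nat; apply: sub_count => r /= /eqP ->.
by rewrite expn0 divn1 eqxx /= lexx ltrDl.
Qed.

(** Passing from all the weighted arithmetic means to the geometric mean. *)
Lemma cauchy_schwarz_scale (U X Y : R) : 0 <= X -> 0 <= Y ->
  (forall a b : R, 0 <= a -> 0 <= b -> 2 * a * b * U <= a ^+ 2 * X + b ^+ 2 * Y) ->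
  U <= Num.sqrt (X * Y).
Proof.
move=> X0 Y0 H.
have [U0|U0] := leP U 0; first by rewrite (le_trans U0)// sqrtr_ge0.
rewrite -(ger0_norm (ltW U0)) -sqrtr_sqr ler_sqrt ?mulr_ge0//.
move: X0; rewrite le_eqVlt => /orP[/eqP X0|X0].
  have := H (Y + 1) U ltac:(lra) (ltW U0); rewrite -X0 mulr0 add0r mul0r.
  rewrite (_ : 2 * (Y + 1) * U * U = U ^+ 2 * (2 * (Y + 1))); last by ring.
  by rewrite ler_pM2l ?exprn_gt0//; lra.
have := H U X (ltW U0) (ltW X0).
rewrite (_ : 2 * U * X * U = X * (2 * U ^+ 2)); last by ring.
rewrite (_ : U ^+ 2 * X + X ^+ 2 * Y = X * (U ^+ 2 + X * Y)); last by ring.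
by rewrite ler_pM2l//; lra.
Qed.

(** For one angle: [overlap_gram_ge0] applied to the cells of a column of
squares together with the intervals around the projected points, those of half
width [L] scaled by [2 ^- j] with negative and those [K] times longer with
positive coefficients. *)
Lemma column_gram (K : R) j (i : nat) s (a b : R) : 0 < K ->
  2 * a * b * \sum_(q <- s) \sum_(p <- pts)
     m p * (hit j (L%:R / 2 ^+ j) i q p - hit j (L%:R * K / 2 ^+ j) i q p / K) <=
  a ^+ 2 * \sum_(q <- s) \sum_(q' <- s) overlap (lo j q) (hi j q) (lo j q') (hi j q') +
  b ^+ 2 * (4 ^- j * \sum_(p <- pts) \sum_(p' <- pts) m p * m p' *
     (2 ^+ j * band K L%:R (2 ^+ j * (proj (x p') (angle i) - proj (x p) (angle i))))).
Proof.
move=> K0.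
have j0 : 0 < 2 ^+ j :> R by rewrite exprn_gt0.
pose y p := proj (x p) (angle i).
pose h := L%:R / 2 ^+ j : R. pose g := L%:R * K / 2 ^+ j : R.
have := overlap_gram_ge0 ([seq (a, (lo j q, hi j q)) | q <- s] ++
   ([seq (- b * m p, (y p - h, y p + h)) | p <- pts] ++
    [seq (b * m p / K, (y p - g, y p + g)) | p <- pts])).
rewrite !big_cat !big_map /=.
under eq_bigr do rewrite !big_cat !big_map /=.
under [X in _ + (X + _)]eq_bigr do rewrite !big_cat !big_map /=.
under [X in _ + (_ + X)]eq_bigr do rewrite !big_cat !big_map /=.
rewrite !big_split /=.
set S1 := \sum_(q <- s) \sum_(q' <- s) _.
set S2 := \sum_(q <- s) \sum_(p <- pts) _.
set S3 := \sum_(q <- s) \sum_(p <- pts) _.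
set S4 := \sum_(p <- pts) \sum_(q <- s) _.
set S5 := \sum_(p <- pts) \sum_(p' <- pts) _.
set S6 := \sum_(p <- pts) \sum_(p' <- pts) _.
set S7 := \sum_(p <- pts) \sum_(q <- s) _.
set S8 := \sum_(p <- pts) \sum_(p' <- pts) _.
set S9 := \sum_(p <- pts) \sum_(p' <- pts) _.
move=> H.
have E1 : S1 = a ^+ 2 * \sum_(q <- s) \sum_(q' <- s) overlap (lo j q) (hi j q) (lo j q') (hi j q').
  by rewrite mulr_sumr; apply: eq_bigr => q _; rewrite mulr_sumr; apply: eq_bigr.
have E4 : S4 = S2.
  rewrite /S4 exchange_big /=; apply: eq_bigr => q _; apply: eq_bigr => p _.
  by rewrite overlapC; ring.
have E7 : S7 = S3.
  rewrite /S7 exchange_big /=; apply: eq_bigr => q _; apply: eq_bigr => p _.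
  by rewrite overlapC; ring.
have E23 : S2 + S3 = - (a * b * \sum_(q <- s) \sum_(p <- pts)
     m p * (hit j (L%:R / 2 ^+ j) i q p - hit j (L%:R * K / 2 ^+ j) i q p / K)).
  rewrite -big_split mulr_sumr -sumrN; apply: eq_bigr => q _ /=.
  rewrite -big_split mulr_sumr -sumrN; apply: eq_bigr => p _ /=.
  by rewrite /hit -/(y p) -/h -/g; field; rewrite gt_eqF.
have E5 : S5 + S6 + (S8 + S9) = b ^+ 2 * (4 ^- j * \sum_(p <- pts) \sum_(p' <- pts) m p * m p' *
     (2 ^+ j * band K L%:R (2 ^+ j * (proj (x p') (angle i) - proj (x p) (angle i))))).
  rewrite -!big_split /= !mulr_sumr; apply: eq_bigr => p _.
  rewrite -!big_split /= !mulr_sumr; apply: eq_bigr => p' _.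
  rewrite !overlap_centred -!/(y _).
  have E z : z = 2 ^- j * (2 ^+ j * z) :> R by rewrite mulKf// gt_eqF.
  have tC u v z : tent u v z = tent v u z :> R by rewrite /tent (addrAC z u v) (addrAC z (- u) (- v)); ring.
  rewrite (tC g h) (E (y p' - y p)) /h /g ![_ / 2 ^+ j]mulrC !tent_scale ?invr_ge0 ?(ltW j0)//.
  rewrite -E /band (_ : 4 ^- j = 2 ^- j * 2 ^- j); last first.
    by rewrite -invfM -exprMn; congr (_ ^+ _)^-1; ring.
  by field; rewrite !gt_eqF.
lra.
Qed.


Hypothesis L34 : (34 <= L)%N.
Hypothesis m0 : forall p, 0 <= m p.
Hypothesis xb : forall p, p \in pts -> `|(x p).1| <= 2 /\ `|(x p).2| <= 2.

Lemma sep_le4 p p' : p \in pts -> p' \in pts -> sep (x p') (x p) <= 4.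
Proof.
move=> /xb[a1 a2] /xb[b1 b2]; rewrite /sep ge_max.
by apply/andP; split; apply: le_trans (ler_normB _ _) _; lra.
Qed.

(** Cauchy-Schwarz over all lines: the difference of the two scales is
controlled by [band_energy], and the squares by their number times the
multiplicity [kap]. The condition [8 <= A * tau] says that the two dimensions
add up to at least 3, which is what turns the bound into one that does not
deteriorate from scale to scale. *)
Lemma high_part (K C tau A kap : R) j s :
  1 <= K -> 0 < tau < 4 -> 0 <= C -> frostman pts x m C tau j ->
  0 <= kap -> window_kt kap A j s -> (forall q, q \in s -> (q.1 < 2 ^ j)%N) ->
  (j <= N)%N -> 8 <= A * tau ->
  400 * taylor_const K L%:R * (8 * 2 ^+ j) ^+ 3 <= (2 ^ N)%:R ->
  8 ^+ j * (tube_sum j (L%:R / 2 ^+ j) s - tube_sum j (L%:R * K / 2 ^+ j) s / K) <=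
  2 ^+ N * Num.sqrt (kernel_const K L%:R * (1 + 16 / (4 - tau)) *
    (kap * (size s)%:R * C * (\sum_(p <- pts) m p) * A ^+ j)).
Proof.
move=> K1 t04 C0 F kap0 kt sj jN At nV.
have [t0 t4] := andP t04.
have j0 : 0 < 2 ^+ j :> R by rewrite exprn_gt0.
have N0 : 0 < 2 ^+ N :> R by rewrite exprn_gt0.
have L1 : 1 <= L%:R :> R by rewrite ler1n (leq_trans _ L34).
have K0 : 0 < K by lra.
pose M := \sum_(p <- pts) m p.
have M0 : 0 <= M by apply: sumr_ge0.
pose C1 := kernel_const K L%:R * (1 + 16 / (4 - tau)).
have C10 : 0 <= C1.
  apply: mulr_ge0; first exact: le_trans ler01 (kernel_const_ge1 K1 L1).
  by rewrite addr_ge0// divr_ge0// subr_ge0 ltW.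
have en := band_energy K1 L1 t04 C0 m0 sep_le4 F nV.
set U := (_ - _); pose T := 4 ^- j * 2 ^+ N : R.
have T0 : 0 < T by rewrite mulr_gt0// invr_gt0 exprn_gt0.
suff H : U / T <= Num.sqrt (kap * (size s)%:R * (C1 * C * M * (2 / tau) ^+ j)).
  have -> : 8 ^+ j * U = 2 ^+ N * (2 ^+ j * (U / T)).
    rewrite /T (_ : 8 = 2 * 4)%R; last by ring.
    by rewrite exprMn; field; rewrite !gt_eqF// exprn_gt0.
  rewrite ler_pM2l//.
  have -> : Num.sqrt (C1 * (kap * (size s)%:R * C * M * A ^+ j)) =
     2 ^+ j * Num.sqrt (C1 * (kap * (size s)%:R * C * M * (A / 4) ^+ j)).
    rewrite -{1}(ger0_norm (ltW j0)) -sqrtr_sqr -sqrtrM ?sqr_ge0//; congr Num.sqrt.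
    have -> : A = 2 * 2 * (A / 4) by field.
    by rewrite {1}exprMn exprMn (_ : 2 * 2 * (A / 4) / 4 = A / 4);[ring|field].
  rewrite ler_wpM2l ?(ltW j0)//; apply: le_trans H _.
  rewrite ler_wsqrtr//.
  rewrite (_ : kap * (size s)%:R * (C1 * C * M * (2 / tau) ^+ j) =
    C1 * (kap * (size s)%:R * C * M * (2 / tau) ^+ j)); last by ring.
  rewrite ler_wpM2l// ler_wpM2l ?mulr_ge0//.
  have A0 : 0 <= A by rewrite -(pmulr_lge0 _ t0); apply: le_trans At; lra.
  apply: lerXn2r; rewrite ?nnegrE; first by rewrite divr_ge0// ltW.
    by rewrite divr_ge0.
  by rewrite ler_pdivrMr//; lra.
apply: cauchy_schwarz_scale => [||a b a0 b0]; first by rewrite mulr_ge0.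
  by apply: mulr_ge0; [exact: mulr_ge0 (mulr_ge0 C10 C0) M0|rewrite exprn_ge0// divr_ge0// ltW].
suff H : 2 * a * b * U <= a ^+ 2 * (T * (kap * (size s)%:R)) +
   b ^+ 2 * (4 ^- j * ((2 ^ N)%:R * (C1 * C * M * (2 / tau) ^+ j))).
  rewrite -(ler_pM2r T0); apply: le_trans (_ : 2 * a * b * U <= _).
    by rewrite -[_ * (U / T) * T]mulrA divfK// gt_eqF.
  by apply: le_trans H _; rewrite /T natrX le_eqVlt; apply/orP; left; apply/eqP; ring.
rewrite /U /tube_sum mulr_suml -sumrB mulr_sumr.
apply: (@le_trans _ _ (\sum_(i < 2 ^ N) (a ^+ 2 * \sum_(q <- s | (i %/ 2 ^ (N - j) == q.1)%N)
    \sum_(q' <- s | (i %/ 2 ^ (N - j) == q'.1)%N) overlap (lo j q) (hi j q) (lo j q') (hi j q') +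
  b ^+ 2 * (4 ^- j * \sum_(p <- pts) \sum_(p' <- pts) m p * m p' *
     (2 ^+ j * band K L%:R (2 ^+ j * (proj (x p') (angle i) - proj (x p) (angle i)))))))).
  apply: ler_sum => i _.
  have := @column_gram K j i [seq q <- s | (i %/ 2 ^ (N - j) == q.1)%N] a b K0.
  rewrite !big_filter.
  rewrite (_ : \sum_(q <- s | (i %/ 2 ^ (N - j) == q.1)%N) _ - _ = \sum_(q <- s | (i %/ 2 ^ (N - j) == q.1)%N)
       \sum_(p <- pts) m p * (hit j (L%:R / 2 ^+ j) i q p - hit j (L%:R * K / 2 ^+ j) i q p / K)); last first.
    rewrite mulr_suml -sumrB; apply: eq_bigr => q _.
    by rewrite mulr_suml -sumrB; apply: eq_bigr => p _; ring.
  move=> /le_trans; apply; rewrite lerD2r le_eqVlt; apply/orP; left; apply/eqP.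
  by congr (_ * _); apply: eq_bigr => q _; rewrite big_filter.
rewrite big_split /= -!mulr_sumr lerD// ler_wpM2l ?sqr_ge0//; last first.
  by rewrite ler_wpM2l ?invr_ge0 ?exprn_ge0.
(* only equal squares of a column overlap *)
apply: (@le_trans _ _ (\sum_(i < 2 ^ N) \sum_(q <- s | (i %/ 2 ^ (N - j) == q.1)%N) 2 ^- j * kap)).
  apply: ler_sum => i _; apply: ler_sum => q /eqP iq.
  rewrite (eq_bigr (fun q' => 2 ^- j * (q == q')%R%:R)); last first.
    by move=> q' /eqP iq'; rewrite lo_hi_disjoint// -iq -iq'.
  rewrite -mulr_sumr ler_wpM2l ?invr_ge0 ?(ltW j0)//.
  apply: le_trans (count_mem_kt q kt).
  rewrite -sum1_count natr_sum big_mkcond [leRHS]big_mkcond; apply: ler_sum => q' _.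
  by rewrite /= (eq_sym q'); case: eqP => _; case: ifP.
rewrite (exchange_big_dep xpredT) //=.
apply: (@le_trans _ _ (\sum_(q <- s) (2 ^ (N - j))%:R * (2 ^- j * kap))).
  rewrite big_seq [leRHS]big_seq; apply: ler_sum => q /sj qj.
  have -> : (2 ^ N = 2 ^ j * 2 ^ (N - j))%N by rewrite -expnD subnKC.
  rewrite (@big_block _ _ _ q.1 (fun=> 2 ^- j * kap))// ?expn_gt0//.
  by rewrite big_const_ord iter_addr_0 mulr_natl.
rewrite big_const_seq count_predT iter_addr_0 -[leLHS]mulr_natr natrX.
rewrite /T le_eqVlt; apply/orP; left; apply/eqP.
have -> : 2 ^+ N = 2 ^+ j * 2 ^+ (N - j) :> R by rewrite -exprD subnKC.
have -> : 4 ^+ j = 2 ^+ j * 2 ^+ j :> R by rewrite -exprMn; congr (_ ^+ _); ring.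
by field; rewrite gt_eqF.
Qed.

End Recursion.

(** * Passing to a coarser scale *)

Section Low.
Variables (R : realType) (P : eqType) (pts : seq P) (x : P -> R * R) (m : P -> R).
Variables (L N : nat).
Implicit Types (q : nat * int) (s : seq (nat * int)) (j e : nat).

(** The square containing [q] with side [2 ^ e] times larger, moved by [d] such
sides in the offset. *)
Definition parent e (d : int) q : nat * int :=
  ((q.1 %/ 2 ^ e)%N, ((q.2 %/ (2 ^ e)%N%:Z)%Z + d)%R).

(** Over the angles of a parent square a projected point moves by about the side
of that square, so that one widened interval must be replaced by two shifted
parent cells. *)
Definition coarsen e s : seq (nat * int) :=
  map (parent e (- L%:Z)) s ++ map (parent e (L%:Z - 1)) s.

Lemma size_coarsen e s : size (coarsen e s) = (2 * size s)%N.
Proof. by rewrite size_cat !size_map mul2n addnn. Qed.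

(** Windows pull back to windows under [parent], because they may start at any
offset; dyadic squares would not. *)
Lemma window_coarsen (kap A : R) j e s : 0 <= A -> (e <= j)%N ->
  window_kt kap A j s -> window_kt (2 * kap * A ^+ e) A (j - e) (coarsen e s).
Proof.
move=> A0 ej kt f k c fj.
rewrite count_cat natrD !count_map.
have B d : (count (preim (parent e d) (fun q => (q.1 %/ 2 ^ f == k)%N &&
    (c <= q.2 < c + (2 ^ f)%N%:Z))) s)%:R <= kap * A ^+ e * A ^+ f.
  rewrite -mulrA -exprD.
  have ef : (e + f <= j)%N by lia.
  apply: le_trans (kt (e + f)%N k ((c - d) * (2 ^ e)%N%:Z) ef).
  rewrite ler_nat; apply: sub_count => q /=.
  rewrite -divnMA -expnD => /andP[-> /=].
  have e0 : 0 < (2 ^ e)%N%:Z by rewrite ltz_nat expn_gt0.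
  rewrite -lerBlDr -ltrBrDr lez_divRL// ltz_divLR// => /andP[-> /=] h.
  rewrite (lt_le_trans h)// expnD PoszM; lia.
have := B (- L%:Z); have := B (L%:Z - 1).
by rewrite (_ : 2 * _ * _ * _ = kap * A ^+ e * A ^+ f + kap * A ^+ e * A ^+ f);
  [lra|ring].
Qed.

Lemma coarsen_lt j e s : (e <= j)%N -> (forall q, q \in s -> (q.1 < 2 ^ j)%N) ->
  forall q, q \in coarsen e s -> (q.1 < 2 ^ (j - e))%N.
Proof.
move=> ej sj q; rewrite mem_cat => /orP[] /mapP[r /sj rj ->] /=;
by rewrite ltn_divLR ?expn_gt0// -expnD subnK.
Qed.

Hypothesis L34 : (34 <= L)%N.
Hypothesis m0 : forall p, 0 <= m p.
Hypothesis xb : forall p, p \in pts -> `|(x p).1| <= 2 /\ `|(x p).2| <= 2.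

Lemma subn_subn j e : (e <= j)%N -> (j <= N)%N -> (N - (j - e) = N - j + e)%N.
Proof. by move=> ej jN; lia. Qed.

Lemma angle_cell j (i k : nat) : (j <= N)%N -> (i %/ 2 ^ (N - j) = k)%N ->
  k%:R / 2 ^+ j <= angle R N i <= (k%:R + 1) / 2 ^+ j.
Proof.
move=> jN ik; rewrite /angle natrX.
have j0 : 0 < 2 ^+ j :> R by rewrite exprn_gt0.
have n0 : 0 < 2 ^+ (N - j) :> R by rewrite exprn_gt0.
have -> : 2 ^+ N = 2 ^+ (N - j) * 2 ^+ j :> R by rewrite -exprD subnK.
rewrite ler_pdivlMr ?mulr_gt0// ler_pdivrMr ?mulr_gt0//.
rewrite (_ : k%:R / 2 ^+ j * _ = k%:R * 2 ^+ (N - j)); last by field; rewrite gt_eqF.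
rewrite (_ : _ / 2 ^+ j * _ = (k%:R + 1) * 2 ^+ (N - j)); last by field; rewrite gt_eqF.
rewrite natr1 -!natrX -!natrM !ler_nat -ik leq_trunc_div /=.
by rewrite ltnW// ltn_ceil ?expn_gt0.
Qed.

(** If the wide interval meets a cell, then from every angle of the parent
column one of the two shifted parent cells lies inside it: the projected point
has moved by at most [32] sides, and [L - 34] sides are left. *)
Lemma hit_parent j e (i i' : nat) q p : (e <= j)%N -> (j <= N)%N -> p \in pts ->
  (i %/ 2 ^ (N - j) = q.1)%N -> (i' %/ 2 ^ (N - (j - e)) = q.1 %/ 2 ^ e)%N ->
  let H := L%:R / 2 ^+ (j - e) in
  2 ^+ e * hit x N j H i q p <=
    hit x N (j - e) H i' (parent e (- L%:Z) q) p +
    hit x N (j - e) H i' (parent e (L%:Z - 1) q) p.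
Proof.
move=> ej jN pp iq iq' /=.
set H := L%:R / _.
have j0 : 0 < 2 ^+ j :> R by rewrite exprn_gt0.
have f0 : 0 < 2 ^+ (j - e) :> R by rewrite exprn_gt0.
have e0 : 0 < 2 ^+ e :> R by rewrite exprn_gt0.
have E : 2 ^+ j = 2 ^+ e * 2 ^+ (j - e) :> R by rewrite -exprD subnKC.
pose rr : R := 2 ^- (j - e).
have r0 : 0 < rr by rewrite invr_gt0.
have HE : H = L%:R * rr by [].
have H0 : 0 <= H by rewrite HE mulr_ge0// ltW.
set y := proj (x p) (angle R N i); set y' := proj (x p) (angle R N i').
have ovb k r z : 0 <= hit x N k H z r p <= 2 ^- k.
  have := @overlap_bound R (lo R k r) (hi R k r) (proj (x p) (angle R N z) - H) (proj (x p) (angle R N z) + H).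
  by rewrite lo_hi; apply; [exact: le_lo_hi|lra].
have [h1 h2] := andP (ovb (j - e)%N (parent e (- L%:Z) q) i').
have [h3 h4] := andP (ovb (j - e)%N (parent e (L%:Z - 1) q) i').
have [h5 h6] := andP (ovb j q i).
have [h0|h0] := leP (hit x N j H i q p) 0.
  have -> : hit x N j H i q p = 0 by lra.
  by rewrite mulr0 addr_ge0.
have {h0}[]  := overlap_gt0 (le_lo_hi R j q) _ h0; first by lra.
rewrite -/y => yl yr.
(* [a] is the offset of the parent cell, whose side is [rr] *)
pose a := (q.2 %/ (2 ^ e)%N%:Z)%Z.
have e0z : 0 < (2 ^ e)%N%:Z by rewrite ltz_nat expn_gt0.
have eR : (2 ^ e)%N%:Z%:~R = 2 ^+ e :> R by rewrite -natrX.
have al : a%:~R * rr <= lo R j q.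
  rewrite /lo E /rr invfM mulrA ler_pM2r ?invr_gt0// ler_pdivlMr//.
  by rewrite -eR -rmorphM ler_int lez_floor// gt_eqF.
have ar : hi R j q <= (a%:~R + 1) * rr.
  rewrite /hi E /rr invfM mulrA ler_pM2r ?invr_gt0// ler_pdivrMr//.
  have -> : a%:~R + 1 = (a + 1)%:~R :> R by rewrite rmorphD.
  by rewrite -eR -rmorphM ler_int lezD1 ltz_ceil.
have ang : `|angle R N i - angle R N i'| <= rr.
  have [A1 A2] := andP (angle_cell (leq_trans (leq_subr e j) jN) iq').
  have B1 : (q.1 %/ 2 ^ e = i %/ 2 ^ (N - (j - e)))%N.
    by rewrite -iq -divnMA -expnD subn_subn.
  have [C1 C2] := andP (angle_cell (leq_trans (leq_subr e j) jN) (esym B1)).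
  rewrite /rr ler_norml; move: A1 A2 C1 C2; rewrite mulrDl mul1r; lra.
have [x1 x2] := xb pp.
have yy : `|y - y'| <= 32 * rr.
  apply: le_trans (proj_lip _ _ x1 x2) _; lra.
have L34' : 34 <= L%:R :> R by rewrite (ler_nat _ 34).
have Lr : 34 * rr <= L%:R * rr by rewrite ler_pM2r.
move: yy; rewrite ler_norml => /andP[yy1 yy2].
have ra d : lo R (j - e) (parent e d q) = a%:~R * rr + d%:~R * rr.
  by rewrite /lo /= -/a rmorphD /= mulrDl.
have rb d : hi R (j - e) (parent e d q) = a%:~R * rr + d%:~R * rr + rr.
  by rewrite -ra -(subrK (lo R (j-e) (parent e d q)) (hi _ _ _)) lo_hi addrC.
have dn : (- L%:Z)%:~R = - L%:R :> R by rewrite rmorphN.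
have dp : (L%:Z - 1)%:~R = L%:R - 1 :> R by rewrite rmorphB.
have er : 2 ^+ e * hit x N j H i q p <= rr.
  apply: le_trans (_ : 2 ^+ e * 2 ^- j <= _); first by rewrite ler_pM2l.
  by rewrite E /rr invfM mulrA divff ?mul1r// gt_eqF.
have [c|c] := leP y' (a%:~R * rr).
  have -> : hit x N (j - e) H i' (parent e (- L%:Z) q) p = rr.
    by rewrite /hit overlap_sub ?le_lo_hi ?lo_hi// -/y' ?ra ?rb dn HE; lra.
  by lra.
have -> : hit x N (j - e) H i' (parent e (L%:Z - 1) q) p = rr.
  by rewrite /hit overlap_sub ?le_lo_hi ?lo_hi// -/y' ?ra ?rb dp HE; lra.
by lra.
Qed.

(** The sum for the widened tubes is at most the sum of the same kind at the
coarser scale; the shape of the statement is preserved, so it can be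
iterated. *)
Lemma low_part j e s : (e <= j)%N -> (j <= N)%N ->
  (forall q, q \in s -> (q.1 < 2 ^ j)%N) ->
  let H := L%:R / 2 ^+ (j - e) in
  8 ^+ j / 2 ^+ e * tube_sum pts x m N j H s <=
  8 ^+ (j - e) * tube_sum pts x m N (j - e) H (coarsen e s).
Proof.
move=> ej jN sj /=; set H := L%:R / _.
have e0 : 0 < 2 ^+ e :> R by rewrite exprn_gt0.
have E8 : 8 ^+ j = 8 ^+ (j - e) * 2 ^+ e * 2 ^+ e * 2 ^+ e :> R.
  rewrite -[in LHS](subnK ej) exprD -!mulrA; congr (_ * _).
  by rewrite -!exprMn; congr (_ ^+ _); ring.
rewrite E8 mulfK ?gt_eqF// -!(mulrA (8 ^+ _)) ler_pM2l ?exprn_gt0//.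
rewrite /tube_sum (exchange_big_dep xpredT) //= [leRHS](exchange_big_dep xpredT) //=.
rewrite /coarsen big_cat !big_map /= -big_split /= mulr_sumr big_seq [leRHS]big_seq.
apply: ler_sum => q qs.
rewrite -big_split /=.
have qj := sj _ qs.
have jeN : (j - e <= N)%N by rewrite (leq_trans (leq_subr _ _)).
have qj' : (q.1 %/ 2 ^ e < 2 ^ (j - e))%N.
  by rewrite ltn_divLR ?expn_gt0// -expnD subnK.
pose a i := \sum_(p <- pts) m p * hit x N j H i q p.
pose b i := \sum_(p <- pts) m p * hit x N (j - e) H i (parent e (- L%:Z) q) p +
            \sum_(p <- pts) m p * hit x N (j - e) H i (parent e (L%:Z - 1) q) p.
under eq_bigr do rewrite -/(a _).
under [leRHS]eq_bigr do rewrite -/(b _).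
have ab i i' : (i %/ 2 ^ (N - j) = q.1)%N -> (i' %/ 2 ^ (N - (j - e)) = q.1 %/ 2 ^ e)%N ->
    2 ^+ e * a i <= b i'.
  move=> iq iq'; rewrite /a /b -big_split /= mulr_sumr [leLHS]big_seq [leRHS]big_seq /=.
  apply: ler_sum => p pp; rewrite -mulrDr mulrCA ler_wpM2l//.
  exact: hit_parent.
have -> : (2 ^ N = 2 ^ j * 2 ^ (N - j))%N by rewrite -expnD subnKC.
rewrite (big_block a qj) ?expn_gt0//.
have -> : (2 ^ j * 2 ^ (N - j) = 2 ^ (j - e) * 2 ^ (N - (j - e)))%N.
  by rewrite subn_subn// -!expnD (addnC (N - j)%N e) addnA subnK.
rewrite (big_block b qj') ?expn_gt0//.
set n1 := (2 ^ (N - j))%N; set n2 := (2 ^ (N - (j - e)))%N.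
have n12 : n2%:R = 2 ^+ e * n1%:R :> R.
  by rewrite /n1 /n2 -natrX -natrM -expnD subn_subn// addnC.
have n10 : 0 < n1%:R :> R by rewrite ltr0n expn_gt0.
have n1p : (0 < n1)%N by rewrite expn_gt0.
have n2p : (0 < n2)%N by rewrite expn_gt0.
rewrite -(ler_pM2l n10).
apply: (@le_trans _ _ (\sum_(i < n1) \sum_(i' < n2) 2 ^+ e * a (q.1 * n1 + i)%N)).
  under [leRHS]eq_bigr do rewrite big_const_ord iter_addr_0 -[_ *+ n2]mulr_natl n12.
  by rewrite -!mulr_sumr le_eqVlt; apply/orP; left; apply/eqP; ring.
apply: (@le_trans _ _ (\sum_(i < n1) \sum_(i' < n2) b (q.1 %/ 2 ^ e * n2 + i')%N)).
  apply: ler_sum => i _; apply: ler_sum => i' _; apply: ab.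
    by rewrite divnMDl// divn_small ?addn0 ?ltn_ord.
  by rewrite divnMDl// (divn_small (ltn_ord i')) addn0.
by rewrite big_const_ord iter_addr_0 mulr_natl; apply: lexx.
Qed.

End Low.

(** * The incidence bound *)

Section Bound.
Variables (R : realType) (P : eqType) (pts : seq P) (x : P -> R * R) (m : P -> R).
Variables (L N : nat).
Implicit Types (q : nat * int) (s : seq (nat * int)) (j e : nat).

Hypothesis L34 : (34 <= L)%N.
Hypothesis m0 : forall p, 0 <= m p.
Hypothesis xb : forall p, p \in pts -> `|(x p).1| <= 2 /\ `|(x p).2| <= 2.

(** The other squares are not hit, all points being near the origin. *)
Definition low_offset j q :=
  (- (L + 5)%:Z * (2 ^ j)%N%:Z <= q.2) && (q.2 < (L + 5)%:Z * (2 ^ j)%N%:Z).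

Lemma hit_low_offset j (i : nat) q p : p \in pts ->
  hit x N j (L%:R / 2 ^+ j) i q p <= 2 ^- j * (low_offset j q)%:R.
Proof.
move=> pp; have j0 : 0 < 2 ^+ j :> R by rewrite exprn_gt0.
have j1 : 1 <= 2 ^+ j :> R by rewrite exprn_ege1// ler1n.
set H := L%:R / _.
have H0 : 0 <= H by rewrite divr_ge0// ltW.
have HL : H <= L%:R by rewrite ler_pdivrMr// ler_peMr.
set y := proj (x p) (angle R N i).
have yH : y - H <= y + H by lra.
have := overlap_bound (le_lo_hi R j q) yH; rewrite lo_hi => /andP[_ le].
have [ro|nro] := boolP (low_offset j q); first by rewrite mulr1.
rewrite mulr0 leNgt; apply/negP => /overlap_gt0.
move=> /(_ (le_lo_hi R j q) yH)[]; rewrite -/y => h1 h2.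
have [x1 x2] := xb pp.
have := proj_le (angle R N i) x1 x2; rewrite -/y ler_norml => /andP[y1 y2].
have e1 : (L + 5)%N%:Z%:~R = L%:R + 5 :> R by rewrite -[LHS]/((L + 5)%:R) natrD.
have e2 : (2 ^ j)%N%:Z%:~R = 2 ^+ j :> R by rewrite -natrX.
move/negP: nro; apply; apply/andP; split.
  rewrite -ltzD1 -(ltr_int R) rmorphM rmorphN /= e1 e2 -ltr_pdivlMr//.
  by rewrite -/(hi R j q); lra.
rewrite -(ltr_int R) rmorphM /= e1 e2 -ltr_pdivrMr//.
by rewrite -/(lo R j q); lra.
Qed.

Lemma count_low_offset (kap A : R) j s : window_kt kap A j s ->
  (forall q, q \in s -> (q.1 < 2 ^ j)%N) ->
  (count (low_offset j) s)%:R <= (2 * (L + 5))%:R * (kap * A ^+ j).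
Proof.
move=> kt sj.
pose w (d : nat) q := (q.1 %/ 2 ^ j == 0)%N &&
  ((d%:Z - (L + 5)%:Z) * (2 ^ j)%N%:Z <= q.2 < (d%:Z - (L + 5)%:Z) * (2 ^ j)%N%:Z + (2 ^ j)%N%:Z).
have e0 : 0 < (2 ^ j)%N%:Z by rewrite ltz_nat expn_gt0.
apply: (@le_trans _ _ (\sum_(d < 2 * (L + 5)) (count (w d) s)%:R)); last first.
  rewrite mulr_natl -[leRHS]iter_addr_0 -[(2 * (L + 5))%N in leRHS]card_ord -big_const.
  by apply: ler_sum => d _; exact: kt.
rewrite -natr_sum ler_nat.
under eq_bigr do rewrite -sum1_count big_mkcond.
rewrite exchange_big -sum1_count big_mkcond big_seq [leqRHS]big_seq /=.
apply: leq_sum => q /sj qj; case: ifP => // /andP[lq rq].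
pose a := (q.2 %/ (2 ^ j)%N%:Z)%Z.
have a1 : - (L + 5)%:Z <= a by rewrite lez_divRL.
have a2 : a < (L + 5)%:Z by rewrite ltz_divLR.
have dl : (`|(a + (L + 5)%:Z)%R|%N < 2 * (L + 5))%N by lia.
rewrite (bigD1 (Ordinal dl)) //= ifT// /w divn_small// eqxx /=.
have -> : `|(a + (L + 5)%:Z)%R|%N%:Z = a + (L + 5)%:Z by lia.
rewrite addrK lez_floor ?gt_eqF//=.
by rewrite -[X in _ + X]mul1r -mulrDl ltz_ceil.
Qed.

(** Start of the iteration, for scales close to [1]: every tube has at most the
total mass, and the Katz-Tao condition bounds the number of squares that are
hit. *)
Lemma tube_sum_coarse (C A kap : R) j s : 0 <= C -> 0 <= A -> 0 <= kap ->
  \sum_(p <- pts) m p <= C -> window_kt kap A j s ->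
  (forall q, q \in s -> (q.1 < 2 ^ j)%N) -> (j <= N)%N ->
  8 ^+ j * tube_sum pts x m N j (L%:R / 2 ^+ j) s <=
  2 ^+ N * (2 ^+ j * (2 * (L + 5))%:R *
    Num.sqrt (kap * (size s)%:R * C * (\sum_(p <- pts) m p) * A ^+ j)).
Proof.
move=> C0 A0 kap0 MC kt sj jN.
set M := \sum_(p <- pts) m p in MC *.
have M0 : 0 <= M by apply: sumr_ge0.
have j0 : 0 < 2 ^+ j :> R by rewrite exprn_gt0.
have N0 : 0 < 2 ^+ N :> R by rewrite exprn_gt0.
set W := (2 * (L + 5))%:R.
have W1 : 1 <= W by rewrite ler1n; lia.
have T : tube_sum pts x m N j (L%:R / 2 ^+ j) s <=
    (2 ^ (N - j))%:R * (M * 2 ^- j * (count (low_offset j) s)%:R).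
  rewrite /tube_sum (exchange_big_dep xpredT) //= -sum1_count natr_sum.
  rewrite [in leRHS]big_mkcond !mulr_sumr big_seq [leRHS]big_seq.
  apply: ler_sum => q /sj qj.
  have -> : (2 ^ N = 2 ^ j * 2 ^ (N - j))%N by rewrite -expnD subnKC.
  rewrite (@big_block _ _ _ q.1
    (fun i => \sum_(p <- pts) m p * hit x N j (L%:R / 2 ^+ j) i q p))// ?expn_gt0//.
  rewrite [leRHS]mulr_natl -[leRHS]iter_addr_0 -[(2 ^ (N - j))%N in leRHS]card_ord -big_const.
  apply: ler_sum => i _; rewrite /M !mulr_suml big_seq [leRHS]big_seq.
  apply: ler_sum => p pp; rewrite -mulrA ler_wpM2l//.
  apply: le_trans (hit_low_offset _ _ _ pp) _.
  by case: (low_offset j q).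
set c := (count (low_offset j) s)%:R in T.
apply: (@le_trans _ _ (2 ^+ N * (2 ^+ j * (M * c)))).
  apply: le_trans (ler_wpM2l _ T) _; first by rewrite exprn_ge0.
  rewrite natrX.
  have -> : 2 ^+ N = 2 ^+ j * 2 ^+ (N - j) :> R by rewrite -exprD subnKC.
  have -> : 8 ^+ j = 2 ^+ j * 2 ^+ j * 2 ^+ j :> R by rewrite -!exprMn; congr (_ ^+ _); ring.
  by rewrite le_eqVlt; apply/orP; left; apply/eqP; field; rewrite gt_eqF.
rewrite ler_pM2l// -mulrA ler_pM2l//.
rewrite -(ger0_norm (ltW (lt_le_trans ltr01 W1))) -sqrtr_sqr -sqrtrM ?sqr_ge0//.
have c0 : 0 <= c by [].
have cs : c <= (size s)%:R by rewrite ler_nat count_size.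
have cw : c <= W * (kap * A ^+ j) by exact: count_low_offset.
rewrite -(ger0_norm (mulr_ge0 M0 c0)) -sqrtr_sqr ler_wsqrtr//.
have kA : 0 <= kap * A ^+ j by rewrite mulr_ge0// exprn_ge0.
rewrite (_ : W ^+ 2 * _ = (C * M) * (W * W * (kap * A ^+ j) * (size s)%:R)); last by ring.
rewrite exprMn !expr2; apply: ler_pM; rewrite ?mulr_ge0//; first by rewrite ler_wpM2r.
rewrite [leRHS]mulrC; apply: ler_pM => //; apply: le_trans cw _.
by rewrite -mulrA ler_peMl// mulr_ge0//; lra.
Qed.

Lemma frostmanW (C tau : R) i j : (i <= j)%N ->
  frostman pts x m C tau j -> frostman pts x m C tau i.
Proof. by move=> ij [F1 F2]; split=> // k p ki; apply: F2; exact: leq_trans ki ij. Qed.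

(** Each passage to a scale [2 ^ e] times coarser costs one [high_part] and a
factor [2]; hence the loss [3 ^+ (j / e)], which is as small a power of [2 ^ j]
as desired when [e] is large. *)
Theorem tube_sum_bound (C tau A : R) e : (0 < e)%N ->
  0 < tau < 4 -> 0 <= C -> 0 <= A -> 8 <= A * tau ->
  forall j s (kap : R), 0 <= kap -> window_kt kap A j s ->
  (forall q, q \in s -> (q.1 < 2 ^ j)%N) -> (j <= N)%N ->
  frostman pts x m C tau j ->
  400 * taylor_const (2 ^+ e) L%:R * (8 * 2 ^+ j) ^+ 3 <= (2 ^ N)%:R :> R ->
  8 ^+ j * tube_sum pts x m N j (L%:R / 2 ^+ j) s <=
  2 ^+ N * ((2 ^+ e * (2 * (L + 5))%:R +
     Num.sqrt (kernel_const (2 ^+ e) L%:R * (1 + 16 / (4 - tau)))) * 3 ^+ (j %/ e) *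
    Num.sqrt (kap * (size s)%:R * C * (\sum_(p <- pts) m p) * A ^+ j)).
Proof.
move=> e0 t04 C0 A0 At.
set W := (2 * (L + 5))%:R; set C1 := kernel_const _ _ * _.
set M := \sum_(p <- pts) m p.
have N0 : 0 < 2 ^+ N :> R by rewrite exprn_gt0.
have E0 : 0 < 2 ^+ e :> R by rewrite exprn_gt0.
have E1 : 1 <= 2 ^+ e :> R by rewrite exprn_ege1// ler1n.
have W0 : 0 <= W by [].
have D0 : 0 <= 2 ^+ e * W by rewrite mulr_ge0// ltW.
have S0 : 0 <= Num.sqrt C1 by rewrite sqrtr_ge0.
elim/ltn_ind => j IH s kap kap0 kt sj jN F nV.
set Y := Num.sqrt (kap * _ * _ * _ * _).
have Y0 : 0 <= Y by rewrite sqrtr_ge0.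
have [je|ej] := ltnP j e.
  apply: le_trans (tube_sum_coarse C0 A0 kap0 F.1 kt sj jN) _.
  rewrite ler_pM2l// -/W -/M -/Y ler_wpM2r// divn_small// expr0 mulr1.
  apply: (@le_trans _ _ (2 ^+ e * W)); last by rewrite lerDl.
  rewrite ler_wpM2r//; apply: ler_weXn2l; [by rewrite ler1n|exact: ltnW].
have K1 : 1 <= 2 ^+ e :> R by [].
have hp := high_part L34 m0 xb K1 t04 C0 F kap0 kt sj jN At nV.
have HK : L%:R * 2 ^+ e / 2 ^+ j = L%:R / 2 ^+ (j - e) :> R.
  rewrite -[in LHS](subnKC ej) exprD; field.
  by rewrite !gt_eqF// exprn_gt0.
rewrite HK -/C1 -/M in hp.
have lp := low_part L34 m0 xb ej jN sj.
have lt : (j - e < j)%N by rewrite ltn_subrL e0 (leq_trans e0 ej).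
have jle : (j - e <= j)%N by exact: leq_subr.
have kap'0 : 0 <= 2 * kap * A ^+ e by rewrite !mulr_ge0// exprn_ge0.
have jN' : (j - e <= N)%N by exact: leq_trans jle jN.
have nV' : 400 * taylor_const (2 ^+ e) L%:R * (8 * 2 ^+ (j - e)) ^+ 3 <= (2 ^ N)%:R :> R.
  apply: le_trans nV; rewrite (ler_wpM2l (taylor_const_ge0 _ _))//.
  by rewrite lerXn2r ?nnegrE ?mulr_ge0 ?exprn_ge0// ler_pM2l// ler_weXn2l// ler1n.
have ih := IH _ lt (coarsen L e s) _ kap'0 (window_coarsen L A0 ej kt)
  (coarsen_lt ej sj) jN' (frostmanW jle F) nV'.
have EY : Num.sqrt (2 * kap * A ^+ e * (size (coarsen L e s))%:R * C * M * A ^+ (j - e)) = 2 * Y.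
  rewrite -[2 in RHS](@ger0_norm R)// -sqrtr_sqr -sqrtrM ?sqr_ge0//; congr Num.sqrt.
  rewrite size_coarsen natrM -{2}(subnKC ej) exprD; ring.
rewrite EY in ih.
have ED : (j %/ e = ((j - e) %/ e).+1)%N.
  by rewrite -{1}(subnK ej) divnDr ?dvdnn// divnn e0 addn1.
have T3 : 1 <= 3 ^+ ((j - e) %/ e) :> R by rewrite exprn_ege1// ler1n.
have hpY : Num.sqrt (C1 * (kap * (size s)%:R * C * M * A ^+ j)) = Num.sqrt C1 * Y.
  rewrite sqrtrM//; rewrite /C1; case/andP: t04 => t0 t4.
  have L1 : 1 <= L%:R :> R by rewrite ler1n (leq_trans _ L34).
  apply: mulr_ge0; first exact: le_trans ler01 (kernel_const_ge1 K1 L1).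
  by rewrite addr_ge0// divr_ge0// subr_ge0 ltW.
rewrite hpY in hp.
rewrite ED exprS.
set Z := 3 ^+ _ in ih T3 *.
set U := tube_sum _ _ _ _ _ _ _ in hp *.
have -> : 8 ^+ j * U = 8 ^+ j * (U - tube_sum pts x m N j (L%:R / 2 ^+ (j - e)) s / 2 ^+ e) +
   8 ^+ j / 2 ^+ e * tube_sum pts x m N j (L%:R / 2 ^+ (j - e)) s by ring.
apply: le_trans (lerD hp (le_trans lp ih)) _.
rewrite -mulrDr ler_pM2l//.
set B := 2 ^+ e * W + _.
have BS : Num.sqrt C1 <= B by rewrite lerDr.
have : Num.sqrt C1 * Y <= B * Z * Y.
  by rewrite ler_wpM2r// (le_trans BS)// ler_peMr// (le_trans S0).
rewrite (_ : B * (3 * Z) * Y = 3 * (B * Z * Y)); last by ring.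
rewrite (_ : B * Z * (2 * Y) = 2 * (B * Z * Y)); last by ring.
lra.
Qed.

(** The slack [2 * 2 ^- j] allows for the distance between a point of a dyadic
square of side [2 ^- j] and the corner of that square. *)
Definition incident j (y : R * R) q : Prop := exists th u : R,
  [/\ q.1%:R / 2 ^+ j <= th <= (q.1%:R + 1) / 2 ^+ j, lo R j q <= u <= hi R j q &
      `|proj y th - u| <= 2 * 2 ^- j].

(** The distances are at most [2 + 32 + 1] sides, and [35 <= L]. *)
Lemma hit_incident j (i : nat) q p : (35 <= L)%N -> p \in pts -> (j <= N)%N ->
  (i %/ 2 ^ (N - j) = q.1)%N -> incident j (x p) q ->
  hit x N j (L%:R / 2 ^+ j) i q p = 2 ^- j.
Proof.
move=> L35 pp jN iq [th [u [thI uI pu]]].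
pose r : R := 2 ^- j; have r0 : 0 < r by rewrite invr_gt0 exprn_gt0.
have [x1 x2] := xb pp.
have := angle_cell R jN iq; rewrite mulrDl mul1r -/r => aI.
rewrite mulrDl mul1r -/r in thI.
have ang : `|th - angle R N i| <= r by rewrite ler_norml; lra.
have := proj_lip th (angle R N i) x1 x2.
have : 16 * 2 * `|th - angle R N i| <= 32 * r by lra.
move=> h1 h2; have h := le_trans h2 h1.
move: h pu; rewrite -/r !ler_norml => h pu.
have lh := lo_hi R j q; rewrite -/r in lh.
have L35' : 35 <= L%:R :> R by rewrite (ler_nat _ 35).
have Lr : 35 * r <= L%:R * r by rewrite ler_pM2r.
by rewrite /hit overlap_sub ?le_lo_hi ?lo_hi// -/r; lra.
Qed.

End Bound.

(** The loss [3 ^+ (j / e)] of [tube_sum_bound] is below [gam ^+ j] as soon as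
[3 <= gam ^+ e], and the number of sampled angles may be taken as large as the
error in [by_parts_sum] requires. *)
Theorem incidence_bound (R : realType) (tau A gam : R) :
  0 < tau < 4 -> 0 <= A -> 8 <= A * tau -> 1 < gam ->
  exists D : R, 0 < D /\
  forall (P : eqType) (pts : seq P) (x : P -> R * R) (m : P -> R) (C : R)
    (j : nat) (s : seq (nat * int)) (kap : R),
  (forall p, 0 <= m p) ->
  (forall p, p \in pts -> `|(x p).1| <= 2 /\ `|(x p).2| <= 2) ->
  0 <= C -> frostman pts x m C tau j ->
  0 <= kap -> window_kt kap A j s -> (forall q, q \in s -> (q.1 < 2 ^ j)%N) ->
  2 ^+ j * \sum_(q <- s) \sum_(p <- pts) m p * `[< incident j (x p) q >]%:R <=
  D * gam ^+ j *
    Num.sqrt (kap * (size s)%:R * C * (\sum_(p <- pts) m p) * A ^+ j).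
Proof.
move=> t04 A0 At g1.
pose L := 35%N.
have [e e0 He] : exists2 e : nat, (0 < e)%N & 3 <= gam ^+ e.
  pose g := gam - 1; have g0 : 0 < g by rewrite /g; lra.
  have gE : gam = 1 + g by rewrite /g; ring.
  have B n : 1 + n%:R * g <= gam ^+ n.
    elim: n => [|n IH]; first by rewrite mul0r addr0 expr0.
    rewrite exprS -natr1 gE.
    apply: le_trans (_ : (1 + g) * (1 + n%:R * g) <= _); last first.
      by rewrite -gE ler_wpM2l//; lra.
    have : 0 <= n%:R * g * g by rewrite !mulr_ge0// ltW.
    lra.
  pose n := Num.bound (2 / g).
  have hn : 2 / g < n%:R.
    by apply: archi_boundP; rewrite divr_ge0// ltW.
  exists n.+1 => //; apply: le_trans (B n.+1).
  rewrite ltr_pdivrMr// in hn; rewrite -natr1; lra.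
exists (2 ^+ e * (2 * (L + 5))%:R +
     Num.sqrt (kernel_const (2 ^+ e) L%:R * (1 + 16 / (4 - tau)))).
split.
  by rewrite ltr_pwDl ?sqrtr_ge0// mulr_gt0// exprn_gt0.
move=> P pts x m C j s kap m0 xb C0 F kap0 kt sj.
set V := 400 * taylor_const (2 ^+ e) L%:R * (8 * 2 ^+ j) ^+ 3 : R.
pose N := maxn j (Num.bound V).
have jN : (j <= N)%N by exact: leq_maxl.
have nV : V <= (2 ^ N)%:R.
  have V0 : 0 <= V.
    apply: mulr_ge0; last by rewrite exprn_ge0// mulr_ge0// exprn_ge0.
    exact: taylor_const_ge0.
  apply: le_trans (ltW (archi_boundP V0)) _; rewrite ler_nat.
  by apply: leq_trans (leq_maxr j _) _; rewrite ltnW// ltn_expl.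
have := @tube_sum_bound R P pts x m L N isT m0 xb C tau A e e0 t04 C0 A0 At
  j s kap kap0 kt sj jN F nV.
set D := 2 ^+ e * _ + _; set Y := Num.sqrt (kap * _ * _ * _ * _) => H.
have N0 : 0 < 2 ^+ N :> R by rewrite exprn_gt0.
have j0 : 0 < 2 ^+ j :> R by rewrite exprn_gt0.
rewrite -(ler_pM2l N0).
apply: (@le_trans _ _ (8 ^+ j * tube_sum pts x m N j (L%:R / 2 ^+ j) s)); last first.
  apply: le_trans H _; rewrite ler_pM2l// ler_wpM2r ?sqrtr_ge0// ler_wpM2l//.
    by rewrite addr_ge0 ?sqrtr_ge0// mulr_ge0// exprn_ge0.
  apply: le_trans (_ : gam ^+ e ^+ (j %/ e) <= _).
    by apply: lerXn2r; rewrite ?nnegrE// (le_trans _ He).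
  by rewrite -exprM mulnC; apply: ler_weXn2l; [exact: ltW|exact: leq_trunc_div].
rewrite /tube_sum [X in _ <= _ * X](exchange_big_dep xpredT) //=.
rewrite mulrA [leLHS]mulr_sumr [leRHS]mulr_sumr big_seq [leRHS]big_seq.
apply: ler_sum => q /sj qj.
have -> : (2 ^ N = 2 ^ j * 2 ^ (N - j))%N by rewrite -expnD subnKC.
rewrite (@big_block _ _ _ q.1
    (fun i => \sum_(p <- pts) m p * hit x N j (L%:R / 2 ^+ j) i q p))// ?expn_gt0//.
have E8 : 8 ^+ j = 2 ^+ j * 2 ^+ j * 2 ^+ j :> R by rewrite -!exprMn; congr (_ ^+ _); ring.
have EN : 2 ^+ N = 2 ^+ j * 2 ^+ (N - j) :> R by rewrite -exprD subnKC.
rewrite EN E8.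
set I := \sum_(p <- pts) _.
have -> : 2 ^+ j * 2 ^+ (N - j) * 2 ^+ j * I =
  2 ^+ j * 2 ^+ j * 2 ^+ j * \sum_(i < 2 ^ (N - j)) (2 ^- j * I).
  rewrite big_const_ord iter_addr_0 -[_ *+ (2 ^ _)%N]mulr_natl natrX.
  by field; rewrite gt_eqF.
rewrite ler_wpM2l ?mulr_ge0 ?(ltW j0)//; apply: ler_sum => i _.
rewrite /I mulr_sumr big_seq [leRHS]big_seq; apply: ler_sum => p pp.
rewrite mulrCA ler_wpM2l//.
case: asboolP => [inc|_]; last first.
  rewrite mulr0; apply: (andP (overlap_bound (le_lo_hi _ _ _) _)).1.
  have : 0 <= L%:R / 2 ^+ j :> R by rewrite divr_ge0// ltW.
  lra.
rewrite mulr1 (hit_incident xb _ pp jN _ inc)//.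
by rewrite divnMDl ?expn_gt0// divn_small ?addn0.
Qed.

(** * Maximal Katz-Tao families and saturated nodes *)

Section Selection.
Variable R : realType.
Implicit Types (q r v : nat * int) (S X : seq (nat * int)) (e f n : nat).

(** The node of height [e] above the leaf [q]: dyadic squares form a forest
whose leaves are the squares of the smallest side. *)
Definition anc e q : nat * int := ((q.1 %/ 2 ^ e)%N, (q.2 %/ (2 ^ e)%N%:Z)%Z).

Lemma ancD e f q : anc f (anc e q) = anc (e + f) q.
Proof.
rewrite /anc /= -divnMA -expnD; congr pair.
by rewrite expnD PoszM divzMA_ge0.
Qed.

Lemma anc_coarser e e' q r : (e <= e')%N -> anc e q = anc e r -> anc e' q = anc e' r.
Proof. by move=> ee; rewrite -(subnKC ee) -!ancD => ->. Qed.

Definition below e v X := count (fun r => anc e r == v) X.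

(** No further leaf fits below the node of height [e] above [q], whose capacity
is [A ^+ e]. *)
Definition saturated (A : R) X e q := A ^+ e < (below e (anc e q) X).+1%:R.

Lemma saturatedS (A : R) X X' e q : subseq X X' -> saturated A X e q -> saturated A X' e q.
Proof.
move=> XX; rewrite /saturated => /lt_le_trans; apply.
by rewrite ler_nat ltnS; apply: leq_count_subseq.
Qed.

(** Greedy choice of a maximal Katz-Tao family: a leaf is refused only when one
of the nodes above it is saturated. *)
Lemma greedy_selection (A : R) n S : 1 <= A -> exists X,
  [/\ subseq X S,
      forall e v, (e <= n)%N -> (below e v X)%:R <= A ^+ e &
      forall q, q \in S -> exists2 e, (e <= n)%N & saturated A X e q].
Proof.
move=> A1; elim: S => [|q S [X [XS kt sat]]].
  by exists [::]; split=> // e v _; rewrite exprn_ge0//; lra.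
have [[e [en se]]|free] := pselect (exists e, (e <= n)%N /\ saturated A X e q).
  exists X; split=> //; first by rewrite (subseq_trans XS)// subseq_cons.
  by move=> r; rewrite inE => /orP[/eqP ->|/sat//]; exists e.
exists (q :: X); split; first by rewrite /= eqxx.
  move=> e v en; rewrite /below /=; case: eqP => [<-|_]; last exact: kt.
  by rewrite add1n leNgt; apply/negP => h; apply: free; exists e.
move=> r; rewrite inE => /orP[/eqP ->|/sat[e en /(saturatedS (subseq_cons X q)) h]].
  by exists 0%N => //; rewrite /saturated expr0 /below /= eqxx ltr1n.
by exists e.
Qed.

Variables (A : R) (n : nat) (S X : seq (nat * int)).
Hypothesis A1 : 1 <= A.
Hypothesis kt : forall e v, (e <= n)%N -> (below e v X)%:R <= A ^+ e.
Hypothesis sat : forall q, q \in S -> exists2 e, (e <= n)%N & saturated A X e q.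

Definition height q : nat := (\max_(e < n.+1 | saturated A X e q) e)%N.

(** The maximal saturated nodes of height [e]. *)
Definition tops e := undup [seq anc e q | q <- S & height q == e].

Lemma height_le q : (height q <= n)%N.
Proof. by apply/bigmax_leqP => e _; rewrite -ltnS. Qed.

Lemma height_max e q : (e <= n)%N -> saturated A X e q -> (e <= height q)%N.
Proof.
move=> en se; have en' : (e < n.+1)%N by rewrite ltnS.
apply: (@leq_bigmax_cond _ (fun i : 'I_n.+1 => saturated A X i q)
  (fun i : 'I_n.+1 => i : nat) (Ordinal en')).
exact: se.
Qed.

Lemma height_sat q : q \in S -> saturated A X (height q) q.
Proof.
move=> /sat[e en' se]; have en : (e < n.+1)%N by rewrite ltnS.
have [|i si E] := @eq_bigmax_cond _ [pred i : 'I_n.+1 | saturated A X i q]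
    (fun i : 'I_n.+1 => i : nat).
  by apply/card_gt0P; exists (Ordinal en).
have -> : height q = i by rewrite /height -E.
exact: si.
Qed.

Lemma tops_cover q : q \in S -> anc (height q) q \in tops (height q).
Proof.
by move=> qS; rewrite mem_undup; apply/mapP; exists q => //; rewrite mem_filter eqxx.
Qed.

(** A saturated node is half full, its capacity being at least [1]. *)
Lemma saturated_below e q : saturated A X e q -> A ^+ e <= 2 * (below e (anc e q) X)%:R.
Proof.
rewrite /saturated => h.
have c0 : (0 < below e (anc e q) X)%N.
  rewrite lt0n; apply/eqP => c0; move: h; rewrite c0; apply/negP; rewrite -leNgt.
  by rewrite exprn_ege1.
move: h; rewrite -natr1; have : 1 <= (below e (anc e q) X)%:R :> R by rewrite ler1n.
lra.
Qed.

Lemma tops_below e v : v \in tops e -> A ^+ e <= 2 * (below e v X)%:R.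
Proof.
rewrite mem_undup => /mapP[q]; rewrite mem_filter => /andP[/eqP qe qS ->].
by apply: saturated_below; rewrite -{1}qe; exact: height_sat.
Qed.

(** Saturation of a node does not depend on the leaf below it from which it is
seen, so two nested maximal saturated nodes are equal. *)
Lemma tops_disjoint e e' r : anc e r \in tops e -> anc e' r \in tops e' -> e = e'.
Proof.
wlog ee : e e' / (e <= e')%N.
  by move=> W; have [/W//|/ltnW/W H a b] := leqP e e'; rewrite H.
rewrite !mem_undup => /mapP[q]; rewrite mem_filter => /andP[/eqP qe qS rq].
move=> /mapP[q']; rewrite mem_filter => /andP[/eqP qe' qS' rq'].
apply/eqP; rewrite eqn_leq ee -{1}qe; apply: height_max.
  by rewrite -qe' height_le.
have := height_sat qS'; rewrite qe' /saturated -rq'.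
by rewrite (anc_coarser ee rq).
Qed.

Lemma sum_below (B : seq (nat * int)) e Y : uniq B ->
  (\sum_(v <- B) below e v Y = count (fun r => anc e r \in B) Y)%N.
Proof.
move=> uB; rewrite /below; under eq_bigr do rewrite -sum1_count big_mkcond.
rewrite exchange_big -sum1_count [RHS]big_mkcond; apply: eq_bigr => r _ /=.
rewrite -big_mkcond sum1_count.
rewrite (eq_count (a2 := pred1 (anc e r))) => [|v /=]; last by rewrite eq_sym.
by rewrite count_uniq_mem//; case: (_ \in B).
Qed.

(** The nodes below [V] are disjoint and half full, while [V] holds no more
leaves than its capacity. *)
Lemma tops_kt e f V : (e + f <= n)%N ->
  (count (fun v => anc f v == V) (tops e))%:R <= 2 * A ^+ f.
Proof.
move=> en.
have Ae : 0 < A ^+ e by rewrite exprn_gt0//; have := A1; lra.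
rewrite -(ler_pM2l Ae) mulrCA -exprD.
apply: (@le_trans _ _ (2 * (below (e + f) V X)%:R)); last by rewrite ler_pM2l// kt.
apply: (@le_trans _ _ (\sum_(v <- tops e | anc f v == V) 2 * (below e v X)%:R)).
  rewrite -sum1_count natr_sum mulr_sumr big_seq_cond [leRHS]big_seq_cond.
  by apply: ler_sum => v /andP[vt _]; rewrite mulr1 tops_below.
rewrite -mulr_sumr ler_pM2l// -natr_sum ler_nat -big_filter sum_below; last first.
  by rewrite filter_uniq// undup_uniq.
apply: sub_count => r; rewrite mem_filter => /andP[/eqP <- _].
by rewrite ancD.
Qed.

(** The maximal saturated nodes are disjoint and each of them is half full. *)
Lemma tops_total : \sum_(e < n.+1) (size (tops e))%:R * A ^+ e <= 2 * (size X)%:R.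
Proof.
apply: (@le_trans _ _ (\sum_(e < n.+1) 2 * (count (fun r => anc e r \in tops e) X)%:R)).
  apply: ler_sum => e _; rewrite -sum_below ?undup_uniq// natr_sum mulr_sumr.
  rewrite mulr_natl -[leLHS]iter_addr_0 -(count_predT (tops e)) -big_const_seq.
  by rewrite big_seq [leRHS]big_seq; apply: ler_sum => v vt; exact: tops_below.
rewrite -mulr_sumr ler_pM2l// -natr_sum ler_nat -sum1_size.
under eq_bigr do rewrite -sum1_count big_mkcond.
rewrite exchange_big; apply: leq_sum => r _ /=.
have [[e he]|no] := pselect (exists e : 'I_n.+1, anc e r \in tops e); last first.
  rewrite big1// => e _; case: ifP => // h; exfalso; apply: no; by exists e.
rewrite (bigD1 e)//= he big1 ?addn0// => e' /eqP ne; case: ifP => // h.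
by exfalso; apply: ne; apply/val_inj/esym; exact: tops_disjoint he h.
Qed.

(** A window is covered by two dyadic squares, hence [4 = 2 * 2]. *)
Lemma tops_window e (A' : R) : (e <= n)%N -> A <= A' ->
  window_kt 4 A' (n - e) (tops e).
Proof.
move=> en AA f k c fn.
have ef : (e + f <= n)%N by rewrite -(subnKC en) leq_add2l.
pose d := (c %/ (2 ^ f)%N%:Z)%Z.
have f0 : 0 < (2 ^ f)%N%:Z by rewrite ltz_nat expn_gt0.
apply: (@le_trans _ _ (count (fun v => anc f v == (k, d)) (tops e) +
    count (fun v => anc f v == (k, d + 1)) (tops e))%:R).
  rewrite ler_nat -count_predUI; apply: leq_trans (leq_addr _ _).
  apply: sub_count => v /= /andP[/eqP vk /andP[cv vc]].
  rewrite !xpair_eqE vk eqxx /=.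
  have h1 : d <= (v.2 %/ (2 ^ f)%N%:Z)%Z.
    by rewrite lez_divRL// (le_trans _ cv)// lez_floor// gt_eqF.
  have h2 : (v.2 %/ (2 ^ f)%N%:Z)%Z < d + 2.
    rewrite ltz_divLR// (lt_le_trans vc)//.
    have := ltz_ceil c f0; rewrite -/d; lia.
  lia.
have A0 : 0 <= A by have := A1; lra.
have Af : A ^+ f <= A' ^+ f by apply: lerXn2r; rewrite ?nnegrE// (le_trans A0).
have := tops_kt (k, d) ef; have := tops_kt (k, d + 1) ef.
rewrite natrD; lra.
Qed.

End Selection.

(** * The theorem for point masses *)

Section Discrete.
Variable R : realType.

Lemma incident_anc n e (y : R * R) q : (e <= n)%N ->
  incident n y q -> incident (n - e) y (anc e q).
Proof.
move=> en [th [u [/andP[t1 t2] /andP[u1 u2] pu]]]; exists th, u.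
have n0 : 0 < 2 ^+ n :> R by rewrite exprn_gt0.
have f0 : 0 < 2 ^+ (n - e) :> R by rewrite exprn_gt0.
have e0 : 0 < 2 ^+ e :> R by rewrite exprn_gt0.
have e1 : 1 <= 2 ^+ e :> R by rewrite exprn_ege1// ler1n.
have E : 2 ^+ n = 2 ^+ e * 2 ^+ (n - e) :> R by rewrite -exprD subnKC.
have e0z : 0 < (2 ^ e)%N%:Z by rewrite ltz_nat expn_gt0.
have eR : (2 ^ e)%N%:Z%:~R = 2 ^+ e :> R by rewrite -natrX.
have eN : (2 ^ e)%N%:R = 2 ^+ e :> R by rewrite natrX.
split; last first.
- apply: le_trans pu _; rewrite ler_pM2l// lef_pV2 ?posrE// E ler_peMl// ltW//.
- apply/andP; split.
    apply: le_trans u1; rewrite /lo /= E invfM mulrA ler_pM2r ?invr_gt0// ler_pdivlMr//.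
    by rewrite -eR -rmorphM ler_int lez_floor// gt_eqF.
  apply: le_trans u2 _; rewrite /hi /= E invfM mulrA ler_pM2r ?invr_gt0// ler_pdivrMr//.
  by rewrite -eR -rmorphM ler_int lezD1 ltz_ceil.
apply/andP; split.
  apply: le_trans t1; rewrite /= E invfM mulrA ler_pM2r ?invr_gt0// ler_pdivlMr//.
  by rewrite -eN -natrM ler_nat leq_trunc_div.
apply: le_trans t2 _; rewrite /= E invfM mulrA ler_pM2r ?invr_gt0// ler_pdivrMr//.
by rewrite -eN !natr1 -natrM ler_nat ltn_ceil// expn_gt0.
Qed.

Lemma geometric_le (a : R) n : 0 <= a < 1 -> (1 - a) * \sum_(e < n) a ^+ e <= 1.
Proof.
move=> /andP[a0 a1]; have := subrX1 a n => H.
have : 0 <= a ^+ n by rewrite exprn_ge0.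
lra.
Qed.

Lemma frostman_filter (P : eqType) (pts : seq P) x (m : P -> R) C tau j (g : pred P) :
  (forall p, 0 <= m p) -> frostman pts x m C tau j ->
  frostman [seq p <- pts | g p] x m C tau j.
Proof.
move=> m0 [F1 F2].
have H (Q : pred P) : \sum_(p <- [seq p <- pts | g p] | Q p) m p <= \sum_(p <- pts | Q p) m p.
  rewrite big_filter_cond big_mkcond [leRHS]big_mkcond; apply: ler_sum => p _.
  by case: (g p) => //=; case: ifP.
split; first by apply: le_trans F1; exact: H.
move=> i p ij; rewrite mem_filter => /andP[_ pp].
by apply: le_trans (F2 i p ij pp); exact: H.
Qed.

(** Each point is incident to many maximal saturated nodes of some height [e]
(geometric pigeonholing, with ratio [1 / gam]); [incidence_bound] at that scale,
squared, then bounds the number of these nodes from below. The hypothesis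
[gam ^+ 4 * A' ^+ 2 <= 4 * vs ^+ 2] makes the losses of both steps fit into the
gap between [log2 vs + 1] and [log2 A']. The Katz-Tao family has the exponent
[log2 A], but the incidence bound may need the larger exponent [log2 A']. *)
Theorem discrete_furstenberg (A A' tau vs gam : R) :
  0 < tau < 4 -> 1 <= A -> A <= A' -> 8 <= A' * tau -> 0 < vs -> 1 < gam ->
  gam ^+ 4 * A' ^+ 2 <= 4 * vs ^+ 2 ->
  exists c : R, 0 < c /\
  forall (P : eqType) (pts : seq P) (x : P -> R * R) (m : P -> R) (C : R) (n : nat)
    (S : seq (nat * int)) (Lam : P -> seq (nat * int)),
  (forall p, 0 <= m p) ->
  (forall p, p \in pts -> `|(x p).1| <= 2 /\ `|(x p).2| <= 2) ->
  1 <= C -> frostman pts x m C tau n ->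
  (forall q, q \in S -> (q.1 < 2 ^ n)%N) ->
  (forall p q, p \in pts -> q \in Lam p -> q \in S /\ incident n (x p) q) ->
  (forall p (B : nat -> seq (nat * int)), p \in pts ->
     (forall q, q \in Lam p -> exists2 e, (e <= n)%N & anc e q \in B e) ->
     1 <= C * \sum_(e < n.+1)
       (count (fun v => has (fun q => anc e q == v) (Lam p)) (B e))%:R * vs ^- (n - e)) ->
  exists X, [/\ subseq X S, forall e v, (e <= n)%N -> (below e v X)%:R <= A ^+ e &
    c / C ^+ 3 * (\sum_(p <- pts) m p) * A ^+ n <= (size X)%:R].
Proof.
move=> t04 A1 AA At vs0 g1 gA.
have A'0 : 0 <= A' by lra.
have A0 : 0 < A by lra.
have g0 : 0 < gam by lra.
have [D [D0 inc]] := incidence_bound t04 A'0 At g1.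
pose al := gam^-1.
have al0 : 0 < al by rewrite invr_gt0.
have al1 : al < 1 by rewrite invf_lt1.
exists ((1 - al) ^+ 2 / (8 * D ^+ 2)); split.
  by rewrite divr_gt0 ?mulr_gt0 ?exprn_gt0// subr_gt0.
move=> P pts x m C n S Lam m0 xb C1 F Sn LamS cov.
have [X [XS kt sat]] := greedy_selection n S A1.
exists X; split=> //.
have C0 : 0 < C by lra.
pose B e := tops A n S X e.
pose cnt e p := count (fun v => has (fun q => anc e q == v) (Lam p)) (B e).
pose be : R := (1 - al) / C.
have be0 : 0 < be by rewrite divr_gt0// subr_gt0.
pose good e p := be * al ^+ (n - e) <= (cnt e p)%:R * vs ^- (n - e).
pose M e := \sum_(p <- pts | good e p) m p.
(* otherwise the sum in [cov] would be below a geometric series *)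
have good_ex p : p \in pts -> exists e : 'I_n.+1, good e p.
  move=> pp; apply: contrapT => no.
  have := cov p B pp _.
  have h q : q \in Lam p -> exists2 e, (e <= n)%N & anc e q \in B e.
    move=> qL; exists (height A n X q); first exact: height_le.
    by apply: tops_cover; exact: (LamS p q pp qL).1.
  move=> /(_ h); apply/negP; rewrite -ltNge.
  rewrite mulrC -ltr_pdivlMr// mul1r.
  have lt : \sum_(e < n.+1) (cnt e p)%:R * vs ^- (n - e) <
      \sum_(e < n.+1) be * al ^+ (n - e).
    apply: ltr_sum => [|e _]; first by apply/hasP; exists ord0; rewrite ?mem_index_enum.
    by rewrite ltNge; apply/negP => h'; apply: no; exists e.
  apply: lt_le_trans lt _; rewrite -mulr_sumr.
  rewrite (reindex_inj rev_ord_inj) /=.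
  have -> : \sum_(e < n.+1) al ^+ (n - (n.+1 - e.+1)) = \sum_(e < n.+1) al ^+ e.
    by apply: eq_bigr => e _; rewrite subSS subKn// -ltnS.
  have := @geometric_le al n.+1 _; rewrite (ltW al0) al1 => /(_ isT) geo.
  by rewrite /be mulrAC -[leRHS]mul1r ler_pM2r ?invr_gt0.
have Msum : \sum_(p <- pts) m p <= \sum_(e < n.+1) M e.
  rewrite /M; under [leRHS]eq_bigr do rewrite big_mkcond.
  rewrite [leRHS]exchange_big [leLHS]big_seq [leRHS]big_seq; apply: ler_sum => p pp /=.
  have [e ge] := good_ex p pp.
  rewrite (bigD1 e)//= ge lerDl sumr_ge0// => e' _; case: ifP => // _.
(* the incidences of the good points against [inc], after squaring *)
have one (e : 'I_n.+1) : M e * be ^+ 2 * A ^+ n <= 4 * D ^+ 2 * C * ((size (B e))%:R * A ^+ e).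
  have en : (e <= n)%N by rewrite -ltnS.
  set j := (n - e)%N.
  have M0 : 0 <= M e by apply: sumr_ge0.
  have rhs0 : 0 <= 4 * D ^+ 2 * C * ((size (B e))%:R * A ^+ e).
    apply: mulr_ge0; last by rewrite mulr_ge0// exprn_ge0// ltW.
    by rewrite !mulr_ge0 ?sqr_ge0// ltW.
  have [M00|Mn0] := eqVneq (M e) 0; first by rewrite M00 !mul0r.
  have Mp : 0 < M e by rewrite lt_def Mn0.
  have j0 : 0 < 2 ^+ j :> R by rewrite exprn_gt0.
  have Bj q : q \in B e -> (q.1 < 2 ^ j)%N.
    rewrite mem_undup => /mapP[r]; rewrite mem_filter => /andP[_ rS ->] /=.
    by rewrite ltn_divLR ?expn_gt0// -expnD subnK// Sn.
  have xb' p : p \in [seq p <- pts | good e p] -> `|(x p).1| <= 2 /\ `|(x p).2| <= 2.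
    by rewrite mem_filter => /andP[_ /xb].
  have k4 : 0 <= 4 :> R by [].
  have F' : frostman [seq p <- pts | good e p] x m C tau j.
    by apply: frostman_filter => //; apply: frostmanW F; exact: leq_subr.
  have := inc P [seq p <- pts | good e p] x m C j (B e) 4 m0 xb' (ltW C0) F' k4
    (tops_window A1 kt sat en AA) Bj.
  rewrite big_filter -/(M e).
  set Z := 4 * _ * _ * _ * _ => H.
  have Z0 : 0 <= Z.
    by apply: mulr_ge0; [rewrite !mulr_ge0// ltW|rewrite exprn_ge0].
  have T : M e * (be * al ^+ j * vs ^+ j) <= \sum_(q <- B e)
      \sum_(p <- [seq p <- pts | good e p]) m p * `[< incident j (x p) q >]%:R.
    rewrite exchange_big /M /= -big_filter [leLHS]mulr_suml [leLHS]big_seq [leRHS]big_seq.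
    apply: ler_sum => p; rewrite mem_filter => /andP[gp pp].
    rewrite -mulr_sumr ler_wpM2l//.
    apply: le_trans (_ : (cnt e p)%:R <= _).
      by move: gp; rewrite /good -/j ler_pdivlMr// exprn_gt0.
    rewrite /cnt -sum1_count natr_sum big_mkcond; apply: ler_sum => v _.
    case: ifP => [/hasP[q qL /eqP <-]|_]; last by [].
    case: asboolP => // no; exfalso; apply: no.
    by apply: incident_anc => //; exact: (LamS p q pp qL).2.
  have {T}H : M e * (be * al ^+ j * vs ^+ j) * 2 ^+ j <= D * gam ^+ j * Num.sqrt Z.
    by apply: le_trans H; rewrite mulrC ler_pM2l.
  have L0 : 0 <= M e * (be * al ^+ j * vs ^+ j) * 2 ^+ j.
    exact: (mulr_ge0 (mulr_ge0 M0 (mulr_ge0 (mulr_ge0 (ltW be0)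
      (exprn_ge0 j (ltW al0))) (exprn_ge0 j (ltW vs0)))) (ltW j0)).
  have R0 : 0 <= D * gam ^+ j * Num.sqrt Z.
    by rewrite !mulr_ge0 ?sqrtr_ge0 ?exprn_ge0// ltW.
  have {}H : (M e * (be * al ^+ j * vs ^+ j) * 2 ^+ j) ^+ 2 <=
      (D * gam ^+ j * Num.sqrt Z) ^+ 2 by apply: lerXn2r; rewrite ?nnegrE.
  rewrite [leRHS]exprMn sqr_sqrtr// in H.
  have gj : 0 < gam ^+ j by rewrite exprn_gt0.
  have Aj : 0 < A' ^+ j by rewrite exprn_gt0//; lra.
  have alE : al ^+ j = (gam ^+ j)^-1 by rewrite /al exprVn.
  have E1 : (M e * (be * al ^+ j * vs ^+ j) * 2 ^+ j) ^+ 2 * gam ^+ j ^+ 2 =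
     M e * (M e * be ^+ 2 * (4 * vs ^+ 2) ^+ j).
    have -> : (4 * vs ^+ 2) ^+ j = (2 ^+ j * vs ^+ j) ^+ 2.
      by rewrite -exprMn exprAC; congr (_ ^+ _); ring.
    by rewrite alE; field; rewrite gt_eqF.
  have {}H : M e * (M e * be ^+ 2 * (4 * vs ^+ 2) ^+ j) <=
      M e * (4 * D ^+ 2 * C * (size (B e))%:R * (gam ^+ j ^+ 4 * A' ^+ j)).
    rewrite -E1.
    apply: le_trans (ler_wpM2r (ltW (exprn_gt0 2 gj)) H) _.
    by rewrite /Z le_eqVlt; apply/orP; left; apply/eqP; ring.
  rewrite ler_pM2l// in H.
  have {}H : M e * be ^+ 2 * A' ^+ j <= 4 * D ^+ 2 * C * (size (B e))%:R.
    have W : 0 < gam ^+ j ^+ 4 * A' ^+ j by rewrite mulr_gt0// exprn_gt0.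
    rewrite -(ler_pM2r W); apply: le_trans H; rewrite -[leLHS]mulrA ler_wpM2l//.
      by rewrite mulr_ge0// sqr_ge0.
    have -> : A' ^+ j * (gam ^+ j ^+ 4 * A' ^+ j) = (gam ^+ 4 * A' ^+ 2) ^+ j.
      by rewrite exprMn -!exprM (mulnC 4) (mulnC 2) !exprM; ring.
    by apply: lerXn2r; rewrite ?nnegrE// mulr_ge0 ?exprn_ge0// ltW.
  have -> : A ^+ n = A ^+ j * A ^+ e by rewrite -exprD subnK.
  have AE : 0 < A ^+ e by rewrite exprn_gt0.
  rewrite [leLHS]mulrA [leRHS]mulrA (ler_pM2r AE); apply: le_trans H.
  rewrite ler_wpM2l//; first by rewrite mulr_ge0// sqr_ge0.
  by apply: lerXn2r; rewrite ?nnegrE// ltW.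
have tot := tops_total A1 sat.
have AN : 0 < A ^+ n by rewrite exprn_gt0.
have : (\sum_(p <- pts) m p) * (be ^+ 2 * A ^+ n) <= 4 * D ^+ 2 * C * (2 * (size X)%:R).
  apply: le_trans (_ : (\sum_(e < n.+1) M e) * (be ^+ 2 * A ^+ n) <= _).
    by rewrite ler_wpM2r// mulr_ge0 ?sqr_ge0 ?ltW.
  rewrite mulr_suml; apply: le_trans (_ : 4 * D ^+ 2 * C *
     \sum_(e < n.+1) (size (B e))%:R * A ^+ e <= _).
    by rewrite mulr_sumr; apply: ler_sum => e _; rewrite mulrA; exact: one.
  by rewrite ler_wpM2l// mulr_ge0 ?mulr_ge0 ?sqr_ge0 ?ltW.
set Mt := \sum_(p <- pts) m p => fin.
have W : 0 < 8 * D ^+ 2 * C by rewrite !mulr_gt0 ?exprn_gt0.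
rewrite -(ler_pM2l W); apply: le_trans (_ : 4 * D ^+ 2 * C * (2 * (size X)%:R) <= _); last first.
  by rewrite le_eqVlt; apply/orP; left; apply/eqP; ring.
apply: le_trans fin; rewrite /be le_eqVlt; apply/orP; left; apply/eqP.
by field; rewrite !gt_eqF.
Qed.

End Discrete.

(** * Dyadic squares and covering numbers *)

Section Geometry.
Variable R : realType.
Implicit Types (x y z : R * R) (r d : R) (q : nat * int) (n : nat).

Lemma edist_leE x y r : 0 <= r ->
  (Defs.edist x y <= r) = ((x.1 - y.1) ^+ 2 + (x.2 - y.2) ^+ 2 <= r ^+ 2).
Proof.
move=> r0; rewrite /Defs.edist -{1}(ger0_norm r0) -sqrtr_sqr ler_sqrt ?sqr_ge0//.
Qed.

Lemma edist_coord x y r : Defs.edist x y <= r -> `|x.1 - y.1| <= r /\ `|x.2 - y.2| <= r.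
Proof.
move=> h; have r0 : 0 <= r by apply: le_trans h; rewrite sqrtr_ge0.
move: h; rewrite edist_leE// => h.
by split; rewrite -(ger0_norm r0) -!sqrtr_sqr ler_sqrt ?sqr_ge0//; apply: le_trans h;
  rewrite ?lerDl ?lerDr sqr_ge0.
Qed.

Lemma edist_le2 x y r : `|x.1 - y.1| <= r -> `|x.2 - y.2| <= r -> Defs.edist x y <= 2 * r.
Proof.
move=> h1 h2; have r0 : 0 <= r by apply: le_trans h1.
rewrite edist_leE ?mulr_ge0//.
have H (a : R) : `|a| <= r -> a ^+ 2 <= r ^+ 2.
  by move=> ar; rewrite -(real_normK (num_real a)); apply: lerXn2r; rewrite ?nnegrE.
have := H _ h1; have := H _ h2; have := sqr_ge0 r.
by rewrite exprMn; lra.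
Qed.

Definition leaf n q : set (R * R) := dyadic_square (2 ^- n) q.1%:Z q.2.

Definition corner n q : R * R := (q.1%:R / 2 ^+ n, q.2%:~R / 2 ^+ n).

Lemma leafE n q z : leaf n q z <->
  (q.1%:R / 2 ^+ n <= z.1 < (q.1%:R + 1) / 2 ^+ n /\
   q.2%:~R / 2 ^+ n <= z.2 < (q.2%:~R + 1) / 2 ^+ n).
Proof. by rewrite /leaf /dyadic_square /= !rmorphD. Qed.

Lemma corner_leaf n q : leaf n q (corner n q).
Proof.
have n0 : 0 < 2 ^- n :> R by rewrite invr_gt0 exprn_gt0.
by apply/leafE; rewrite /corner /= !lexx /= !mulrDl !ltrDl mul1r.
Qed.

Lemma leaf_near n q z w : leaf n q z -> leaf n q w ->
  `|z.1 - w.1| <= 2 ^- n /\ `|z.2 - w.2| <= 2 ^- n.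
Proof.
move=> /leafE[z1 z2] /leafE[w1 w2]; rewrite !mulrDl !mul1r in z1 z2 w1 w2.
by split; rewrite ler_norml; lra.
Qed.

(** A square lies in the parameter space exactly when its corner does, because
[2 ^- n] divides [1]. *)
Lemma param_squareP n (Q : set (R * R)) :
  param_square (2 ^- n) Q <-> exists2 q, (q.1 < 2 ^ n)%N & Q = leaf n q.
Proof.
have n0 : 0 < 2 ^+ n :> R by rewrite exprn_gt0.
have n1 : 0 < 2 ^- n :> R by rewrite invr_gt0.
split=> [[[k [l ->]] sub]|[q qn ->]].
  have : dyadic_square (2 ^- n) k l (k%:~R * 2 ^- n : R, l%:~R * 2 ^- n : R).
    by split; apply/andP; split; rewrite /= ?lexx// ltr_pM2r// ltr_int ltzD1.
  move=> h; have := sub _ h; rewrite /params /= => /andP[k0 k1].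
  move: k0; rewrite pmulr_lge0// ler0z => k0.
  move: k1; rewrite ltr_pdivrMr// mul1r.
  move=> k1; clear h; case: k k0 k1 sub => // k _ k1 sub.
  have kn : (k < 2 ^ n)%N by rewrite -(ltr_nat R) natrX.
  by exists (k, l).
split; first by exists q.1%:Z, q.2.
move=> z /leafE[/andP[h1 h2] _]; rewrite /params /=; apply/andP; split.
  by apply: le_trans h1; rewrite divr_ge0// ltW.
apply: lt_le_trans h2 _; rewrite ler_pdivrMr// mul1r natr1 -natrX ler_nat//.
Qed.

Local Notation cov := (@covering_number R).

Lemma cov_le d (P Q : set (R * R)) : P `<=` Q -> (cov d P <= cov d Q)%E.
Proof.
move=> PQ; apply: ereal_inf_le_tmp => _ [n [x Qx] <-]; exists n => //.
by exists x; exact: subset_trans PQ Qx.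
Qed.

Lemma cov_le1 d (P : set (R * R)) x : P `<=` eball x d -> (cov d P <= 1)%E.
Proof.
move=> Px; apply: ereal_inf_lbound; exists 1%N => //; exists (fun=> x).
by move=> z /Px ?; exists ord0.
Qed.

Lemma cov_ge1 d (P : set (R * R)) : P !=set0 -> (1 <= cov d P)%E.
Proof.
move=> [z Pz]; apply: le_ereal_inf_tmp => _ [n [x Px] <-].
rewrite lee_fin ler1n; case: n x Px => // x /(_ z Pz)[i].
by case: i.
Qed.

Lemma cov_ge0 d P : (0 <= cov d P)%E.
Proof. by apply: le_ereal_inf_tmp => _ [n _ <-]; rewrite lee_fin. Qed.

(** An infimum of natural numbers is attained. *)
Lemma cov_attained d P : cov d P = +oo%E \/
  exists n (c : 'I_n -> R * R), P `<=` \bigcup_i eball (c i) d /\ cov d P = n%:R%:E.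
Proof.
pose B n := `[< exists c : 'I_n -> R * R, P `<=` \bigcup_i eball (c i) d >].
have [[n Bn]|no] := pselect (exists n, B n); last first.
  left; rewrite /covering_number (_ : [set _ | _ in _] = set0) ?ereal_inf0//.
  by apply/seteqP; split=> // y [n [c Pc] _]; apply: no; exists n; apply/asboolP; exists c.
right; have ex : exists n, B n by exists n.
case: (ex_minnP ex) => k /asboolP[c Pc] kmin.
exists k, c; split=> //; apply/eqP; rewrite eq_le; apply/andP; split.
  by apply: ereal_inf_lbound; exists k => //; exists c.
apply: le_ereal_inf_tmp => _ [j [c' Pc'] <-]; rewrite lee_fin ler_nat; apply: kmin.
by apply/asboolP; exists c'.
Qed.

Lemma cov_setU d P Q : (cov d (P `|` Q) <= cov d P + cov d Q)%E.
Proof.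
have [->|[n [c [Pc ->]]]] := cov_attained d P.
  by rewrite addye ?leey// gt_eqF// (lt_le_trans _ (cov_ge0 d Q)).
have [->|[k [b [Qb ->]]]] := cov_attained d Q; first by rewrite addey ?leey.
rewrite -EFinD -natrD; apply: ereal_inf_lbound; exists (n + k)%N => //.
exists (fun i => match fintype.split i with inl a => c a | inr a => b a end) => z [/Pc|/Qb] [i _ zi].
  by exists (lshift k i) => //=; rewrite (fintype.unsplitK (inl i)).
by exists (rshift n i) => //=; rewrite (fintype.unsplitK (inr i)).
Qed.

Lemma cov_sum d (I : eqType) (s : seq I) (E : I -> set (R * R)) P :
  P `<=` [set z | exists2 i, i \in s & E i z] ->
  (cov d P <= \sum_(i <- s) cov d (P `&` E i))%E.
Proof.
elim: s P => [|i s IH] P PE.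
  rewrite big_nil; apply: ereal_inf_lbound; exists 0%N => //.
  by exists (fun=> (0, 0)) => z /PE[].
rewrite big_cons.
pose Q := P `&` [set z | exists2 i, i \in s & E i z].
apply: le_trans (_ : cov d ((P `&` E i) `|` Q) <= _)%E.
  apply: cov_le => z Pz; have [j] := PE z Pz; rewrite inE => /orP[/eqP -> Ez|js Ez].
    by left.
  by right; split=> //; exists j.
apply: le_trans (cov_setU _ _ _) _; apply: leeD => //.
apply: le_trans (IH Q _) _; first by move=> z [].
by apply: lee_sum => j _; apply: cov_le => z [[]].
Qed.

Lemma cov_leaf_le1 n q : (cov (2 ^- n) (leaf n q) <= 1)%E.
Proof.
pose c := ((q.1%:R + 2^-1) / 2 ^+ n, (q.2%:~R + 2^-1) / 2 ^+ n) : R * R.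
apply: (@cov_le1 _ _ c) => z /leafE[h1 h2].
have n1 : 0 < 2 ^- n :> R by rewrite invr_gt0 exprn_gt0.
rewrite /eball /=; apply: le_trans (_ : 2 * (2 ^- n / 2) <= _); last by rewrite mulrCA divff ?mulr1//.
by apply: edist_le2; rewrite /c /=; rewrite !mulrDl in h1 h2 *; rewrite ler_norml; lra.
Qed.

Lemma cov_leaves n (s : seq (nat * int)) P :
  P `<=` [set z | exists2 q, q \in s & leaf n q z] -> (cov (2 ^- n) P <= (size s)%:R%:E)%E.
Proof.
move=> Ps; apply: le_trans (cov_sum _ Ps) _.
apply: le_trans (_ : \sum_(q <- s) 1 <= _)%E.
  apply: lee_sum => q _; apply: le_trans (cov_leaf_le1 n q).
  by apply: cov_le => z [].
rewrite sumEFin lee_fin big_const_seq count_predT iter_addr_0 lexx//.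
Qed.

End Geometry.

(** * Counting in balls, and the content *)

Section BallCount.
Variable R : realType.
Implicit Types (x y z : R * R) (r a : R) (q : nat * int) (n : nat).

Lemma count_nodes (A : R) e (X V : seq (nat * int)) (p : pred (nat * int)) :
  0 <= A -> (forall v, (below e v X)%:R <= A ^+ e) ->
  (forall q, q \in X -> p q -> anc e q \in V) ->
  (count p X)%:R <= (size V)%:R * A ^+ e.
Proof.
move=> A0 kt pV.
apply: (@le_trans _ _ (count (fun q => anc e q \in undup V) X)%:R).
  rewrite ler_nat -!sum1_count big_mkcond [leqRHS]big_mkcond.
  rewrite big_seq [leqRHS]big_seq; apply: leq_sum => q qX.
  by case: ifP => // /(pV q qX); rewrite mem_undup => ->.
rewrite -sum_below ?undup_uniq// natr_sum.
apply: (@le_trans _ _ (\sum_(v <- undup V) A ^+ e)); first by apply: ler_sum.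
rewrite big_const_seq count_predT iter_addr_0 -[leLHS]mulr_natl.
by rewrite ler_wpM2r ?exprn_ge0// ler_nat size_undup.
Qed.

Definition in_box n x r q :=
  (`|x.1 - (corner R n q).1| <= r) && (`|x.2 - (corner R n q).2| <= r).

Lemma powR_exprn (A a : R) e : 1 <= a -> A = 2 `^ a -> (2 ^+ e) `^ a = A ^+ e.
Proof.
move=> a1 ->; have -> : 2 ^+ e = 2 `^ e%:R :> R by rewrite powR_mulrn.
by rewrite powRAC powR_mulrn// powR_ge0.
Qed.

(** An interval of length at most twice the side meets at most three cells. *)
Lemma box_nodes (xi rho r c : R) (w : int) : 0 < rho -> r <= rho ->
  w%:~R * rho <= c < (w%:~R + 1) * rho -> `|xi - c| <= r ->
  exists2 i : nat, (i < 3)%N & w = Num.floor ((xi - r) / rho) + i%:Z.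
Proof.
move=> rho0 rr /andP[wc cw]; rewrite ler_norml => /andP[h1 h2].
set f := Num.floor _.
have f1 : f%:~R * rho <= xi - r by rewrite -ler_pdivlMr// /f floor_le.
have f2 : xi - r < (f%:~R + 1) * rho.
  by rewrite -ltr_pdivrMr// -[1]/(1%:~R) -rmorphD /f floorD1_gt.
have l1 : f%:~R * rho < (w%:~R + 1) * rho by lra.
have l2 : w%:~R * rho < (f%:~R + 3) * rho by lra.
move: l1 l2; rewrite !ltr_pM2r// -[1]/(1%:~R) -[3]/(3%:~R) -!rmorphD !ltr_int => l1 l2.
exists `|(w - f)%R|%N; lia.
Qed.

Lemma divz_window (w : int) (N k : nat) : (0 < N)%N -> (`|w| <= k * N)%N ->
  exists2 i, i \in iota 0 (2 * k.+1) & (w %/ N%:Z)%Z = i%:Z - k.+1%:Z.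
Proof.
move=> N0 wk; have N0z : 0 < N%:Z by [].
have h1 : - k.+1%:Z <= (w %/ N%:Z)%Z by rewrite lez_divRL//; lia.
have h2 : (w %/ N%:Z)%Z < k.+1%:Z by rewrite ltz_divLR//; lia.
by exists `|((w %/ N%:Z)%Z + k.+1%:Z)%R|%N; rewrite ?mem_iota; lia.
Qed.

(** For [r <= 1] take nodes of side between [r] and [2 * r]: at most nine of
them meet the box, and their capacity is at most [4] times the wanted power. For
larger [r] the sixteen unit squares in range do. *)
Lemma ball_count (A a : R) n X x r : 1 <= a <= 2 -> A = 2 `^ a ->
  (forall q, q \in X -> (q.1 < 2 ^ n)%N /\ (`|q.2| <= 7 * 2 ^ n)%N) ->
  (forall e v, (e <= n)%N -> (below e v X)%:R <= A ^+ e) ->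
  2 ^- n <= r -> (count (in_box n x r) X)%:R <= 36 * (r / 2 ^- n) `^ a.
Proof.
move=> /andP[a1 a2] AE Xb kt nr.
have n0 : 0 < 2 ^- n :> R by rewrite invr_gt0 exprn_gt0.
have n00 : 0 < 2 ^+ n :> R by rewrite exprn_gt0.
have r0 : 0 < r by apply: lt_le_trans nr.
have a0 : 0 <= a by lra.
have A0 : 0 <= A by rewrite AE powR_ge0.
have P0 : 0 <= (r / 2 ^- n) `^ a by exact: powR_ge0.
have [r1|r1] := leP r 1; last first.
  apply: (@le_trans _ _ (16%:R * A ^+ n)).
    have := @count_nodes A n X [seq (0%N, i%:Z - 8) | i <- iota 0 16] (in_box n x r) A0
      (fun v => kt n v (leqnn n)).
    rewrite size_map size_iota; apply=> q /Xb[q1 q2] _; rewrite /anc divn_small//.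
    have [i i16 ->] := divz_window (expn_gt0 2 n) q2.
    by apply/mapP; exists i.
  rewrite -(powR_exprn n a1 AE).
  have : (2 ^+ n) `^ a <= (r / 2 ^- n) `^ a.
    by rewrite ge0_ler_powR ?nnegrE ?divr_ge0 ?(ltW r0) ?(ltW n0) ?(ltW n00)// invrK ler_peMl// ltW.
  lra.
have ex : exists e : nat, r <= 2 ^+ e * 2 ^- n.
  by exists n; rewrite divff// gt_eqF.
case: (ex_minnP ex) => e re emin.
have en : (e <= n)%N by apply: emin; rewrite divff// gt_eqF.
have e2 : 2 ^+ e * 2 ^- n <= 2 * r.
  case: e emin {re en} => [|e] emin; first by rewrite expr0 mul1r; lra.
  rewrite exprS -mulrA ler_pM2l// leNgt; apply/negP => /ltW /emin.
  by rewrite ltnn.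
pose rho := 2 ^+ e * 2 ^- n : R.
have e00 : 0 < 2 ^+ e :> R by rewrite exprn_gt0.
have rho0 : 0 < rho by rewrite mulr_gt0.
pose f1 := Num.floor ((x.1 - r) / rho).
pose f2 := Num.floor ((x.2 - r) / rho).
apply: (@le_trans _ _ (9%:R * A ^+ e)).
  have := @count_nodes A e X [seq (`|(f1 + i%:Z)%R|%N, f2 + j%:Z) | i <- iota 0 3, j <- iota 0 3]
    (in_box n x r) A0 (fun v => kt e v en).
  rewrite size_allpairs !size_iota; apply=> q qX /andP[b1 b2].
  have en0 : (0 < 2 ^ e)%N by rewrite expn_gt0.
  have en0z : 0 < (2 ^ e)%N%:Z by rewrite ltz_nat.
  have E : (2 ^ e)%N%:Z%:~R = 2 ^+ e :> R by rewrite -natrX.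
  have EN : (2 ^ e)%N%:R = 2 ^+ e :> R by rewrite natrX.
  have [|i i3 E1] := @box_nodes x.1 rho r (corner R n q).1 (q.1 %/ 2 ^ e)%N%:Z rho0 re _ b1.
    rewrite /rho /= !mulrA ler_pM2r// ltr_pM2r// -EN natr1 -!natrM ler_nat ltr_nat.
    by rewrite leq_trunc_div ltn_ceil.
  have [|j j3 E2] := @box_nodes x.2 rho r (corner R n q).2 (q.2 %/ (2 ^ e)%N%:Z)%Z rho0 re _ b2.
    rewrite /rho /= !mulrA ler_pM2r// ltr_pM2r// -E -[1]/(1%:~R) -rmorphD -!rmorphM ler_int ltr_int.
    by rewrite lez_floor ?gt_eqF//= ltz_ceil.
  apply/allpairsP; exists (i, j); split; rewrite ?mem_iota//=.
  by rewrite /anc /f1 /f2 -E1 -E2.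
rewrite -(powR_exprn e a1 AE).
have : (2 ^+ e) `^ a <= (2 * (r / 2 ^- n)) `^ a.
  rewrite ge0_ler_powR ?nnegrE ?mulr_ge0 ?invr_ge0 ?(ltW r0) ?(ltW n0) ?(ltW e00)//.
  by rewrite mulrA ler_pdivlMr.
rewrite powRM ?divr_ge0 ?(ltW r0) ?(ltW n0)//.
have : 2 `^ a <= 2 `^ 2 :> R by rewrite ler_powR// ler1n.
rewrite (_ : 2 `^ 2 = 4 :> R); last by rewrite -[X in _ `^ X]/(2%:R) powR_mulrn// expr2; ring.
move=> h4 h; have : 2 `^ a * (r / 2 ^- n) `^ a <= 4 * (r / 2 ^- n) `^ a by rewrite ler_wpM2r.
lra.
Qed.

Lemma diam_eball_ge x r : 0 <= r -> (r%:E <= diam (eball x r))%E.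
Proof.
move=> r0; apply: ereal_sup_ubound; exists (x, (x.1 + r, x.2)).
  split; rewrite /eball /= edist_leE//=.
    by rewrite (_ : _ + _ = 0); [rewrite sqr_ge0|ring].
  by rewrite (_ : _ + _ = r ^+ 2); [rewrite lexx|ring].
rewrite /Defs.edist /= (_ : _ + _ = r ^+ 2); last by ring.
by rewrite sqrtr_sqr ger0_norm.
Qed.

(** Mass distribution principle for the counting measure of [X]. Finitely many
balls of the cover already contain all the corners, and [ball_count] bounds the
number of corners in each. *)
Lemma content_ge (A a : R) n X (E : set (R * R)) : 1 <= a <= 2 -> A = 2 `^ a ->
  (forall q, q \in X -> (q.1 < 2 ^ n)%N /\ (`|q.2| <= 7 * 2 ^ n)%N) ->
  (forall e v, (e <= n)%N -> (below e v X)%:R <= A ^+ e) ->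
  (forall q, q \in X -> E (corner R n q)) ->
  (((size X)%:R * (2 ^- n) `^ a / 36)%:E <= Defs.content (2 ^- n) a E)%E.
Proof.
move=> a12 AE Xb kt XE; apply: le_ereal_inf_tmp => _ [D [x [r [rD cov ->]]]].
have n0 : 0 < 2 ^- n :> R by rewrite invr_gt0 exprn_gt0.
have a0 : 0 <= a by case/andP: a12; lra.
have /choice[f Hf] : forall q, exists i, q \in X -> D i /\ eball (x i) (r i) (corner R n q).
  move=> q; have [qX|qX] := boolP (q \in X); last by exists 0%N.
  by have [i Di qi] := cov _ (XE q qX); exists i.
pose I := undup [seq f q | q <- X].
apply: esum_ge; exists [set` I].
  split; first by exact: finite_seq.
  by move=> i /=; rewrite mem_undup => /mapP[q qX ->]; exact: (Hf q qX).1.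
rewrite -fsbig_seq ?undup_uniq//.
have term i : D i -> (((r i) `^ a)%:E <= diam (eball (x i) (r i)) `^ a)%E.
  move=> Di; have ri : 0 <= r i by apply: le_trans (rD i Di); exact: ltW.
  rewrite -poweR_EFin; apply: gt0_ler_poweR => //.
  - by rewrite in_itv /= lee_fin ri leey.
  - by rewrite in_itv /= leey andbT (le_trans _ (diam_eball_ge (x i) ri)).
  - exact: diam_eball_ge.
have ID i : i \in I -> D i by rewrite mem_undup => /mapP[q qX ->]; exact: (Hf q qX).1.
apply: (@le_trans _ _ (\sum_(i <- I) ((r i) `^ a)%:E)%E); last first.
  by rewrite big_seq [leRHS]big_seq; apply: lee_sum => i /ID; exact: term.
rewrite sumEFin lee_fin.
have p0 : 0 < (2 ^- n) `^ a :> R by rewrite powR_gt0.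
rewrite ler_pdivrMr// -ler_pdivlMr//.
apply: (@le_trans _ _ (\sum_(i <- I) (count (in_box n (x i) (r i)) X)%:R)).
  rewrite -natr_sum ler_nat; under eq_bigr do rewrite -sum1_count big_mkcond.
  rewrite exchange_big -sum1_size big_seq [leqRHS]big_seq; apply: leq_sum => q qX.
  have fI : f q \in I by rewrite mem_undup; apply: map_f.
  rewrite (bigD1_seq (f q))//= ?undup_uniq//.
  have [_ ball] := Hf q qX.
  by have [b1 b2] := edist_coord ball; rewrite /in_box b1 b2.
rewrite mulr_suml mulr_suml big_seq [leRHS]big_seq; apply: ler_sum => i /ID Di.
apply: le_trans (ball_count (x i) a12 AE Xb kt (rD i Di)) _.
have ri : 0 < r i by apply: lt_le_trans (rD i Di).
rewrite powRM ?invr_ge0 ?(ltW ri) ?(ltW n0)// -powR_inv1 ?(ltW n0)// powRAC powR_inv1 ?powR_ge0//.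
by rewrite mulrA (mulrC 36).
Qed.

End BallCount.

(** * Parameter squares with the same tube *)

Section Fibres.
Variable R : realType.
Implicit Types (x y z : R * R) (r a : R) (q : nat * int) (n : nat).

(** Squares whose tubes can coincide: nearly equal ones, and, since the line of
parameters [(th, u)] is also that of [(th + 1/2, - u)], nearly antipodal ones. *)
Definition twin n q q' : Prop :=
  (q.1 = q'.1 /\ (`|q.2 - q'.2| <= 64)%N) \/
  ((q.1 + 2 ^ n.-1 = q'.1 \/ q'.1 + 2 ^ n.-1 = q.1)%N /\ (`|(q.2 + q'.2)%R| <= 64)%N).

Lemma tube_leafE n q z : tube (leaf n q) z <->
  exists th u, leaf n q (th, u) /\ proj z th = u.
Proof.
by split=> [[[th u] qu /= e]|[th [u [qu e]]]]; [exists th, u|exists (th, u)].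
Qed.

(** Monotonicity up to [pi / 2], and symmetry about it. *)
Lemma sin_lower n (y : R) : pi / 2 ^+ n.+1 <= y <= pi - pi / 2 ^+ n.+1 ->
  sin (pi / 2 ^+ n.+1) <= sin y.
Proof.
have p0 := pi_gt0 R.
have n0 : 0 < 2 ^+ n.+1 :> R by rewrite exprn_gt0.
have n2 : 2 <= 2 ^+ n.+1 :> R by rewrite exprS ler_peMr// exprn_ege1// ler1n.
set d := pi / _; move=> /andP[h1 h2].
have d0 : 0 < d by rewrite divr_gt0.
have d2 : d <= pi / 2 by rewrite ler_pM2l// lef_pV2 ?posrE.
have dI : d \in `[- (pi / 2), pi / 2] by rewrite in_itv /=; lra.
have [y2|y2] := leP y (pi / 2).
  have yI : y \in `[- (pi / 2), pi / 2] by rewrite in_itv /=; lra.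
  by rewrite leNgt ltr_sin// -leNgt.
rewrite -[leRHS](_ : sin (pi - y) = _); last by rewrite sinB sinpi cospi; ring.
have yI : pi - y \in `[- (pi / 2), pi / 2] by rewrite in_itv /=; lra.
by rewrite leNgt ltr_sin// -leNgt; lra.
Qed.

(** The interval for [t] is that of the differences between the angles of the
column [k'] and the middle angle of the column [k]. It stays away from the
multiples of [pi] unless the columns are equal or opposite. *)
Lemma sin_separated n (k k' : nat) (t : R) : (k < 2 ^ n)%N -> (k' < 2 ^ n)%N ->
  k <> k' -> (k + 2 ^ n.-1 <> k')%N -> (k' + 2 ^ n.-1 <> k)%N ->
  (2 * (k'%:Z - k%:Z) - 1)%:~R * (pi / 2 ^+ n) <= t <=
    (2 * (k'%:Z - k%:Z) + 1)%:~R * (pi / 2 ^+ n) ->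
  sin (pi / 2 ^+ n.+1) <= `|sin t|.
Proof.
case: n => [|n]; first by rewrite expn0; lia.
rewrite /= => kn k'n kk1 kk2 kk3.
have p0 := pi_gt0 R.
have n0 : 0 < 2 ^+ n.+1 :> R by rewrite exprn_gt0.
set w := pi / 2 ^+ n.+1.
have w0 : 0 < w by rewrite divr_gt0.
have w2 : pi / 2 ^+ n.+2 = w / 2.
  by rewrite /w (exprS _ n.+1); field; rewrite gt_eqF.
have pw : pi = (2 * (2 ^ n)%N%:Z)%:~R * w.
  rewrite rmorphM /= -[(2 ^ n)%N%:~R]/((2 ^ n)%N%:R) natrX /w exprS.
  by field; rewrite gt_eqF ?exprn_gt0.
set D := k'%:Z - k%:Z; set h := (2 ^ n)%N%:Z in pw.
have hh : (2 ^ n.+1)%N%:Z = 2 * h by rewrite expnS PoszM.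
have mono (a b : int) : a <= b -> a%:~R * w <= b%:~R * w.
  by move=> ab; rewrite ler_pM2r// ler_int.
move=> /andP[t1 t2].
have up (y : R) : w <= y -> y <= pi - w -> sin (pi / 2 ^+ n.+2) <= sin y.
  by move=> y1 y2; apply: sin_lower; rewrite w2; lra.
have sp (y : R) : sin (y - pi) = - sin y by rewrite sinB sinpi cospi; ring.
have [kn' k'n'] : (k%:Z < 2 * h) /\ (k'%:Z < 2 * h) by rewrite -hh !ltz_nat.
have n1 : D != 0 by apply/eqP; rewrite /D; lia.
have n2 : D != h by apply/eqP; rewrite /D /h; lia.
have n3 : D != - h by apply/eqP; rewrite /D /h; lia.
have h0 : 0 < h by rewrite ltz_nat expn_gt0.
have [Dl Du] : - (2 * h) < D /\ D < 2 * h by rewrite /D; lia.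
clearbody D h.
have [D0|D0] := ltP D 0; [have [Dh|Dh] := ltP D (- h)|have [Dh|Dh] := ltP D h].
- have : sin (pi / 2 ^+ n.+2) <= sin (- t - pi).
    have H1 : (2 * D + 1)%:~R * w <= (- 1 - 2 * h)%:~R * w by apply: mono; lia.
    have H2 : (1 - 4 * h)%:~R * w <= (2 * D - 1)%:~R * w by apply: mono; lia.
    have E1 : (- 1 - 2 * h)%:~R * w = - w - pi by rewrite pw rmorphB rmorphN /=; ring.
    have E2 : (1 - 4 * h)%:~R * w = w - 2 * pi by rewrite pw rmorphB !rmorphM /=; ring.
    by apply: up; lra.
  by rewrite sp sinN opprK => /le_trans; apply; exact: ler_norm.
- have : sin (pi / 2 ^+ n.+2) <= sin (- t).
    have H1 : (2 * D + 1)%:~R * w <= (- 1)%:~R * w by apply: mono; lia.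
    have H2 : (1 - 2 * h)%:~R * w <= (2 * D - 1)%:~R * w by apply: mono; lia.
    have E1 : (- 1)%:~R * w = - w by rewrite rmorphN /=; ring.
    have E2 : (1 - 2 * h)%:~R * w = w - pi by rewrite pw rmorphB /=; ring.
    by apply: up; lra.
  by rewrite sinN => /le_trans; apply; rewrite -normrN ler_norm.
- have : sin (pi / 2 ^+ n.+2) <= sin t.
    have H1 : (2 * D + 1)%:~R * w <= (2 * h - 1)%:~R * w by apply: mono; lia.
    have H2 : 1%:~R * w <= (2 * D - 1)%:~R * w by apply: mono; lia.
    have E2 : (2 * h - 1)%:~R * w = pi - w by rewrite pw rmorphB /=; ring.
    by apply: up; lra.
  by move=> /le_trans; apply; exact: ler_norm.
- have : sin (pi / 2 ^+ n.+2) <= sin (t - pi).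
    have H1 : (2 * D + 1)%:~R * w <= (4 * h - 1)%:~R * w by apply: mono; lia.
    have H2 : (2 * h + 1)%:~R * w <= (2 * D - 1)%:~R * w by apply: mono; lia.
    have E1 : (4 * h - 1)%:~R * w = 2 * pi - w by rewrite pw rmorphB !rmorphM /=; ring.
    have E2 : (2 * h + 1)%:~R * w = w + pi by rewrite pw rmorphD /=; ring.
    by apply: up; lra.
  by rewrite sp => /le_trans; apply; rewrite -normrN ler_norm.
Qed.

(** The point is the one of the line of parameters [(th, u)] at distance [M]
from the foot of the perpendicular from the origin. *)
Lemma proj_line_point (th u M th' : R) :
  proj (u * cos (2 * pi * th) - M * sin (2 * pi * th),
        u * sin (2 * pi * th) + M * cos (2 * pi * th)) th' =
  u * cos (2 * pi * (th' - th)) + M * sin (2 * pi * (th' - th)).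
Proof. by rewrite /proj /= mulrBr cosB sinB; ring. Qed.

Lemma proj_line_point_id (th u M : R) :
  proj (u * cos (2 * pi * th) - M * sin (2 * pi * th),
        u * sin (2 * pi * th) + M * cos (2 * pi * th)) th = u.
Proof. by rewrite proj_line_point subrr mulr0 cos0 sin0; ring. Qed.

(** The offset is a projection of [z], up to the side of the square. *)
Lemma leaf_offset_bound n q z : tube (leaf n q) z -> `|z.1| <= 3 -> `|z.2| <= 3 ->
  (`|q.2| <= 7 * 2 ^ n)%N.
Proof.
move=> /tube_leafE[th [u [/leafE[_ /= /andP[u1 u2]] e]]] z1 z2.
have := proj_le th z1 z2; rewrite e ler_norml => /andP[h1 h2].
have n0 : 0 < 2 ^+ n :> R by rewrite exprn_gt0.
have n1 : 1 <= 2 ^+ n :> R by rewrite exprn_ege1// ler1n.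
have nn : 2 ^- n <= 1 :> R by rewrite invf_le1.
rewrite mulrDl mul1r in u2.
have l1 : q.2%:~R / 2 ^+ n <= 7 :> R by lra.
have l2 : - 7 <= q.2%:~R / 2 ^+ n :> R by lra.
rewrite ler_pdivrMr// in l1; rewrite ler_pdivlMr// in l2.
have E : 7 * 2 ^+ n = (7 * (2 ^ n)%N%:Z)%:~R :> R.
  by rewrite rmorphM /= -[(2 ^ n)%N%:~R]/((2 ^ n)%N%:R) natrX.
rewrite E ler_int in l1; rewrite mulNr E -rmorphN ler_int in l2.
lia.
Qed.

Lemma twin_column n (k : nat) (th th' : R) (D : int) :
  k%:R / 2 ^+ n <= th' < (k%:R + 1) / 2 ^+ n ->
  th = ((k%:Z - D)%:~R + 2^-1) / 2 ^+ n ->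
  (2 * D - 1)%:~R * (pi / 2 ^+ n) <= 2 * pi * (th' - th) <= (2 * D + 1)%:~R * (pi / 2 ^+ n).
Proof.
have n0 : 0 < 2 ^+ n :> R by rewrite exprn_gt0.
have p0 := pi_gt0 R.
move=> /andP[h1 h2] ->.
set a := 2 ^- n : R in h1 h2 *.
have -> : 2 * pi * (th' - ((k%:Z - D)%:~R + 2^-1) * a) =
    2 * pi * (th' - k%:R * a) + (2 * D - 1)%:~R * (pi * a).
  by rewrite !rmorphB rmorphM /= -[k%:~R]/(k%:R); field.
rewrite mulrDl mul1r in h2.
have d0 : 0 <= th' - k%:R * a by lra.
have d1 : th' - k%:R * a <= a by lra.
rewrite (_ : (2 * D + 1)%:~R = 2 + (2 * D - 1)%:~R :> R); last first.
  by rewrite rmorphB rmorphD /=; ring.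
rewrite [X in _ <= _ <= X]mulrDl lerD2r lerDr mulr_ge0//=; last by rewrite mulr_ge0// ltW.
by rewrite -[leLHS]mulrA !ler_pM2l.
Qed.

(** Far away on the middle line of [q], the tube of [q'] is met only if the two
directions agree up to a half turn; then the foot of that line, which is also in
the tube of [q'], shows that the offsets are nearly equal or opposite. *)
Lemma tube_twin n q q' z : (q.1 < 2 ^ n)%N -> (q'.1 < 2 ^ n)%N ->
  tube (leaf n q) z -> `|z.1| <= 3 -> `|z.2| <= 3 ->
  tube (leaf n q) = tube (leaf n q') :> set (R * R) -> twin n q q'.
Proof.
move=> qn q'n tz z1 z2 tE.
have off := leaf_offset_bound tz z1 z2.
have n0 : 0 < 2 ^+ n :> R by rewrite exprn_gt0.
have ni0 : 0 < 2 ^- n :> R by rewrite invr_gt0.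
have p0 := pi_gt0 R; have p4 := pi_lt4 R.
pose th : R := (q.1%:R + 2^-1) / 2 ^+ n.
pose u : R := q.2%:~R / 2 ^+ n.
have thu : leaf n q (th, u).
  apply/leafE; rewrite /th /u /=.
  by split; rewrite !mulrDl; lra.
have u7 : `|u| <= 7.
  rewrite /u normrM (ger0_norm (ltW ni0)) ler_pdivrMr//.
  have E : (7 * 2 ^ n)%N%:Z%:~R = 7 * 2 ^+ n :> R.
    by rewrite -[LHS]/((7 * 2 ^ n)%N%:R) natrM natrX.
  by rewrite -intr_norm -E ler_int -abszE lez_nat.
pose D : int := q'.1%:Z - q.1%:Z.
have meet M : exists th' u', leaf n q' (th', u') /\
    u * cos (2 * pi * (th' - th)) + M * sin (2 * pi * (th' - th)) = u'.
  have : tube (leaf n q) (u * cos (2 * pi * th) - M * sin (2 * pi * th),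
        u * sin (2 * pi * th) + M * cos (2 * pi * th)).
    by apply/tube_leafE; exists th, u; rewrite proj_line_point_id.
  rewrite tE => /tube_leafE[th' [u' [l e]]]; exists th', u'.
  by split=> //; rewrite -e proj_line_point.
have thD : th = ((q'.1%:Z - D)%:~R + 2^-1) / 2 ^+ n.
  by rewrite /D (_ : q'.1%:Z - (q'.1%:Z - q.1%:Z) = q.1%:Z)//; ring.
have col th' u' : leaf n q' (th', u') ->
    (2 * D - 1)%:~R * (pi / 2 ^+ n) <= 2 * pi * (th' - th) <= (2 * D + 1)%:~R * (pi / 2 ^+ n).
  by move=> /leafE[h _]; exact: twin_column h thD.
(* far along the line, a fixed angle would exceed any bounded offset *)
have cols : q.1 = q'.1 \/ (q.1 + 2 ^ n.-1 = q'.1 \/ q'.1 + 2 ^ n.-1 = q.1)%N.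
  apply: contrapT => /not_orP[n1 /not_orP[n2 n3]].
  pose c : R := sin (pi / 2 ^+ n.+1).
  have c0 : 0 < c.
    apply: sin_gt0_pi; rewrite divr_gt0 ?exprn_gt0//= ltr_pdivrMr ?exprn_gt0//.
    by rewrite ltr_pMr// exprn_egt1// ltr1n.
  pose B : R := `|q'.2%:~R / 2 ^+ n| + 2 ^- n.
  have [th' [u' [l e]]] := meet ((B + 8) / c).
  have sc : c <= `|sin (2 * pi * (th' - th))|.
    by apply: (@sin_separated n q.1 q'.1) => //; exact: col l.
  have uB : `|u'| <= B.
    move: l => /leafE[_ /=]; rewrite mulrDl mul1r => /andP[l1 l2].
    have := ler_norm (q'.2%:~R / 2 ^+ n : R).
    have := ler_norm (- (q'.2%:~R / 2 ^+ n) : R); rewrite normrN.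
    by rewrite ler_norml /B; lra.
  have B0 : 0 <= B by apply: le_trans uB.
  have : `|(B + 8) / c * sin (2 * pi * (th' - th))| <= B + 7.
    have -> : (B + 8) / c * sin (2 * pi * (th' - th)) = u' - u * cos (2 * pi * (th' - th)).
      by rewrite -e; ring.
    rewrite (le_trans (ler_normB _ _))// lerD// normrM (le_trans _ u7)//.
    by rewrite ler_piMr// cos_max.
  rewrite normrM ger0_norm ?divr_ge0 ?(ltW c0)//; last by lra.
  have : B + 8 <= (B + 8) / c * `|sin (2 * pi * (th' - th))|.
    rewrite mulrAC ler_pdivlMr// ler_wpM2l//; lra.
  lra.
have [th' [u' [l e]]] := meet 0; rewrite mul0r addr0 in e.
have tI := col _ _ l; set t := 2 * pi * (th' - th) in e tI.
move: l => /leafE[_ /=]; rewrite mulrDl mul1r => l.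
have w4 : pi / 2 ^+ n <= 4 * 2 ^- n :> R by rewrite ler_pM2r// ltW.
have cosb (v : R) : `|v| <= pi / 2 ^+ n -> `|u * cos v - u| <= 28 * 2 ^- n.
  move=> vw; rewrite -[X in _ - X]mulr1 -mulrBr normrM.
  rewrite (_ : 28 * _ = 7 * (4 * 2 ^- n)); last by ring.
  rewrite ler_pM//; apply: le_trans w4; apply: le_trans vw.
  by have := cos_lip v 0; rewrite cos0 subr0.
have toint (k : int) : `|k%:~R / 2 ^+ n| <= 29 * 2 ^- n :> R -> (`|k| <= 64)%N.
  rewrite normrM (ger0_norm (ltW ni0)) ler_pM2r// -intr_norm => h.
  have k29 : `|k| <= 29%N%:Z by rewrite -(ler_int R).
  by apply: leq_trans (_ : 29 <= 64)%N => //; rewrite -lez_nat abszE.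
have w0 : 0 < pi / 2 ^+ n :> R by rewrite divr_gt0.
have anti (v : R) : `|v| <= pi / 2 ^+ n -> cos t = - cos v ->
    (`|(q.2 + q'.2)%R| <= 64)%N.
  move=> vw tv; have := cosb v vw; rewrite tv mulrN in e => cb.
  apply: toint; rewrite rmorphD mulrDl -/u; move: cb l; rewrite -e !ler_norml; lra.
have n1 : (2 ^ n.-1 < 2 ^ n)%N -> pi = (2 * (2 ^ n.-1)%N%:Z)%:~R * (pi / 2 ^+ n) :> R.
  case: (n) => // k _; rewrite rmorphM /= -[(2 ^ k)%N%:~R]/((2 ^ k)%N%:R) natrX exprS.
  by field; rewrite gt_eqF ?exprn_gt0.
case: cols => [same|[c|c]].
- left; split=> //.
  have D0 : D = 0 by rewrite /D same subrr.
  have tw : `|t| <= pi / 2 ^+ n.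
    by move: tI; rewrite D0 mulr0 !add0r rmorphN mulN1r mul1r ler_norml.
  have := cosb t tw => cb.
  apply: toint; rewrite rmorphB mulrBl -/u; move: cb l; rewrite -e !ler_norml; lra.
- right; split; first by left.
  have nn : (2 ^ n.-1 < 2 ^ n)%N by rewrite (leq_ltn_trans _ q'n)// -c leq_addl.
  have D0 : D = (2 ^ n.-1)%N%:Z by rewrite /D -c PoszD addrAC subrr add0r.
  apply: (anti (t - pi)); last by rewrite cosB cospi sinpi; ring.
  move: tI; rewrite D0 {3}(n1 nn) rmorphB rmorphD /= mulrBl mulrDl mul1r ler_norml; lra.
- right; split; first by right.
  have nn : (2 ^ n.-1 < 2 ^ n)%N by rewrite (leq_ltn_trans _ qn)// -c leq_addl.
  have D0 : D = - (2 ^ n.-1)%N%:Z by rewrite /D -c PoszD opprD addrA subrr add0r.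
  apply: (anti (t + pi)); last by rewrite cosD cospi sinpi; ring.
  move: tI; rewrite D0 mulrN {3}(n1 nn) rmorphB rmorphD rmorphN /= mulrBl mulrDl mulNr mul1r ler_norml; lra.
Qed.

End Fibres.

(** * The family of tubes *)

Section TubeFamily.
Variable R : realType.
Implicit Types (x y z w : R * R) (r a : R) (q : nat * int) (n : nat).

Let window : seq int := [seq i%:Z - 64 | i <- iota 0 129].

Lemma mem_window (d : int) : (`|d| <= 64)%N -> d \in window.
Proof.
move=> d64; apply/mapP; exists `|(d + 64)%R|%N; rewrite ?mem_iota; lia.
Qed.

Definition twins n q : seq (nat * int) :=
  [seq (k, (q.2 + d)%R) | k <- [:: q.1], d <- window] ++
  [seq (k, (d - q.2)%R) | k <- [:: q.1 + 2 ^ n.-1; q.1 - 2 ^ n.-1]%N, d <- window].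

Lemma size_twins n q : size (twins n q) = 387%N.
Proof. by rewrite size_cat !size_allpairs size_map size_iota. Qed.

Lemma twin_mem n q q' : twin n q q' -> q' \in twins n q.
Proof.
case: q' => k' l'; rewrite mem_cat => -[[e h]|[e h]]; apply/orP; [left|right];
  rewrite /= in e h.
  apply/allpairsP; exists (k', l' - q.2); split.
  - by rewrite /= e inE.
  - by apply: mem_window; rewrite -abszN opprB.
  - by rewrite /=; congr pair; ring.
apply/allpairsP; exists (k', q.2 + l'); split.
- rewrite /= !inE; case: e => e; apply/orP; [left|right]; apply/eqP.
    by rewrite e.
  by rewrite -e addnK.
- exact: mem_window.
- by rewrite /=; congr pair; ring.
Qed.

Variables (n : nat) (X : seq (nat * int)).
Hypothesis Xn : forall q, q \in X -> (q.1 < 2 ^ n)%N.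
Hypothesis Xt : forall q, q \in X -> exists z : R * R,
  [/\ tube (leaf n q) z, `|z.1| <= 3 & `|z.2| <= 3].

Definition tubes_of : seq (set (R * R)) := [seq tube (leaf n q) | q <- X].

Lemma tubes_of_twin q q' : q \in X -> (q'.1 < 2 ^ n)%N ->
  tube (leaf n q) = tube (leaf n q') :> set (R * R) -> twin n q q'.
Proof. by move=> qX q'n e; have [z [z0 z1 z2]] := Xt qX; exact: tube_twin (Xn qX) q'n z0 z1 z2 e. Qed.

(** The squares with a given tube are twins of any one of them. *)
Lemma size_tubes_of : uniq X -> (size X <= 387 * size (undup tubes_of))%N.
Proof.
move=> uX.
apply: (@leq_trans (\sum_(U <- undup tubes_of) count (fun q => tube (leaf n q) == U) X)).
  under eq_bigr do rewrite -sum1_count big_mkcond.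
  rewrite exchange_big -sum1_size big_seq [leqRHS]big_seq; apply: leq_sum => q qX.
  have qL : tube (leaf n q) \in undup tubes_of by rewrite mem_undup; apply: map_f.
  by rewrite (bigD1_seq _ qL)//= ?undup_uniq// eqxx.
apply: (@leq_trans (\sum_(U <- undup tubes_of) 387)%N); last first.
  by rewrite big_const_seq count_predT iter_addn_0.
rewrite big_seq [leqRHS]big_seq; apply: leq_sum => U.
rewrite mem_undup => /mapP[q qX ->].
rewrite -size_filter -(size_twins n q); apply: uniq_leq_size; first by rewrite filter_uniq.
move=> q'; rewrite mem_filter => /andP[/eqP e q'X]; apply: twin_mem.
by apply: tubes_of_twin => //; exact: Xn.
Qed.

(** Each square whose tube is in the family is a twin of a member of [X], and
the twins of the members near a ball are near that ball or one of its two
antipodal images; [67 * r] is more than the sum of the radius, the side and the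
offset between twins, at most [64] sides, and [67 ^+ 2] is due to [a <= 2]. *)
Lemma tubes_of_kt (A a : R) : 1 <= a <= 2 -> A = 2 `^ a ->
  (forall q, q \in X -> (`|q.2| <= 7 * 2 ^ n)%N) ->
  (forall e v, (e <= n)%N -> (below e v X)%:R <= A ^+ e) ->
  tube_katz_tao (2 ^- n) a (387 * 3 * 36 * 67 ^+ 2) [set` tubes_of].
Proof.
move=> a12 AE Xo kt x r nr.
have n0 : 0 < 2 ^+ n :> R by rewrite exprn_gt0.
have ni0 : 0 < 2 ^- n :> R by rewrite invr_gt0.
have r0 : 0 < r by apply: lt_le_trans nr.
have Xb q : q \in X -> (q.1 < 2 ^ n)%N /\ (`|q.2| <= 7 * 2 ^ n)%N.
  by move=> qX; split; [exact: Xn|exact: Xo].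
pose c2 := (x.1 - 1 / 2, - x.2) : R * R.
pose c3 := (x.1 + 1 / 2, - x.2) : R * R.
pose near q := [|| in_box n x (67 * r) q, in_box n c2 (67 * r) q | in_box n c3 (67 * r) q].
pose Z := flatten [seq twins n q | q <- X & near q].
have sub : param_union (2 ^- n) [set` tubes_of] `&` eball x r `<=`
    [set z | exists2 q, q \in Z & leaf n q z].
  move=> w [[Q [/param_squareP[z zn ->] /mapP[q qX e]] zw] xw].
  have tw := tubes_of_twin qX zn (esym e).
  exists z => //; apply/flattenP; exists (twins n q); last exact: twin_mem.
  apply: map_f; rewrite mem_filter qX andbT.
  have [] := edist_coord xw; have [] := leaf_near zw (corner_leaf R n z).
  rewrite /near /in_box /corner /=.
  have hn : (2 ^ n.-1 < 2 ^ n)%N -> (2 ^ n.-1)%:R / 2 ^+ n = 1 / 2 :> R.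
    case: (n) => // k _; rewrite /= natrX exprS; field.
    by rewrite gt_eqF ?exprn_gt0.
  have off (k : int) : (`|k| <= 64)%N -> `|k%:~R / 2 ^+ n| <= 64 * 2 ^- n :> R.
    move=> k64; rewrite normrM (ger0_norm (ltW ni0)) ler_pM2r// -intr_norm.
    by rewrite -[leRHS]/(64%N%:Z%:~R) ler_int -abszE lez_nat.
  case: tw => [[e1 /off]|[ant /off]].
    rewrite e1 rmorphB mulrBl !ler_norml => h h1 h2 h3 h4; apply/orP; left; lra.
  have -> : (q.2 + z.2)%:~R / 2 ^+ n = q.2%:~R / 2 ^+ n + z.2%:~R / 2 ^+ n :> R.
    by rewrite rmorphD mulrDl.
  case: ant => c.
    have nn : (2 ^ n.-1 < 2 ^ n)%N by rewrite (leq_ltn_trans _ zn)// -c leq_addl.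
    have -> : z.1%:R / 2 ^+ n = q.1%:R / 2 ^+ n + 1 / 2 :> R by rewrite -c natrD mulrDl hn.
    rewrite !ler_norml => h h1 h2 h3 h4.
    by apply/orP; right; apply/orP; left; rewrite /c2 /=; lra.
  have nn : (2 ^ n.-1 < 2 ^ n)%N by rewrite (leq_ltn_trans _ (Xn qX))// -c leq_addl.
  have -> : q.1%:R / 2 ^+ n = z.1%:R / 2 ^+ n + 1 / 2 :> R by rewrite -c natrD mulrDl hn.
  rewrite !ler_norml => h h1 h2 h3 h4.
  by apply/orP; right; apply/orP; right; rewrite /c3 /=; lra.
apply: le_trans (cov_leaves sub) _; rewrite lee_fin.
have -> : size Z = (387 * count near X)%N.
  rewrite size_flatten /shape -map_comp -size_filter.
  rewrite (eq_map (g := fun=> 387%N)); last by move=> q; exact: size_twins.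
  by elim: [seq _ <- _ | _] => //= q s ->; rewrite mulnS.
have r67 : 2 ^- n <= 67 * r by lra.
have bc c := ball_count c a12 AE Xb kt r67.
have : (count near X)%:R <= 3 * (36 * (67 * r / 2 ^- n) `^ a).
  apply: (@le_trans _ _ ((count (in_box n x (67 * r)) X)%:R +
    ((count (in_box n c2 (67 * r)) X)%:R + (count (in_box n c3 (67 * r)) X)%:R))).
    rewrite -!natrD ler_nat.
    apply: leq_trans (leq_add (leqnn _) (_ : count (predU (in_box n c2 (67 * r)) (in_box n c3 (67 * r))) X <= _)%N); last first.
      by rewrite -count_predUI leq_addr.
    by rewrite -count_predUI leq_addr.
  have := bc x; have := bc c2; have := bc c3; lra.
have p67 : (67 * r / 2 ^- n) `^ a <= 67 ^+ 2 * (r / 2 ^- n) `^ a.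
  rewrite -mulrA powRM ?divr_ge0 ?(ltW r0) ?(ltW ni0)// ler_wpM2r ?powR_ge0//.
  rewrite -[leRHS]powR_mulrn// ler_powR// ?ler1n//; by case/andP: a12.
rewrite natrM; lra.
Qed.

End TubeFamily.

(** * From the measure to point masses *)

Section FiniteUnions.
Context d (T : measurableType d) (R : realType) (mu : {measure set T -> \bar R}).
Variables (I : eqType) (F : I -> set T).
Hypothesis mF : forall i, measurable (F i).

Definition union_of (s : seq I) : set T := [set z | exists2 i, i \in s & F i z].

Lemma union_of_cons i s : union_of (i :: s) = F i `|` union_of s.
Proof.
apply/seteqP; split=> z.
  by move=> [j]; rewrite inE => /orP[/eqP ->|js Fz]; [left|right; exists j].
by move=> [Fz|[j js Fz]]; [exists i|exists j]; rewrite // inE ?eqxx ?js ?orbT.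
Qed.

Lemma union_of_measurable s : measurable (union_of s).
Proof.
elim: s => [|i s IH]; last by rewrite union_of_cons; exact: measurableU.
by rewrite (_ : union_of [::] = set0)//; apply/seteqP; split=> // z [].
Qed.

Lemma measure_union_le s : (mu (union_of s) <= \sum_(i <- s) mu (F i))%E.
Proof.
elim: s => [|i s IH].
  by rewrite big_nil (_ : union_of [::] = set0) ?measure0//; apply/seteqP; split=> // z [].
rewrite big_cons union_of_cons.
apply: le_trans (measureU2 mu (mF i) (union_of_measurable s)) _.
exact: leeD.
Qed.

Lemma measure_union_disjoint s : uniq s ->
  (forall i j z, i \in s -> j \in s -> F i z -> F j z -> i = j) ->
  mu (union_of s) = (\sum_(i <- s) mu (F i))%E.
Proof.
elim: s => [|i s IH] us dis.
  by rewrite big_nil (_ : union_of [::] = set0) ?measure0//; apply/seteqP; split=> // z [].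
move: us => /= /andP[nis us].
rewrite big_cons union_of_cons measureU//; last 2 first.
- exact: union_of_measurable.
- apply/seteqP; split=> // z [Fi [j js Fj]].
  have ij : i = j by apply: dis Fi Fj; rewrite inE ?eqxx ?js ?orbT.
  by move: nis; rewrite ij js.
congr (_ + _)%E; apply: IH => // a b z as_ bs; apply: dis; rewrite inE ?as_ ?bs orbT//.
Qed.
End FiniteUnions.

Section Plane.
Variable R : realType.
Local Notation plane := (measurableTypeR R * measurableTypeR R)%type.
Variable mu : {measure set plane -> \bar R}.

Lemma measurable_square (a : R) (k l : int) : measurable (dyadic_square a k l : set plane).
Proof.
rewrite (_ : dyadic_square a k l = `[k%:~R * a, (k + 1)%:~R * a[ `*` `[l%:~R * a, (l + 1)%:~R * a[).
  by apply: measurableX; exact: measurable_itv.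
by apply/seteqP; split=> z [] h1 h2; split; move: h1 h2; rewrite /= ?in_itv.
Qed.

Lemma measurable_eball (x : R * R) (r : R) : measurable (eball x r : set plane).
Proof.
have [r0|r0] := ltP r 0.
  rewrite (_ : eball x r = set0)//; apply/seteqP; split=> // y.
  rewrite /eball /= => h; have d0 : 0 <= Defs.edist x y by rewrite sqrtr_ge0.
  by exfalso; lra.
pose f (y : plane) : R := (x.1 - y.1) ^+ 2 + (x.2 - y.2) ^+ 2.
rewrite (_ : eball x r = setT `&` f @^-1` `]-oo, r ^+ 2]).
  suff mf : measurable_fun setT f by apply: mf => //; exact: measurable_itv.
  apply: measurable_realfun.measurable_funD; apply: measurable_realfun.measurable_funX;
  apply: measurable_realfun.measurable_funB => //.
rewrite setTI; apply/seteqP; split=> y; rewrite /eball /= edist_leE// in_itv//=.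
Qed.

Lemma floor_cell (c w : R) : 0 < w ->
  (Num.floor (c / w))%:~R * w <= c < (Num.floor (c / w) + 1)%:~R * w.
Proof.
move=> w0; rewrite -ler_pdivlMr// -ltr_pdivrMr// floor_le /=.
by rewrite floorD1_gt.
Qed.

Lemma mem_dyadic (w : R) (z : R * R) : 0 < w ->
  dyadic_square w (Num.floor (z.1 / w)) (Num.floor (z.2 / w)) z.
Proof. by move=> w0; split; exact: floor_cell. Qed.

Lemma dyadic_square_near (w : R) k l (y z : R * R) :
  dyadic_square w k l y -> dyadic_square w k l z -> `|y.1 - z.1| < w /\ `|y.2 - z.2| < w.
Proof.
move=> [y1 y2] [z1 z2]; rewrite !rmorphD !mulrDl !mul1r in y1 y2 z1 z2.
by split; rewrite ltr_norml; lra.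
Qed.

(** Dyadic squares are a countable base, which gives the measurability of open
sets and the covering property behind [null_off_support]. *)
Lemma open_dyadic (U : set (R * R)) (z : R * R) : open U -> U z ->
  exists n k l, dyadic_square (2 ^- n) k l z /\ dyadic_square (2 ^- n) k l `<=` U.
Proof.
move=> oU Uz; have /nbhs_ballP[e /= e0 eU] : nbhs z U by exact: open_nbhs_nbhs.
pose n := Num.bound e^-1.
have ne : 2 ^- n < e.
  rewrite invf_plt ?posrE ?exprn_gt0//.
  apply: lt_trans (archi_boundP _) _; first by rewrite invr_ge0 ltW.
  by rewrite -natrX ltr_nat ltn_expl.
have n0 : 0 < 2 ^- n :> R by rewrite invr_gt0 exprn_gt0.
exists n, (Num.floor (z.1 / 2 ^- n)), (Num.floor (z.2 / 2 ^- n)).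
split; first exact: mem_dyadic.
move=> y /(dyadic_square_near (mem_dyadic z n0))[h1 h2]; apply: eU.
by split; rewrite /ball /=; exact: lt_trans ne.
Qed.

Let cell (i : nat) : set plane :=
  if choice.unpickle i is Some (n, k, l) then dyadic_square (2 ^- n) k l else set0.

Let measurable_cell i : measurable (cell i).
Proof. by rewrite /cell; case: (choice.unpickle i) => [[[n k] l]|//]; exact: measurable_square. Qed.

Lemma open_plane_measurable (U : set (R * R)) : open U -> measurable (U : set plane).
Proof.
move=> oU; pose D := [set i | cell i `<=` U].
rewrite (_ : U = \bigcup_(i in D) cell i); first by apply: bigcup_measurable => i _.
apply/seteqP; split=> z; last by move=> [i Di zi]; exact: Di.
move=> Uz; have [n [k [l [zs sU]]]] := open_dyadic oU Uz.
by exists (choice.pickle (n, k, l)); rewrite /D /cell /= choice.pickleK.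
Qed.

(** Lindelof: the complement of the support is a countable union of null dyadic
squares. *)
Lemma null_off_support (F : set plane) : measurable F ->
  F `&` spt mu = set0 -> mu F = 0%E.
Proof.
move=> mF F0; apply: measure_negligible => //.
pose D i := mu (cell i) = 0%E.
apply: (@negligibleS _ _ _ _ (\bigcup_(i in D) cell i)).
  move=> z Fz; have nz : ~ spt mu z by move=> sz; have : set0 z by rewrite -F0.
  move: nz => /existsNP[U /not_implyP[oU /not_implyP[Uz /negP]]].
  rewrite -leNgt => mU.
  have [n [k [l [zs sU]]]] := open_dyadic oU Uz.
  exists (choice.pickle (n, k, l)); rewrite /D /cell /= choice.pickleK//.
  apply/eqP; rewrite eq_le measure_ge0 andbT; apply: le_trans mU.
  apply: le_measure => //; rewrite inE; first exact: measurable_square.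
  exact: open_plane_measurable.
rewrite bigcup_mkcond; apply: negligible_bigcup => i.
case: ifPn => [|_]; last exact: negligible_set0.
by rewrite inE => Di; exists (cell i); split.
Qed.


End Plane.

Section Points.
Variables (R : realType) (n : nat) (C t t' : R).
Local Notation plane := (measurableTypeR R * measurableTypeR R)%type.
Variable mu : {measure set plane -> \bar R}.
Implicit Types (p : int * int).

Definition square p : set plane := dyadic_square (2 ^- n) p.1 p.2.
Definition sqcorner p : R * R := (p.1%:~R / 2 ^+ n, p.2%:~R / 2 ^+ n).
Definition mass p : R := fine (mu (square p)).

Let rng : seq int := [seq i%:Z - (2 ^ n.+1)%N%:Z | i <- iota 0 (2 ^ n.+2)].
(** The squares that tile [[- 2, 2) * [- 2, 2)]. *)
Definition grid : seq (int * int) := [seq (k, l) | k <- rng, l <- rng].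
(** Squares of positive mass meet the support, so that they carry a family of
tubes. *)
Definition points : seq (int * int) := [seq p <- grid | mass p != 0].

Let n0 : 0 < 2 ^+ n :> R. Proof. by rewrite exprn_gt0. Qed.
Let ni0 : 0 < 2 ^- n :> R. Proof. by rewrite invr_gt0. Qed.

Lemma mem_rng (k : int) : (k \in rng) = (- (2 ^ n.+1)%N%:Z <= k < (2 ^ n.+1)%N%:Z).
Proof.
have e : (2 ^ n.+2 = 2 ^ n.+1 + 2 ^ n.+1)%N by rewrite expnS mul2n addnn.
rewrite /rng e; move: (2 ^ n.+1)%N => N.
apply/mapP/idP => [[i]|h].
  by rewrite mem_iota add0n => /andP[_ h] ->; lia.
by exists `|(k + N%:Z)%R|%N; rewrite ?mem_iota; lia.
Qed.

Lemma grid_uniq : uniq grid.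
Proof.
have u : uniq rng by rewrite map_inj_uniq ?iota_uniq// => i j; lia.
by apply: allpairs_uniq => // -[a b] [c d] _ _ [-> ->].
Qed.

Lemma mem_grid p : (p \in grid) = (p.1 \in rng) && (p.2 \in rng).
Proof.
apply/allpairsP/andP => [[[a b] [/= h1 h2 ->]]//|[h1 h2]].
by exists p; split=> //; case: p {h1 h2}.
Qed.

Lemma squareE p z : square p z <->
  (p.1%:~R / 2 ^+ n <= z.1 < p.1%:~R / 2 ^+ n + 2 ^- n /\
   p.2%:~R / 2 ^+ n <= z.2 < p.2%:~R / 2 ^+ n + 2 ^- n).
Proof. by rewrite /square /dyadic_square /= !rmorphD /= !mulrDl !mul1r. Qed.

Lemma square_near p z : square p z ->
  `|(sqcorner p).1 - z.1| <= 2 ^- n /\ `|(sqcorner p).2 - z.2| <= 2 ^- n.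
Proof. by move=> /squareE[h1 h2]; split; rewrite /sqcorner /= ler_norml; lra. Qed.

Lemma grid_bound p : p \in grid -> `|(sqcorner p).1| <= 2 /\ `|(sqcorner p).2| <= 2.
Proof.
have E : (2 ^ n.+1)%N%:Z%:~R = 2 * 2 ^+ n :> R.
  by rewrite -[LHS]/((2 ^ n.+1)%N%:R) natrX exprS.
have H (k : int) : k \in rng -> `|k%:~R / 2 ^+ n| <= 2 :> R.
  rewrite mem_rng => /andP[k1 k2].
  have : - (2 * 2 ^+ n) <= k%:~R :> R by rewrite -E -rmorphN ler_int.
  have : k%:~R <= 2 * 2 ^+ n :> R by rewrite -E ler_int ltW.
  move=> h1 h2; rewrite ler_norml ler_pdivrMr// ler_pdivlMr//; lra.
by rewrite mem_grid => /andP[/H ? /H ?].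
Qed.

Lemma grid_square_bound p z : p \in grid -> square p z -> `|z.1| <= 2 /\ `|z.2| <= 2.
Proof.
have E : (2 ^ n.+1)%N%:Z%:~R = 2 * 2 ^+ n :> R.
  by rewrite -[LHS]/((2 ^ n.+1)%N%:R) natrX exprS.
have H (k : int) (c : R) : k \in rng ->
    k%:~R / 2 ^+ n <= c < k%:~R / 2 ^+ n + 2 ^- n -> `|c| <= 2.
  rewrite mem_rng => /andP[k1 k2] /andP[c1 c2].
  have k1' : - 2 <= k%:~R / 2 ^+ n :> R.
    by rewrite ler_pdivlMr// mulNr -E -rmorphN ler_int.
  have k2' : k%:~R / 2 ^+ n + 2 ^- n <= 2 :> R.
    rewrite -[X in _ + X]mul1r -mulrDl ler_pdivrMr// -E.
    by rewrite -[1]/(1%:~R) -rmorphD ler_int lezD1.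
  by rewrite ler_norml; lra.
by rewrite mem_grid => /andP[p1 p2] /squareE[/(H _ _ p1) ? /(H _ _ p2) ?].
Qed.

Lemma square_disjoint p p' z : square p z -> square p' z -> p = p'.
Proof.
case: p p' => [k l] [k' l'] /squareE[/= h1 h2] /squareE[/= h3 h4].
have H (a b : int) (c : R) : a%:~R / 2 ^+ n <= c < a%:~R / 2 ^+ n + 2 ^- n ->
    b%:~R / 2 ^+ n <= c < b%:~R / 2 ^+ n + 2 ^- n -> a = b.
  have e (i : int) : i%:~R / 2 ^+ n + 2 ^- n = (i + 1)%:~R / 2 ^+ n :> R.
    by rewrite rmorphD mulrDl mul1r.
  rewrite !e => /andP[a1 a2] /andP[b1 b2].
  have := le_lt_trans a1 b2; have := le_lt_trans b1 a2.
  rewrite !ltr_pM2r// !ltr_int !ltzD1 => h g.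
  by apply/eqP; rewrite eq_le h g.
by congr pair; [exact: H h1 h3|exact: H h2 h4].
Qed.

Lemma points_meet p : p \in points -> dyadic_meeting (2 ^- n) (spt mu) (square p).
Proof.
rewrite mem_filter => /andP[/eqP m0 _]; split; first by exists p.1, p.2.
apply/set0P/eqP => F0; apply: m0; rewrite /mass (_ : mu (square p) = 0%E)//.
by apply: null_off_support => //; exact: measurable_square.
Qed.

Hypotheses (C0 : 0 <= C) (t12 : 0 <= t <= 2) (tt : t' <= t).
Hypothesis mu1 : mu (~` eball (0, 0) 1) = 0%E.
Hypothesis mut : forall (p : R * R) (r : R), 0 < r -> (mu (eball p r) <= (C * r `^ t)%:E)%E.

Lemma pow4_le (i : nat) : C * (4 * 2 ^- i) `^ t <= 16 * C * (2 `^ t') ^- i.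
Proof.
have i0 : 0 < 2 ^- i :> R by rewrite invr_gt0 exprn_gt0.
have i1 : 2 ^- i <= 1 :> R by rewrite invf_le1 ?exprn_gt0// exprn_ege1// ler1n.
rewrite (mulrC 16) -mulrA ler_wpM2l// powRM ?(ltW i0)//.
rewrite ler_pM ?powR_ge0//.
  have -> : 16 = 4 `^ 2 :> R by rewrite -[X in _ `^ X]/(2%:R) powR_mulrn//; ring.
  by rewrite ler_powR ?ler1n//; case/andP: t12.
have -> : (2 `^ t') ^- i = (2 ^- i) `^ t'.
  rewrite -[(2 `^ t') ^+ i]powR_mulrn ?powR_ge0// powRAC powR_mulrn// -powR_inv1 ?powR_ge0//.
  by rewrite powRAC powR_inv1// exprn_ge0.
by rewrite ler_wniXn2l || (apply: ger_powR; rewrite ?i0).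
Qed.

Lemma mu_square_fin p : mu (square p) = (mass p)%:E.
Proof.
rewrite /mass fineK// ge0_fin_numE//.
apply: le_lt_trans (_ : mu (eball (sqcorner p) (4 * 2 ^- n)) < _)%E.
  apply: le_measure; rewrite ?inE; first exact: measurable_square.
    exact: measurable_eball.
  move=> z /square_near[h1 h2]; rewrite /eball /=.
  by apply: le_trans (edist_le2 h1 h2) _; have := ni0; lra.
by apply: le_lt_trans (mut _ _) (ltry _); rewrite mulr_gt0.
Qed.

Lemma mass_ge0 p : 0 <= mass p. Proof. exact: fine_ge0. Qed.

Lemma mass_sum_le (s : seq (int * int)) (c : R * R) (i : nat) : uniq s ->
  (forall p z, p \in s -> square p z -> eball c (4 * 2 ^- i) z) ->
  \sum_(p <- s) mass p <= 16 * C * (2 `^ t') ^- i.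
Proof.
move=> us sc; apply: le_trans (pow4_le i); rewrite -lee_fin -sumEFin.
have mS p : measurable (square p) by exact: measurable_square.
rewrite (eq_bigr (fun p => mu (square p))) => [|p _]; last by rewrite mu_square_fin.
rewrite -(measure_union_disjoint mu mS us) => [|p q z _ _]; last exact: square_disjoint.
apply: le_trans (_ : mu (eball c (4 * 2 ^- i)) <= _)%E.
  apply: le_measure; rewrite ?inE; first exact: union_of_measurable.
    exact: measurable_eball.
  by move=> z [p ps pz]; exact: sc ps pz.
by apply: mut; rewrite mulr_gt0// invr_gt0 exprn_gt0.
Qed.

(** The squares whose corners lie within [2 ^- i] of a corner, in each
coordinate, are contained in a ball of radius [4 * 2 ^- i], and
[4 `^ t <= 16]. *)
Lemma points_frostman : frostman points sqcorner mass (16 * C) (2 `^ t') n.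
Proof.
have up : uniq points by rewrite filter_uniq ?grid_uniq.
split.
  rewrite [leRHS](_ : _ = 16 * C * (2 `^ t') ^- 0); last by rewrite expr0 invr1 mulr1.
  apply: (@mass_sum_le _ (0, 0)) => // p z.
  rewrite mem_filter => /andP[_ pg] /(grid_square_bound pg)[z1 z2].
  rewrite /eball /= expr0 invr1 (_ : 4 * 1 = 2 * 2); last by ring.
  by apply: edist_le2; rewrite /= sub0r normrN.
move=> i p ij pp; rewrite -big_filter; apply: (@mass_sum_le _ (sqcorner p)).
  by rewrite filter_uniq.
move=> q z; rewrite mem_filter => /andP[sq _] /square_near[z1 z2].
move: sq; rewrite /sep ge_max => /andP[s1 s2].
have ni : 2 ^- n <= 2 ^- i :> R.
  by rewrite lef_pV2 ?posrE ?exprn_gt0// ler_weXn2l// ler1n.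
rewrite /eball /= (_ : 4 * 2 ^- i = 2 * (2 * 2 ^- i)); last by ring.
by apply: edist_le2; move: s1 s2 z1 z2; rewrite !ler_norml; lra.
Qed.

Lemma mu_total : mu setT = (\sum_(p <- points) mass p)%:E.
Proof.
have mS p : measurable (square p) by exact: measurable_square.
have gE : (\sum_(p <- points) mass p)%:E = (\sum_(p <- grid) mu (square p))%E.
  rewrite big_filter big_mkcond -sumEFin; apply: eq_bigr => p _.
  by rewrite mu_square_fin; case: eqP => [->|].
rewrite gE; apply/eqP; rewrite eq_le; apply/andP; split.
  apply: (@le_trans _ _ (mu (union_of square grid))); last exact: measure_union_le.
  have mE : measurable (eball (0, 0) 1 : set plane) by exact: measurable_eball.
  have mU := union_of_measurable mS grid.
  apply: (@le_trans _ _ (mu (union_of square grid `|` ~` eball (0, 0) 1))).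
    apply: le_measure; rewrite ?inE//.
      by apply: measurableU => //; exact: measurableC.
    move=> z _; have [ez|nz] := pselect (eball (0, 0) 1 z); last by right.
    left; exists (Num.floor (z.1 / 2 ^- n), Num.floor (z.2 / 2 ^- n)); last first.
      exact: mem_dyadic.
    have [z1 z2] := edist_coord ez; rewrite /= !sub0r !normrN in z1 z2.
    have H (c : R) : `|c| <= 1 -> Num.floor (c / 2 ^- n) \in rng.
      rewrite ler_norml => /andP[c1 c2].
      have E : (2 ^ n.+1)%N%:Z%:~R = 2 * 2 ^+ n :> R.
        by rewrite -[LHS]/((2 ^ n.+1)%N%:R) natrX exprS.
      have l1 : - (2 * 2 ^+ n) <= c / 2 ^- n.
        rewrite invrK -mulNr ler_pM2r//; lra.
      have l2 : c / 2 ^- n < 2 * 2 ^+ n.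
        rewrite invrK ltr_pM2r//; lra.
      rewrite mem_rng; apply/andP; split.
        by rewrite floor_ge_int rmorphN /= E.
      by rewrite -(ltr_int R) E; apply: le_lt_trans l2; exact: floor_le.
    by rewrite mem_grid /= !H.
  apply: le_trans (measureU2 mu mU (measurableC mE)) _.
  by rewrite -[leRHS]adde0 leeD// le_eqVlt; apply/orP; left; apply/eqP; exact: mu1.
rewrite -(measure_union_disjoint mu mS grid_uniq) => [|p q z _ _]; last exact: square_disjoint.
by apply: le_measure; rewrite ?inE//; exact: union_of_measurable.
Qed.

End Points.

(** * Proof of the theorem *)

Definition leaf_box (n N : nat) : seq (nat * int) :=
  [seq (k, i%:Z - N%:Z) | k <- iota 0 n, i <- iota 0 (2 * N).+1].

Lemma mem_leaf_box n N q : (q \in leaf_box n N) = (q.1 < n)%N && (`|q.2| <= N)%N.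
Proof.
apply/allpairsP/andP => [[[k i] []]|].
  by rewrite !mem_iota !add0n /= => kn iN ->; split=> //=; lia.
case: q => k l [kn lN]; rewrite /= in kn lN; exists (k, `|(l + N%:Z)%R|%N); split.
- by rewrite mem_iota.
- by rewrite mem_iota /=; lia.
by rewrite /=; congr pair; lia.
Qed.

Lemma leaf_box_uniq n N : uniq (leaf_box n N).
Proof.
apply: allpairs_uniq; rewrite ?iota_uniq// => -[a b] [a' b'] _ _ /= [-> h].
by congr pair; lia.
Qed.

Section Assembly.
Variable R : realType.
Implicit Types (n e : nat) (q v : nat * int).

Lemma leaf_anc n e q (z : R * R) : (e <= n)%N -> leaf n q z -> leaf (n - e) (anc e q) z.
Proof.
move=> en /leafE[/andP[t1 t2] /andP[u1 u2]]; apply/leafE.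
have n0 : 0 < 2 ^+ n :> R by rewrite exprn_gt0.
have f0 : 0 < 2 ^+ (n - e) :> R by rewrite exprn_gt0.
have e0 : 0 < 2 ^+ e :> R by rewrite exprn_gt0.
have E : 2 ^+ n = 2 ^+ e * 2 ^+ (n - e) :> R by rewrite -exprD subnKC.
have e0z : 0 < (2 ^ e)%N%:Z by rewrite ltz_nat expn_gt0.
have eR : (2 ^ e)%N%:Z%:~R = 2 ^+ e :> R by rewrite -natrX.
have eN : (2 ^ e)%N%:R = 2 ^+ e :> R by rewrite natrX.
split; apply/andP; split.
- apply: le_trans t1; rewrite /= E invfM mulrA ler_pM2r ?invr_gt0// ler_pdivlMr//.
  by rewrite -eN -natrM ler_nat leq_trunc_div.
- apply: lt_le_trans t2 _; rewrite /= E invfM mulrA ler_pM2r ?invr_gt0// ler_pdivrMr//.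
  by rewrite -eN !natr1 -natrM ler_nat ltn_ceil// expn_gt0.
- apply: le_trans u1; rewrite /= E invfM mulrA ler_pM2r ?invr_gt0// ler_pdivlMr//.
  by rewrite -eR -rmorphM ler_int lez_floor// gt_eqF.
apply: lt_le_trans u2 _; rewrite /= E invfM mulrA ler_pM2r ?invr_gt0// ler_pdivrMr//.
by rewrite -eR -[1]/(1%:~R) -!rmorphD -rmorphM ler_int lezD1 ltz_ceil.
Qed.

Lemma powR2_inv (s : R) i : (2 ^- i) `^ s = (2 `^ s) ^- i :> R.
Proof.
rewrite -[(2 `^ s) ^+ i]powR_mulrn ?powR_ge0// powRAC powR_mulrn// -powR_inv1 ?exprn_ge0//.
by rewrite powRAC powR_inv1 ?powR_ge0.
Qed.

(** Each node of side [rho] contains at most a fraction [2 * C * rho `^ s] of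
the covering number of [P], and these fractions add up to at least [1]. *)
Lemma delta_set_cover n (s C : R) (P : set (R * R)) (Lam : seq (nat * int))
    (B : nat -> seq (nat * int)) :
  0 <= s <= 1 -> 0 <= C -> delta_set (2 ^- n) s C P -> P !=set0 ->
  P `<=` [set z | exists2 q, q \in Lam & leaf n q z] ->
  (forall q, q \in Lam -> exists2 e, (e <= n)%N & anc e q \in B e) ->
  1 <= 2 * C * \sum_(e < n.+1)
    (count (fun v => has (fun q => anc e q == v) Lam) (B e))%:R * (2 `^ s) ^- (n - e).
Proof.
move=> /andP[s0 s1] C0 ds P0 PL LB.
set N := covering_number (2 ^- n) P.
have N1 : (1 <= N)%E by exact: cov_ge1.
have NL : (N <= (size Lam)%:R%:E)%E by exact: cov_leaves.
have Nfin : N \is a fin_num.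
  by rewrite ge0_fin_numE ?(le_trans _ N1)// (le_lt_trans NL)// ltry.
have [x Nx] : exists x, N = x%:E by exists (fine N); rewrite fineK.
have x1 : 1 <= x by rewrite -lee_fin -Nx.
have x0 : 0 < x by lra.
pose Be e := [seq v <- B e | has (fun q => anc e q == v) Lam].
pose E e : set (R * R) := [set z | exists2 v, v \in Be e & leaf (n - e) v z].
have PE : P `<=` [set z | exists2 e, e \in iota 0 n.+1 & E e z].
  move=> z /PL[q qL qz]; have [e en eB] := LB q qL.
  exists e; first by rewrite mem_iota add0n ltnS.
  exists (anc e q); last exact: leaf_anc.
  by rewrite mem_filter eB andbT; apply/hasP; exists q.
have step e : (e <= n)%N -> (covering_number (2 ^- n) (P `&` E e) <=
    ((size (Be e))%:R * (C * (2 * (2 `^ s) ^- (n - e)) * x))%:E)%E.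
  move=> en; apply: le_trans (@cov_sum _ (2 ^- n) _ (Be e) (fun v => leaf (n - e) v) _ _) _.
    by move=> z [_ Ez].
  set y := C * _ * x.
  have -> : ((size (Be e))%:R * y)%:E = (\sum_(v <- Be e) y%:E)%E.
    by rewrite sumEFin big_const_seq count_predT iter_addr_0 mulr_natl.
  apply: lee_sum => v _.
  have e1 : 0 < 2 ^- (n - e) :> R by rewrite invr_gt0 exprn_gt0.
  have ne : 2 ^- n <= 2 ^- (n - e) :> R.
    by rewrite lef_pV2 ?posrE ?exprn_gt0// ler_weXn2l ?ler1n// leq_subr.
  apply: le_trans (_ : covering_number (2 ^- n)
      (P `&` eball (corner R (n - e) v) (2 * 2 ^- (n - e))) <= _)%E.
    apply: cov_le => z [[Pz _] vz]; split=> //.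
    have [h1 h2] := leaf_near (corner_leaf R (n - e) v) vz.
    exact: edist_le2.
  apply: le_trans (ds _ _ _) _; first by lra.
  rewrite -/N Nx -EFinM lee_fin ler_wpM2r ?(ltW x0)// ler_wpM2l//.
  rewrite powRM ?(ltW e1)// powR2_inv ler_wpM2r ?invr_ge0 ?exprn_ge0 ?powR_ge0//.
  by rewrite -[leRHS]powRr1// ler_powR// ler1n.
have : (N <= \sum_(e <- iota 0 n.+1)
    ((size (Be e))%:R * (C * (2 * (2 `^ s) ^- (n - e)) * x))%:E)%E.
  apply: le_trans (cov_sum _ PE) _; rewrite big_seq [leRHS]big_seq.
  by apply: lee_sum => e; rewrite mem_iota add0n ltnS => /andP[_ /step].
rewrite sumEFin Nx lee_fin -[iota 0 n.+1]/(index_iota 0 n.+1) big_mkord.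
have -> : \sum_(e < n.+1) (size (Be e))%:R * (C * (2 * (2 `^ s) ^- (n - e)) * x) =
    x * (2 * C * \sum_(e < n.+1)
      (count (fun v => has (fun q => anc e q == v) Lam) (B e))%:R * (2 `^ s) ^- (n - e)).
  rewrite !mulr_sumr; apply: eq_bigr => e _; rewrite size_filter; ring.
by rewrite -[leLHS]mulr1 ler_pM2l.
Qed.

Lemma proj_near (y z : R * R) (th d : R) : `|y.1 - z.1| <= d -> `|y.2 - z.2| <= d ->
  `|proj y th - proj z th| <= 2 * d.
Proof. by move=> h1 h2; rewrite -proj_sub; exact: proj_le. Qed.

End Assembly.

Theorem theorem4p9 (R : realType) :
  (* K is the absolute constant of the Katz-Tao condition *)
  exists K : R, 0 < K /\
  forall t s sigma : R, 1 < t <= 2 -> 2 - t < s <= 1 -> 0 <= sigma < s ->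
  exists c : R, 0 < c /\
  forall C delta : R, 1 <= C -> dyadic_scale delta ->
  (* the product sigma-algebra is the Borel sigma-algebra of the plane, because
     the line is second countable *)
  forall mu : {measure set (measurableTypeR R * measurableTypeR R) -> \bar R},
  mu (~` eball (0, 0) 1) = 0%E ->
  (forall (p : R * R) (r : R), 0 < r -> (mu (eball p r) <= (C * r `^ t)%:E)%E) ->
  forall T : set (R * R) -> set (set (R * R)),
  (forall p, dyadic_meeting delta (spt mu) p ->
    [/\ T p `<=` dyadic_tube delta, T p !=set0, tube_delta_set delta s C (T p) &
        forall U, T p U -> U `&` p !=set0]) ->
  let TT := \bigcup_(p in dyadic_meeting delta (spt mu)) T p in
  ((c / C ^+ 3)%:E * mu setT <= tube_content delta (sigma + 1) TT)%E /\
  exists T' : set (set (R * R)),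
    [/\ T' `<=` TT, finite_set T', tube_katz_tao delta (sigma + 1) K T' &
        ((c / C ^+ 3 * delta `^ (- (sigma + 1)))%:E * mu setT <=
          (#|` fset_set T'|)%:R%:E)%E].
Proof.
exists (387 * 3 * 36 * 67 ^+ 2); split; first by lra.
move=> t s sigma /andP[t1 t2] /andP[ts s1] /andP[sg0 sgs].
(* the summation over shells needs an exponent below [2] *)
have [t' [tt t'1 t'2 ts']] : exists t' : R, [/\ t' <= t, 1 < t', t' < 2 & 2 - t' < s].
  have [h|h] := leP t (2 - s / 2).
    by exists t; split=> //; lra.
  by exists (2 - s / 2); split; lra.
(* the incidence bound needs [(sg' + 1) + t' >= 3] *)
have [sg' [sgg sg's sg't]] : exists sg' : R, [/\ sigma <= sg', sg' < s & 2 - t' <= sg'].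
  have [h|h] := leP (2 - t') sigma; first by exists sigma; split.
  by exists (2 - t'); split=> //; lra.
pose A : R := 2 `^ (sigma + 1); pose A' : R := 2 `^ (sg' + 1).
(* [gam ^+ 4 * A' ^+ 2] is [4 * (2 `^ s) ^+ 2] *)
pose gam : R := 2 `^ ((s - sg') / 2).
have e12 : 1 <= (2 : R) by rewrite ler1n.
have P0 (a : R) : 0 < 2 `^ a :> R by rewrite powR_gt0.
have Pe (k : nat) : 2 `^ (k%:R : R) = 2 ^+ k :> R by rewrite powR_mulrn.
have mono (a b : R) : a <= b -> 2 `^ a <= 2 `^ b :> R by move=> ab; rewrite ler_powR.
have powD (a b : R) : 2 `^ (a + b) = 2 `^ a * 2 `^ b :> R.
  by rewrite powRD// (_ : (2 : R) != 0) ?implybT// pnatr_eq0.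
have gt1 (a : R) : 0 < a -> 1 < 2 `^ a :> R.
  move=> a0; rewrite lt_def; apply/andP; split; last first.
    by rewrite -[leLHS](powRr0 2); apply: mono; exact: ltW.
  by rewrite powR_eq1; apply/negP => /or3P[/eqP| |/eqP]; lra.
have tau4 : 0 < 2 `^ t' < 4.
  rewrite P0 /=; apply: lt_le_trans (_ : 2 `^ 2 <= _); last by rewrite Pe; lra.
  rewrite -[2 as X in _ < _ `^ X](subrK t') powD.
  by rewrite ltr_pMl// gt1//; lra.
have A1 : 1 <= A by rewrite -[leLHS](powRr0 2); apply: mono; lra.
have AA : A <= A' by apply: mono; lra.
have At : 8 <= A' * 2 `^ t'.
  rewrite -powD.
  by apply: le_trans (_ : 2 `^ 3%:R <= _); [rewrite Pe; lra|apply: mono; lra].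
have g1 : 1 < gam by apply: gt1; lra.
have gA : gam ^+ 4 * A' ^+ 2 <= 4 * (2 `^ s) ^+ 2.
  have pow_exprn (a : R) (k : nat) : (2 `^ a) ^+ k = 2 `^ (a * k%:R).
    by rewrite -[LHS]powR_mulrn ?powR_ge0// powRrM.
  have -> : 4 = 2 `^ 2%:R :> R by rewrite Pe; ring.
  rewrite /gam /A' !pow_exprn -!powD.
  by rewrite le_eqVlt; apply/orP; left; apply/eqP; congr (_ `^ _); field.
have t02 : 0 <= t <= 2 by lra.
have s01 : 0 <= s <= 1 by lra.
have a12 : 1 <= sigma + 1 <= 2 by lra.
have le23 : 2 <= 3 :> R by lra.
have [c [c0 H]] := discrete_furstenberg tau4 A1 AA At (P0 s) g1 gA.
exists (c / (16 ^+ 3 * 387)); split; first by lra.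
move=> C delta C1 [n _ <-] mu mu1 mut T HT TT.
have n0 : 0 < 2 ^+ n :> R by rewrite exprn_gt0.
have ni0 : 0 < 2 ^- n :> R by rewrite invr_gt0.
have Cp : 0 < C by apply: lt_le_trans C1.
have C0 : 0 <= C by exact: ltW.
pose pts := points n mu; pose m := mass n mu.
have inT p q : p \in pts -> T (square n p) (tube (leaf n q)) -> exists z : R * R,
    [/\ square n p z, tube (leaf n q) z, `|z.1| <= 2 & `|z.2| <= 2].
  move=> pp Tq; have pg : p \in grid n by move: pp; rewrite mem_filter => /andP[].
  have [_ _ _ /(_ _ Tq)[z [tz pz]]] := HT _ (points_meet pp).
  by have [z1 z2] := grid_square_bound pg pz; exists z.
(* by [leaf_offset_bound], it contains all squares whose tubes meet the grid *)
pose box := leaf_box (2 ^ n) (7 * 2 ^ n).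
have mem_box q : (q.1 < 2 ^ n)%N -> (`|q.2| <= 7 * 2 ^ n)%N -> q \in box.
  by rewrite mem_leaf_box => -> ->.
have boxP q : q \in box -> (q.1 < 2 ^ n)%N /\ (`|q.2| <= 7 * 2 ^ n)%N.
  by rewrite mem_leaf_box => /andP[].
have box_uniq : uniq box by exact: leaf_box_uniq.
pose Lam p : seq (nat * int) := [seq q <- box | `[< T (square n p) (tube (leaf n q)) >]].
pose S := [seq q <- box | has (fun p => `[< T (square n p) (tube (leaf n q)) >]) pts].
have SP q : q \in S -> [/\ (q.1 < 2 ^ n)%N, (`|q.2| <= 7 * 2 ^ n)%N &
    exists2 p, p \in pts & T (square n p) (tube (leaf n q))].
  rewrite mem_filter => /andP[/hasP[p pp /asboolP Tq] /boxP[q1 q2]].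
  by split=> //; exists p.
have m0 p : 0 <= m p by exact: mass_ge0.
have xb p : p \in pts -> `|(sqcorner R n p).1| <= 2 /\ `|(sqcorner R n p).2| <= 2.
  by rewrite mem_filter => /andP[_]; exact: grid_bound.
have C16 : 1 <= 16 * C by clear -C1; lra.
have F := points_frostman n C0 t02 tt mut.
have Sn q : q \in S -> (q.1 < 2 ^ n)%N by case/SP.
have LamS p q : p \in pts -> q \in Lam p -> q \in S /\ incident n (sqcorner R n p) q.
  move=> pp; rewrite mem_filter => /andP[/asboolP Tq qb]; split.
    by rewrite mem_filter qb andbT; apply/hasP; exists p => //; apply/asboolP.
  have [z [pz /tube_leafE[th [u [/leafE[/= /andP[h1 h2] /andP[h3 h4]] e]]] _ _]] := inT p q pp Tq.
  exists th, u; rewrite h1 ltW//= /lo h3 /hi rmorphD ltW//=; split=> //.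
  rewrite -e; have [d1 d2] := square_near pz.
  exact: proj_near.
have cov p (B : nat -> seq (nat * int)) : p \in pts ->
    (forall q, q \in Lam p -> exists2 e, (e <= n)%N & anc e q \in B e) ->
    1 <= 16 * C * \sum_(e < n.+1)
      (count (fun v => has (fun q => anc e q == v) (Lam p)) (B e))%:R * (2 `^ s) ^- (n - e).
  move=> pp LB; have [Tsub [U TU] ds _] := HT _ (points_meet pp).
  apply: le_trans (@delta_set_cover R n s C _ (Lam p) B _ C0 ds _ _ LB) _.
  - exact: s01.
  - have [Q Qs UQ] := Tsub _ TU; have [q qn QE] := (param_squareP _ _).1 Qs.
    exists (corner R n q); exists Q; last by rewrite QE; exact: corner_leaf.
    by split=> //; rewrite UQ.
  - move=> z [Q [/param_squareP[q qn ->] TQ] qz]; exists q => //.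
    rewrite mem_filter; apply/andP; split; first exact/asboolP.
    have [w [_ tw w1 w2]] := inT p q pp TQ.
    apply: mem_box => //.
    exact: leaf_offset_bound tw (le_trans w1 le23) (le_trans w2 le23).
  rewrite ler_wpM2r//; last by clear -C1; lra.
  by apply: sumr_ge0 => e _; rewrite mulr_ge0// invr_ge0 exprn_ge0// ltW.
have [X [XS kt Xsize]] := H _ pts (sqcorner R n) m (16 * C) n S Lam m0 xb C16 F Sn LamS cov.
clear H cov F LamS.
have Mt : mu setT = (\sum_(p <- pts) m p)%:E by exact: (mu_total n mu1 mut).
set M := \sum_(p <- pts) m p in Xsize Mt.
have M0 : 0 <= M by apply: sumr_ge0.
have XP q : q \in X -> q \in S by move=> qX; exact: mem_subseq XS _ qX.
have Xn q : q \in X -> (q.1 < 2 ^ n)%N by move=> /XP/SP[].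
have Xo q : q \in X -> (`|q.2| <= 7 * 2 ^ n)%N by move=> /XP/SP[].
have Xt q : q \in X -> exists z : R * R, [/\ tube (leaf n q) z, `|z.1| <= 3 & `|z.2| <= 3].
  move=> /XP/SP[_ _ [p pp /(inT _ _ pp)[z [_ tz z1 z2]]]].
  by exists z; split; rewrite // (le_trans _ le23).
have Xu : uniq X by rewrite (subseq_uniq XS)// filter_uniq.
have XTT q : q \in X -> TT (tube (leaf n q)).
  by move=> /XP/SP[_ _ [p pp Tq]]; exists (square n p) => //; exact: points_meet.
have dE : (2 ^- n) `^ (- (sigma + 1)) = A ^+ n :> R.
  by rewrite powRN powR2_inv invrK.
have dA : (2 ^- n) `^ (sigma + 1) = (A ^+ n)^-1 :> R by rewrite powR2_inv.
have An : 0 < A ^+ n by rewrite exprn_gt0//; exact: P0.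
have C3 : 0 < C ^+ 3 by rewrite exprn_gt0.
have Xs : c / 16 ^+ 3 / C ^+ 3 * M * A ^+ n <= (size X)%:R.
  apply: le_trans Xsize; rewrite le_eqVlt; apply/orP; left; apply/eqP.
  by rewrite exprMn; field; rewrite gt_eqF.
have Y0 : 0 <= c / 16 ^+ 3 / C ^+ 3 * M * A ^+ n.
  by rewrite !mulr_ge0 ?invr_ge0 ?(ltW c0) ?(ltW C3) ?(ltW An).
split.
  apply: le_trans (content_ge a12 erefl _ kt _); last 2 first.
  - by move=> q qX; split; [exact: Xn|exact: Xo].
  - move=> q qX; exists (leaf n q); last exact: corner_leaf.
    split; last exact: XTT.
    by apply/param_squareP; exists q => //; exact: Xn.
  rewrite Mt -EFinM lee_fin dA.
  have : c / 16 ^+ 3 / C ^+ 3 * M <= (size X)%:R / A ^+ n by rewrite ler_pdivlMr.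
  have : 0 <= c / 16 ^+ 3 / C ^+ 3 * M by rewrite !mulr_ge0 ?invr_ge0 ?(ltW c0) ?(ltW C3).
  have -> : c / (16 ^+ 3 * 387) / C ^+ 3 * M = c / 16 ^+ 3 / C ^+ 3 * M / 387.
    by field; rewrite gt_eqF.
  by clear; lra.
exists [set` tubes_of R n X]; split.
- by move=> U /mapP[q qX ->]; exact: XTT.
- exact: finite_seq.
- exact: (tubes_of_kt Xn Xt a12 erefl Xo kt).
rewrite Mt -EFinM lee_fin dE.
have szT : #|` fset_set [set` tubes_of R n X]| = size (undup (tubes_of R n X)).
  have -> : [set` tubes_of R n X] = [set` [fset U in tubes_of R n X]%fset].
    by apply/seteqP; split=> U /=; rewrite inE.
  by rewrite set_fsetK card_fseq.
rewrite szT.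
have : (size X)%:R <= 387 * (size (undup (tubes_of R n X)))%:R :> R.
  by rewrite -natrM ler_nat; exact: size_tubes_of.
have -> : c / (16 ^+ 3 * 387) / C ^+ 3 * A ^+ n * M = c / 16 ^+ 3 / C ^+ 3 * M * A ^+ n / 387.
  by field; rewrite gt_eqF.
by move: Y0 Xs; clear; lra.
Qed.
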